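(* Let $k$ be a commutative ring, $I$ a set, $Q=(Q_{ij})_{i,j\in I}$ a matrix with entries in $k[u,v]$ with $Q_{ii}=0$ for all $i\in I$, and let $n\ge 2$. Let $H_n(Q)$ be the algebra and $S\subset H_n(Q)$ the family defined in the context. The following assertions are equivalent: (1) $H_n(Q)$ satisfies the PBW property, i.e. the surjective algebra morphism $k^{(I)}[x]\wr {}^0H_n^f\to \mathrm{gr}\, H_n(Q)$, $T_i1_\nu\mapsto\tau_{i,\nu}$, is an isomorphism; (2) $H_n(Q)$ is a free $k$-module with basis $S$; (3) $Q_{ij}(u,v)=Q_{ji}(v,u)$ for all $i,j\in I$.
   Context: Let $L=I^n$, on which the symmetric group $\mathfrak S_n$ acts by permuting entries, $s_i=(i,i+1)$. $H_n(Q)$ is the (possibly non-unitary) $k$-algebra generated by $1_\nu$, $x_{i,\nu}$ ($1\le i\le n$), $\tau_{i,\nu}$ ($1\le i\le n-1$), $\nu\in L$, with relations (for all admissible indices): - $1_\nu1_{\nu'}=\delta_{\nu,\nu'}1_\nu$, $\tau_{i,\nu}=1_{s_i(\nu)}\tau_{i,\nu}1_\nu$, $x_{a,\nu}=1_\nu x_{a,\nu}1_\nu$, $x_{a,\nu}x_{b,\nu}=x_{b,\nu}x_{a,\nu}$; - $\tau_{i,s_i(\nu)}\tau_{i,\nu}=Q_{\nu_i,\nu_{i+1}}(x_{i,\nu},x_{i+1,\nu})$; - $\tau_{i,s_j(\nu)}\tau_{j,\nu}=\tau_{j,s_i(\nu)}\tau_{i,\nu}$ if $|i-j|>1$; - $\tau_{i+1,s_is_{i+1}(\nu)}\tau_{i,s_{i+1}(\nu)}\tau_{i+1,\nu}-\tau_{i,s_{i+1}s_i(\nu)}\tau_{i+1,s_i(\nu)}\tau_{i,\nu}$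 equals $(x_{i+2,\nu}-x_{i,\nu})^{-1}\bigl(Q_{\nu_i,\nu_{i+1}}(x_{i+2,\nu},x_{i+1,\nu})-Q_{\nu_i,\nu_{i+1}}(x_{i,\nu},x_{i+1,\nu})\bigr)$ (a polynomial) if $\nu_i=\nu_{i+2}$, and $0$ otherwise; - $\tau_{i,\nu}x_{a,\nu}-x_{s_i(a),s_i(\nu)}\tau_{i,\nu}$ equals $-1_\nu$ if $a=i$ and $\nu_i=\nu_{i+1}$, $1_\nu$ if $a=i+1$ and $\nu_i=\nu_{i+1}$, and $0$ otherwise. The family $S$: fix a set $J$ of finite sequences of elements of $\{1,\dots,n-1\}$ consisting of one reduced expression for each element of $\mathfrak S_n$ (so $\{s_{i_1}\cdots s_{i_r}\}_{(i_1,\dots,i_r)\in J}$ runs over $\mathfrak S_n$ with minimal length expressions). Then $$S=\{\tau_{i_1,s_{i_2}\cdots s_{i_r}(\nu)}\cdots\tau_{i_r,\nu}\,x_{1,\nu}^{a_1}\cdots x_{n,\nu}^{a_n}\}_{(i_1,\dots,i_r)\in J,\ (a_1,\dots,a_n)\in\mathbb Z_{\ge0}^n,\ \nu\in L}.$$ The algebra $H_n(Q)$ is filtered with $1_\nu,x_{i,\nu}$ in degree $0$ and $\tau_{i,\nu}$ in degree $1$. ${}^0H_n^f$ is the nil Hecke algebra: the $\mathbb Z$-algebra generated by $T_1,\dots,T_{n-1}$ with $T_iT_{i+1}T_i=T_{i+1}T_iT_{i+1}$, $T_iT_j=T_jT_i$ if $|i-j|>1$, $T_i^2=0$. For an algebra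 $A$, $A\wr{}^0H_n^f$ is $A^{\otimes n}\otimes{}^0H_n^f$ with $A^{\otimes n}$ and ${}^0H_n^f$ subalgebras and $(a_1\otimes\cdots\otimes a_n)T_i=T_i(a_1\otimes\cdots\otimes a_{i-1}\otimes a_{i+1}\otimes a_i\otimes a_{i+2}\otimes\cdots\otimes a_n)$. Here $k^{(I)}$ is the direct sum of copies of $k$ indexed by $I$ with idempotents $1_s$, $s\in I$; $1_\nu=1_{\nu_1}\otimes\cdots\otimes1_{\nu_n}$. The morphism to $\mathrm{gr}\,H_n(Q)$ extends the morphism $(k^{(I)}[x])^{\otimes n}\to H_n(Q)$, $x_i1_\nu\mapsto x_{i,\nu}$. *)

(* Defs.v *)
From HB Require Import structures.
From mathcomp Require Import all_boot all_order all_fingroup all_algebra.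
From mathcomp Require Import finmap mpoly zify.
From mathcomp Require Import generic_quotient boolp.

Set Implicit Arguments.
Unset Strict Implicit.
Unset Printing Implicit Defensive.

Import GRing.Theory.
Local Open Scope ring_scope.
Local Open Scope quotient_scope.

(* Algebras are associative but not necessarily unital. *)
HB.mixin Record Lmodule_isNUAlgebra (k : pzRingType) A of GRing.Lmodule k A := {
  nmul : A -> A -> A;
  nmulA : associative nmul;
  nmulDl : left_distributive nmul +%R;
  nmulDr : right_distributive nmul +%R;
  nmulZl : forall (c : k) a b, nmul (c *: a) b = c *: nmul a b;
  nmulZr : forall (c : k) a b, nmul a (c *: b) = c *: nmul a b
}.

#[short(type="nuAlgType")]
HB.structure Definition NUAlgebra (k : pzRingType) :=
  {A of Lmodule_isNUAlgebra k A & GRing.Lmodule k A}.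

Notation "a ** b" := (nmul a b) (at level 40, left associativity) : ring_scope.

(* Modules and algebras given by generators and relations. The relations are
   given as a predicate on families of elements of an arbitrary module (resp.
   algebra), and two formal expressions are identified when they take the same
   value at every family satisfying the relations. *)

Section PresentedModule.
Variables (k : pzRingType) (X : Type).

Inductive mterm : Type :=
  | MGen of X | MZero | MAdd of mterm & mterm | MOpp of mterm
  | MScale of k & mterm.

HB.instance Definition _ := gen_eqMixin mterm.
HB.instance Definition _ := gen_choiceMixin mterm.

Fixpoint meval (V : lmodType k) (f : X -> V) (t : mterm) : V :=
  match t with
  | MGen x => f x
  | MZero => 0
  | MAdd s t => meval f s + meval f t
  | MOpp s => - meval f s
  | MScale c s => c *: meval f s
  end.

Variable R : forall V : lmodType k, (X -> V) -> Prop.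

Definition meqv : rel mterm := fun s t =>
  `[< forall (V : lmodType k) (f : X -> V), R f -> meval f s = meval f t >].

Lemma meqv_refl : reflexive meqv. Proof. by move=> s; apply/asboolP. Qed.
Lemma meqv_sym : ssrbool.symmetric meqv.
Proof.
by move=> s t; apply/asboolP/asboolP => H V f Rf; rewrite (H V f Rf).
Qed.
Lemma meqv_trans : transitive meqv.
Proof.
move=> s t u /asboolP H1 /asboolP H2; apply/asboolP => V f Rf.
by rewrite (H1 V f Rf) (H2 V f Rf).
Qed.
Canonical meqv_equiv := EquivRel meqv meqv_refl meqv_sym meqv_trans.

Definition pmod := {eq_quot meqv_equiv}.
HB.instance Definition _ := Choice.on pmod.

Definition pmod_gen (x : X) : pmod := \pi_pmod (MGen x).

Section Lift.
Variables (V : lmodType k) (f : X -> V).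
Definition pmod_lift (a : pmod) : V := meval f (repr a).

Hypothesis Rf : R f.
Lemma pmod_lift_pi t : pmod_lift (\pi_pmod t) = meval f t.
Proof.
have /eqmodP/asboolP : repr (\pi_pmod t) = t %[mod pmod] by rewrite reprK.
exact.
Qed.
End Lift.

Lemma pmod_ext (a b : pmod) :
  (forall (V : lmodType k) (f : X -> V), R f -> pmod_lift f a = pmod_lift f b) ->
  a = b.
Proof.
by move=> H; rewrite -[a]reprK -[b]reprK; apply/eqmodP/asboolP => V f /H.
Qed.

Definition pmod_zero : pmod := \pi_pmod MZero.
Definition pmod_add (a b : pmod) : pmod := \pi_pmod (MAdd (repr a) (repr b)).
Definition pmod_opp (a : pmod) : pmod := \pi_pmod (MOpp (repr a)).
Definition pmod_scale c (a : pmod) : pmod := \pi_pmod (MScale c (repr a)).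

Section LiftOps.
Variables (V : lmodType k) (f : X -> V) (Rf : R f).
Local Notation ev := (pmod_lift f).
Lemma pmod_ev0 : ev pmod_zero = 0. Proof. exact: pmod_lift_pi. Qed.
Lemma pmod_evD a b : ev (pmod_add a b) = ev a + ev b.
Proof. exact: pmod_lift_pi. Qed.
Lemma pmod_evN a : ev (pmod_opp a) = - ev a. Proof. exact: pmod_lift_pi. Qed.
Lemma pmod_evZ c a : ev (pmod_scale c a) = c *: ev a.
Proof. exact: pmod_lift_pi. Qed.
Definition pmod_evE := (pmod_ev0, pmod_evD, pmod_evN, pmod_evZ).
End LiftOps.

Lemma pmod_addrA : associative pmod_add.
Proof. by move=> a b c; apply: pmod_ext => V f Rf; rewrite !(pmod_evE Rf) addrA. Qed.
Lemma pmod_addrC : commutative pmod_add.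
Proof. by move=> a b; apply: pmod_ext => V f Rf; rewrite !(pmod_evE Rf) addrC. Qed.
Lemma pmod_add0r : left_id pmod_zero pmod_add.
Proof. by move=> a; apply: pmod_ext => V f Rf; rewrite !(pmod_evE Rf) add0r. Qed.
Lemma pmod_addNr : left_inverse pmod_zero pmod_opp pmod_add.
Proof. by move=> a; apply: pmod_ext => V f Rf; rewrite !(pmod_evE Rf) addNr. Qed.
HB.instance Definition _ :=
  GRing.isZmodule.Build pmod pmod_addrA pmod_addrC pmod_add0r pmod_addNr.

Lemma pmod_scaleA c d a : pmod_scale c (pmod_scale d a) = pmod_scale (c * d) a.
Proof. by apply: pmod_ext => V f Rf; rewrite !(pmod_evE Rf) scalerA. Qed.
Lemma pmod_scale1 : left_id 1 pmod_scale.
Proof. by move=> a; apply: pmod_ext => V f Rf; rewrite !(pmod_evE Rf) scale1r. Qed.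
Lemma pmod_scaleDr : right_distributive pmod_scale +%R.
Proof. by move=> c a b; apply: pmod_ext => V f Rf; rewrite !(pmod_evE Rf) scalerDr. Qed.
Lemma pmod_scaleDl a : {morph pmod_scale^~ a : c d / c + d}.
Proof. by move=> c d; apply: pmod_ext => V f Rf; rewrite !(pmod_evE Rf) scalerDl. Qed.
HB.instance Definition _ :=
  GRing.Zmodule_isLmodule.Build k pmod pmod_scaleA pmod_scale1 pmod_scaleDr pmod_scaleDl.

Section LiftTheory.
Variables (V : lmodType k) (f : X -> V).
Hypothesis Rf : R f.

Lemma pmod_lift_gen x : pmod_lift f (pmod_gen x) = f x.
Proof. exact: pmod_lift_pi. Qed.

Lemma pmod_lift_linear : linear (pmod_lift f).
Proof. by move=> c a b; rewrite (@pmod_evD _ _ Rf) (@pmod_evZ _ _ Rf). Qed.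
End LiftTheory.

Lemma pmod_ind (P : pmod -> Prop) :
  (forall x, P (pmod_gen x)) -> P 0 ->
  (forall c a b, P a -> P b -> P (c *: a + b)) -> forall a, P a.
Proof.
move=> Pg P0 Pl a; rewrite -[a]reprK; elim: (repr a) => [x||s IHs t IHt|s IHs|c s IHs].
- exact: Pg.
- exact: P0.
- have -> : (\pi_pmod (MAdd s t) : pmod) = 1 *: (\pi_pmod s : pmod) + (\pi_pmod t : pmod).
    by rewrite scale1r; apply: pmod_ext => V f Rf; rewrite !(pmod_evE Rf) !pmod_lift_pi.
  exact: Pl.
- have -> : (\pi_pmod (MOpp s) : pmod) = - 1 *: (\pi_pmod s : pmod) + 0.
    by rewrite addr0 scaleN1r; apply: pmod_ext => V f Rf; rewrite !(pmod_evE Rf) !pmod_lift_pi.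
  exact: Pl.
- have -> : (\pi_pmod (MScale c s) : pmod) = c *: (\pi_pmod s : pmod) + 0.
    by rewrite addr0; apply: pmod_ext => V f Rf; rewrite !(pmod_evE Rf) !pmod_lift_pi.
  exact: Pl.
Qed.
End PresentedModule.

Section PresentedAlgebra.
Variables (k : pzRingType) (X : Type).

Inductive aterm : Type :=
  | AGen of X | AZero | AAdd of aterm & aterm | AOpp of aterm
  | AScale of k & aterm | AMul of aterm & aterm.

HB.instance Definition _ := gen_eqMixin aterm.
HB.instance Definition _ := gen_choiceMixin aterm.

Fixpoint aeval (A : nuAlgType k) (f : X -> A) (t : aterm) : A :=
  match t with
  | AGen x => f x
  | AZero => 0
  | AAdd s t => aeval f s + aeval f t
  | AOpp s => - aeval f s
  | AScale c s => c *: aeval f s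
  | AMul s t => aeval f s ** aeval f t
  end.

Variable R : forall A : nuAlgType k, (X -> A) -> Prop.

Definition aeqv : rel aterm := fun s t =>
  `[< forall (A : nuAlgType k) (f : X -> A), R f -> aeval f s = aeval f t >].

Lemma aeqv_refl : reflexive aeqv. Proof. by move=> s; apply/asboolP. Qed.
Lemma aeqv_sym : ssrbool.symmetric aeqv.
Proof.
by move=> s t; apply/asboolP/asboolP => H A f Rf; rewrite (H A f Rf).
Qed.
Lemma aeqv_trans : transitive aeqv.
Proof.
move=> s t u /asboolP H1 /asboolP H2; apply/asboolP => A f Rf.
by rewrite (H1 A f Rf) (H2 A f Rf).
Qed.
Canonical aeqv_equiv := EquivRel aeqv aeqv_refl aeqv_sym aeqv_trans.

Definition palg := {eq_quot aeqv_equiv}.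
HB.instance Definition _ := Choice.on palg.

Definition palg_gen (x : X) : palg := \pi_palg (AGen x).

Section Lift.
Variables (A : nuAlgType k) (f : X -> A).
Definition palg_lift (a : palg) : A := aeval f (repr a).

Hypothesis Rf : R f.
Lemma palg_lift_pi t : palg_lift (\pi_palg t) = aeval f t.
Proof.
have /eqmodP/asboolP : repr (\pi_palg t) = t %[mod palg] by rewrite reprK.
exact.
Qed.
End Lift.

Lemma palg_ext (a b : palg) :
  (forall (A : nuAlgType k) (f : X -> A), R f -> palg_lift f a = palg_lift f b) ->
  a = b.
Proof.
by move=> H; rewrite -[a]reprK -[b]reprK; apply/eqmodP/asboolP => A f /H.
Qed.

Definition palg_zero : palg := \pi_palg AZero.
Definition palg_add (a b : palg) : palg := \pi_palg (AAdd (repr a) (repr b)).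
Definition palg_opp (a : palg) : palg := \pi_palg (AOpp (repr a)).
Definition palg_scale c (a : palg) : palg := \pi_palg (AScale c (repr a)).
Definition palg_mul (a b : palg) : palg := \pi_palg (AMul (repr a) (repr b)).

Section LiftOps.
Variables (A : nuAlgType k) (f : X -> A) (Rf : R f).
Local Notation ev := (palg_lift f).
Lemma palg_ev0 : ev palg_zero = 0. Proof. exact: palg_lift_pi. Qed.
Lemma palg_evD a b : ev (palg_add a b) = ev a + ev b.
Proof. exact: palg_lift_pi. Qed.
Lemma palg_evN a : ev (palg_opp a) = - ev a. Proof. exact: palg_lift_pi. Qed.
Lemma palg_evZ c a : ev (palg_scale c a) = c *: ev a.
Proof. exact: palg_lift_pi. Qed.
Lemma palg_evM a b : ev (palg_mul a b) = ev a ** ev b.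
Proof. exact: palg_lift_pi. Qed.
Definition palg_evE := (palg_ev0, palg_evD, palg_evN, palg_evZ, palg_evM).
End LiftOps.

Lemma palg_addrA : associative palg_add.
Proof. by move=> a b c; apply: palg_ext => A f Rf; rewrite !(palg_evE Rf) addrA. Qed.
Lemma palg_addrC : commutative palg_add.
Proof. by move=> a b; apply: palg_ext => A f Rf; rewrite !(palg_evE Rf) addrC. Qed.
Lemma palg_add0r : left_id palg_zero palg_add.
Proof. by move=> a; apply: palg_ext => A f Rf; rewrite !(palg_evE Rf) add0r. Qed.
Lemma palg_addNr : left_inverse palg_zero palg_opp palg_add.
Proof. by move=> a; apply: palg_ext => A f Rf; rewrite !(palg_evE Rf) addNr. Qed.
HB.instance Definition _ :=
  GRing.isZmodule.Build palg palg_addrA palg_addrC palg_add0r palg_addNr.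

Lemma palg_scaleA c d a : palg_scale c (palg_scale d a) = palg_scale (c * d) a.
Proof. by apply: palg_ext => A f Rf; rewrite !(palg_evE Rf) scalerA. Qed.
Lemma palg_scale1 : left_id 1 palg_scale.
Proof. by move=> a; apply: palg_ext => A f Rf; rewrite !(palg_evE Rf) scale1r. Qed.
Lemma palg_scaleDr : right_distributive palg_scale +%R.
Proof. by move=> c a b; apply: palg_ext => A f Rf; rewrite !(palg_evE Rf) scalerDr. Qed.
Lemma palg_scaleDl a : {morph palg_scale^~ a : c d / c + d}.
Proof. by move=> c d; apply: palg_ext => A f Rf; rewrite !(palg_evE Rf) scalerDl. Qed.
HB.instance Definition _ :=
  GRing.Zmodule_isLmodule.Build k palg palg_scaleA palg_scale1 palg_scaleDr palg_scaleDl.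

Lemma palg_mulA : associative palg_mul.
Proof. by move=> a b c; apply: palg_ext => A f Rf; rewrite !(palg_evE Rf) nmulA. Qed.
Lemma palg_mulDl : left_distributive palg_mul +%R.
Proof. by move=> a b c; apply: palg_ext => A f Rf; rewrite !(palg_evE Rf) nmulDl. Qed.
Lemma palg_mulDr : right_distributive palg_mul +%R.
Proof. by move=> a b c; apply: palg_ext => A f Rf; rewrite !(palg_evE Rf) nmulDr. Qed.
Lemma palg_mulZl (c : k) a b : palg_mul (c *: a) b = c *: palg_mul a b.
Proof. by apply: palg_ext => A f Rf; rewrite !(palg_evE Rf) nmulZl. Qed.
Lemma palg_mulZr (c : k) a b : palg_mul a (c *: b) = c *: palg_mul a b.
Proof. by apply: palg_ext => A f Rf; rewrite !(palg_evE Rf) nmulZr. Qed.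
HB.instance Definition _ := Lmodule_isNUAlgebra.Build k palg
  palg_mulA palg_mulDl palg_mulDr palg_mulZl palg_mulZr.

Section LiftTheory.
Variables (A : nuAlgType k) (f : X -> A).
Hypothesis Rf : R f.

Lemma palg_lift_gen x : palg_lift f (palg_gen x) = f x.
Proof. exact: palg_lift_pi. Qed.

Lemma palg_lift_linear : linear (palg_lift f).
Proof. by move=> c a b; rewrite (@palg_evD _ _ Rf) (@palg_evZ _ _ Rf). Qed.

Lemma palg_liftM a b : palg_lift f (a ** b) = palg_lift f a ** palg_lift f b.
Proof. exact: palg_lift_pi. Qed.
End LiftTheory.

Lemma palg_ind (P : palg -> Prop) :
  (forall x, P (palg_gen x)) -> P 0 ->
  (forall c a b, P a -> P b -> P (c *: a + b)) ->
  (forall a b, P a -> P b -> P (a ** b)) -> forall a, P a.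
Proof.
move=> Pg P0 Pl Pm a; rewrite -[a]reprK.
elim: (repr a) => [x||s IHs t IHt|s IHs|c s IHs|s IHs t IHt].
- exact: Pg.
- exact: P0.
- have -> : (\pi_palg (AAdd s t) : palg) = 1 *: (\pi_palg s : palg) + (\pi_palg t : palg).
    by rewrite scale1r; apply: palg_ext => V f Rf; rewrite !(palg_evE Rf) !palg_lift_pi.
  exact: Pl.
- have -> : (\pi_palg (AOpp s) : palg) = - 1 *: (\pi_palg s : palg) + 0.
    by rewrite addr0 scaleN1r; apply: palg_ext => V f Rf; rewrite !(palg_evE Rf) !palg_lift_pi.
  exact: Pl.
- have -> : (\pi_palg (AScale c s) : palg) = c *: (\pi_palg s : palg) + 0.
    by rewrite addr0; apply: palg_ext => V f Rf; rewrite !(palg_evE Rf) !palg_lift_pi.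
  exact: Pl.
- have -> : (\pi_palg (AMul s t) : palg) = (\pi_palg s : palg) ** (\pi_palg t : palg).
    by apply: palg_ext => V f Rf; rewrite !(palg_evE Rf) !palg_lift_pi.
  exact: Pm.
Qed.
End PresentedAlgebra.

Section Graded.
Variables (k : comPzRingType) (H : nuAlgType k).

Record filtration := Filtration {
  fil :> nat -> H -> Prop;
  fil0 : forall d, fil d 0;
  fil_lin : forall d c a b, fil d a -> fil d b -> fil d (c *: a + b);
  filS : forall d a, fil d a -> fil d.+1 a;
  filM : forall d e a b, fil d a -> fil e b -> fil (d + e) (a ** b)
}.

Variable F : filtration.

Record felt := FElt { fdeg : nat; fval : H; fvalP : F fdeg fval }.

Lemma felt_eq (x y : felt) : fdeg x = fdeg y -> fval x = fval y -> x = y.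
Proof.
case: x y => [d a Fa] [e b Fb] /= Ed Ea; move: Fa Fb; rewrite Ed Ea => Fa Fb.
by rewrite (Prop_irrelevance Fa Fb).
Qed.

(* gr H, the direct sum over d of F_d / F_(d-1), is the module generated by the
   symbols of the pairs (d, a) with a in F_d; these symbols are linear in a for
   fixed d, and vanish when a lies in F_(d-1). For d = 0 linearity suffices,
   as F_(-1) = 0. *)
Definition gr_rel (V : lmodType k) (f : felt -> V) : Prop :=
  (forall d c a b (Fa : F d a) (Fb : F d b) (Fab : F d (c *: a + b)),
      f (FElt Fab) = c *: f (FElt Fa) + f (FElt Fb)) /\
  (forall d a (Fa : F d a) (Fa' : F d.+1 a), f (FElt Fa') = 0).

Definition gr := pmod gr_rel.
HB.instance Definition _ := GRing.Lmodule.on gr.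

Definition gr_class d a (Fa : F d a) : gr := pmod_gen gr_rel (FElt Fa).

Lemma gr_gen_rel : gr_rel (pmod_gen gr_rel).
Proof.
split=> [d c a b Fa Fb Fab|d a Fa Fa']; apply: pmod_ext => V f Rf.
  by rewrite (pmod_lift_linear Rf) !(pmod_lift_gen Rf) (Rf.1 _ _ _ _ Fa Fb).
by rewrite (pmod_ev0 Rf) (pmod_lift_gen Rf) (Rf.2 _ _ Fa).
Qed.

Definition felt_mul (x y : felt) : felt := FElt (filM (fvalP x) (fvalP y)).
Definition gr_mul1 (x : felt) : gr -> gr :=
  pmod_lift (fun y => pmod_gen gr_rel (felt_mul x y)).
Definition gr_mul (a b : gr) : gr := pmod_lift (gr_mul1^~ b) a.

Lemma gr_mul1_rel x : gr_rel (fun y => pmod_gen gr_rel (felt_mul x y)).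
Proof.
case: x => e z Fz; split=> [d c a b Fa Fb Fab|d a Fa Fa'].
  rewrite -(gr_gen_rel.1 _ _ _ _ _ _ (fil_lin c (filM Fz Fa) (filM Fz Fb))).
  by congr pmod_gen; apply: felt_eq; rewrite //= nmulDr nmulZr.
rewrite -(gr_gen_rel.2 _ _ (filM Fz Fa) (filS (filM Fz Fa))).
by congr pmod_gen; apply: felt_eq; rewrite //= addnS.
Qed.

Lemma gr_mul1_linear x : linear (gr_mul1 x).
Proof. exact: pmod_lift_linear (gr_mul1_rel x). Qed.

Lemma gr_mul1_0 x : gr_mul1 x 0 = 0.
Proof. exact: pmod_ev0 (gr_mul1_rel x). Qed.

Lemma gr_mul_rel b : gr_rel (gr_mul1^~ b).
Proof.
split=> [d c x y Fx Fy Fxy|d x Fx Fx'].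
  elim/pmod_ind: b => [[e z Fz]||c' b b' IHb IHb'].
  - rewrite /gr_mul1 !(pmod_lift_gen (gr_mul1_rel _)).
    rewrite -(gr_gen_rel.1 _ _ _ _ _ _ (fil_lin c (filM Fx Fz) (filM Fy Fz))).
    by congr pmod_gen; apply: felt_eq; rewrite //= nmulDl nmulZl.
  - by rewrite !gr_mul1_0 scaler0 addr0.
  - rewrite !gr_mul1_linear IHb IHb' !scalerDr !scalerA [c' * c]mulrC.
    by rewrite addrACA.
elim/pmod_ind: b => [[e z Fz]||c' b b' IHb IHb'].
- rewrite /gr_mul1 !(pmod_lift_gen (gr_mul1_rel _)).
  rewrite -(gr_gen_rel.2 _ _ (filM Fx Fz) (filS (filM Fx Fz))).
  by congr pmod_gen; apply: felt_eq.
- exact: gr_mul1_0.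
- by rewrite gr_mul1_linear IHb IHb' scaler0 addr0.
Qed.

Lemma gr_mul_gen x b : gr_mul (pmod_gen gr_rel x) b = gr_mul1 x b.
Proof. exact: pmod_lift_gen (gr_mul_rel b) _. Qed.

Lemma gr_mul_gen2 x y :
  gr_mul (pmod_gen gr_rel x) (pmod_gen gr_rel y) = pmod_gen gr_rel (felt_mul x y).
Proof. by rewrite gr_mul_gen /gr_mul1 (pmod_lift_gen (gr_mul1_rel _)). Qed.

Lemma gr_mul_linl b : linear (gr_mul^~ b).
Proof. exact: pmod_lift_linear (gr_mul_rel b). Qed.

Lemma gr_mul0l b : gr_mul 0 b = 0.
Proof. exact: pmod_ev0 (gr_mul_rel b). Qed.

Lemma gr_mul_linr a : linear (gr_mul a).
Proof.
move=> c b b'; elim/pmod_ind: a => [x||c' a a' IHa IHa'].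
- by rewrite !gr_mul_gen gr_mul1_linear.
- by rewrite !gr_mul0l scaler0 addr0.
- rewrite !gr_mul_linl IHa IHa' !scalerDr !scalerA [c' * c]mulrC.
  by rewrite addrACA.
Qed.

Lemma gr_mul0r a : gr_mul a 0 = 0.
Proof. by have := gr_mul_linr a (-1) 0 0; rewrite addr0 scaleN1r oppr0 scaleN1r addNr. Qed.

Lemma gr_mulA : associative gr_mul.
Proof.
move=> a b z; elim/pmod_ind: a => [x||c a a' IHa IHa']; first last.
- by rewrite !gr_mul_linl IHa IHa'.
- by rewrite !gr_mul0l.
elim/pmod_ind: b => [y||c b b' IHb IHb']; first last.
- by rewrite !(gr_mul_linl, gr_mul_linr) IHb IHb'.
- by rewrite gr_mul0l gr_mul0r gr_mul0l.
elim/pmod_ind: z => [z||c z z' IHz IHz']; first last.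
- by rewrite !gr_mul_linr IHz IHz'.
- by rewrite !gr_mul0r.
rewrite !gr_mul_gen2; congr pmod_gen; apply: felt_eq => /=.
  exact: addnA.
exact: nmulA.
Qed.

Lemma gr_mulDl : left_distributive gr_mul +%R.
Proof. by move=> a b c; have := gr_mul_linl c 1 a b; rewrite !scale1r. Qed.
Lemma gr_mulDr : right_distributive gr_mul +%R.
Proof. by move=> a b c; have := gr_mul_linr a 1 b c; rewrite !scale1r. Qed.
Lemma gr_mulZl (c : k) a b : gr_mul (c *: a) b = c *: gr_mul a b.
Proof. by have := gr_mul_linl b c a 0; rewrite gr_mul0l !addr0. Qed.
Lemma gr_mulZr (c : k) a b : gr_mul a (c *: b) = c *: gr_mul a b.
Proof. by have := gr_mul_linr a c b 0; rewrite gr_mul0r !addr0. Qed.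
HB.instance Definition _ := Lmodule_isNUAlgebra.Build k gr
  gr_mulA gr_mulDl gr_mulDr gr_mulZl gr_mulZr.
End Graded.

(* The generators T_i, tau_i, s_i are indexed by i : 'I_n.-1, and s_i exchanges
   the positions sl i = i and sr i = i + 1 of 'I_n (numbered from 0). *)
Section Positions.
Variable n : nat.

Lemma sl_subproof (i : 'I_n.-1) : (i < n)%N.
Proof. by case: n i => [|m] [i] //= /ltnW. Qed.
Lemma sr_subproof (i : 'I_n.-1) : (i.+1 < n)%N.
Proof. by case: n i => [|m] [i]. Qed.

Definition sl (i : 'I_n.-1) : 'I_n := Ordinal (sl_subproof i).
Definition sr (i : 'I_n.-1) : 'I_n := Ordinal (sr_subproof i).
Definition sref (i : 'I_n.-1) : 'S_n := tperm (sl i) (sr i).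

Definition far (i j : 'I_n.-1) : bool := (i.+1 < j)%N || (j.+1 < i)%N.

Definition sact (T : Type) (i : 'I_n.-1) (a : {ffun 'I_n -> T}) :
  {ffun 'I_n -> T} := [ffun p => a (sref i p)].

Lemma sactK T i : involutive (@sact T i).
Proof. by move=> a; apply/ffunP => p; rewrite !ffunE tpermK. Qed.

Lemma s_far i j : far i j -> (sref i * sref j = sref j * sref i)%g.
Proof.
move=> ij; apply/commgP/conjg_fixP; rewrite {1}/sref tpermJ.
by rewrite !tpermD // -val_eqE /=; move: ij; rewrite /far; lia.
Qed.

Lemma s_braid (i j : 'I_n.-1) : j = i.+1 :> nat -> (sref i * sref j * sref i = sref j * sref i * sref j)%g.
Proof.
move=> ij; have ll : sl j = sr i by apply: val_inj.
have Ej : (sref j ^ sref i)%g = tperm (sl i) (sr j).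
  rewrite {1}/sref tpermJ ll tpermR tpermD // -val_eqE /=; lia.
have Ei : (sref i ^ sref j)%g = tperm (sl i) (sr j).
  rewrite {1}/sref tpermJ -ll tpermL tpermD // -val_eqE /=; lia.
have V l : (sref l)^-1%g = sref l by rewrite tpermV.
by move: Ej; rewrite -Ei !conjgE !V !mulgA => ->.
Qed.

Lemma sact_far T i j (a : {ffun 'I_n -> T}) :
  far i j -> sact i (sact j a) = sact j (sact i a).
Proof.
by move=> /s_far ij; apply/ffunP => p; rewrite !ffunE -!permM ij.
Qed.

Lemma sact_braid T (i j : 'I_n.-1) (a : {ffun 'I_n -> T}) : j = i.+1 :> nat ->
  sact i (sact j (sact i a)) = sact j (sact i (sact j a)).
Proof.
move=> /s_braid ij; apply/ffunP => p.
by rewrite !ffunE -!permM !mulgA ij.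
Qed.
End Positions.

(* The generator None is the unit, and Some i is T_i. *)
Section NilHecke.
Variable n : nat.

Record nh_rel (A : nuAlgType int) (f : option 'I_n.-1 -> A) : Prop := NHRel {
  nh_1l : forall a, f None ** a = a;
  nh_1r : forall a, a ** f None = a;
  nh_sq : forall i, f (Some i) ** f (Some i) = 0;
  nh_far : forall i j, far i j ->
    f (Some i) ** f (Some j) = f (Some j) ** f (Some i);
  nh_braid : forall i j : 'I_n.-1, j = i.+1 :> nat ->
    f (Some i) ** f (Some j) ** f (Some i) =
    f (Some j) ** f (Some i) ** f (Some j)
}.

Definition nilHecke := palg nh_rel.
HB.instance Definition _ := NUAlgebra.on nilHecke.
Definition nh1 : nilHecke := palg_gen nh_rel None.
Definition nhT (i : 'I_n.-1) : nilHecke := palg_gen nh_rel (Some i).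

Lemma nilHecke_rel : nh_rel (palg_gen nh_rel).
Proof.
by split; intros; apply: palg_ext => A f Rf;
  rewrite ?(palg_liftM Rf) ?(palg_ev0 Rf) ?(palg_lift_gen Rf);
  case: Rf; auto.
Qed.
End NilHecke.

(* The endomorphisms form a Z-algebra, on which nilHecke can be mapped. *)
Section Endo.
Variables (k : pzRingType) (V : lmodType k).

Record endo := Endo { endo_fun :> V -> V; endo_lin : linear endo_fun }.

HB.instance Definition _ := gen_eqMixin endo.
HB.instance Definition _ := gen_choiceMixin endo.

Lemma endoP (f g : endo) : f =1 g -> f = g.
Proof.
case: f g => [f Hf] [g Hg] /= /funext E; rewrite -E in Hg *.
by rewrite (Prop_irrelevance Hf Hg).
Qed.

HB.instance Definition _ (f : endo) := GRing.isLinear.Build k V V *:%R f (endo_lin f).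

Lemma endo0_subproof : linear (fun _ : V => 0 : V).
Proof. by move=> c a b; rewrite scaler0 addr0. Qed.
Lemma endoN_subproof (f : endo) : linear (fun a => - f a).
Proof. by move=> c a b; rewrite linearP opprD scalerN. Qed.
Lemma endoD_subproof (f g : endo) : linear (fun a => f a + g a).
Proof. by move=> c a b; rewrite !linearP scalerDr addrACA. Qed.
Lemma endoM_subproof (f g : endo) : linear (fun a => f (g a)).
Proof. by move=> c a b; rewrite !linearP. Qed.
Lemma endo1_subproof : linear (fun a : V => a). Proof. by []. Qed.

Definition endo0 := Endo endo0_subproof.
Definition endoN f := Endo (endoN_subproof f).
Definition endoD f g := Endo (endoD_subproof f g).
Definition endoM f g := Endo (endoM_subproof f g).
Definition endo1 := Endo endo1_subproof.

Lemma endo_addA : associative endoD.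
Proof. by move=> f g h; apply: endoP => a; apply: addrA. Qed.
Lemma endo_addC : commutative endoD.
Proof. by move=> f g; apply: endoP => a; apply: addrC. Qed.
Lemma endo_add0 : left_id endo0 endoD.
Proof. by move=> f; apply: endoP => a; apply: add0r. Qed.
Lemma endo_addN : left_inverse endo0 endoN endoD.
Proof. by move=> f; apply: endoP => a; apply: addNr. Qed.
HB.instance Definition _ :=
  GRing.isZmodule.Build endo endo_addA endo_addC endo_add0 endo_addN.
HB.instance Definition _ := GRing.Zmodule_isLmodule.Build int endo
  (@mulrzA_C endo) (@mulr1z endo) (@mulrzDl endo) (@mulrzDr endo).

Lemma endo_evalZ (c : int) (f : endo) a : (c *: f) a = f a *~ c.
Proof.
have [E1 E2] : (forall n, (f *+ n) a = f a *+ n) /\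
               (forall n, (f *- n) a = f a *- n).
  have E n : (f *+ n) a = f a *+ n by elim: n => // n IH; rewrite !mulrS -IH.
  by split=> // n; rewrite -E.
by case: c => m; [exact: E1|exact: E2].
Qed.

Lemma endoMA : associative endoM. Proof. by move=> f g h; apply: endoP. Qed.
Lemma endoMDl : left_distributive endoM +%R.
Proof. by move=> f g h; apply: endoP. Qed.
Lemma endoMDr : right_distributive endoM +%R.
Proof. by move=> f g h; apply: endoP => a; apply: raddfD. Qed.
Lemma endoMZl (c : int) f g : endoM (c *: f) g = c *: endoM f g.
Proof. by apply: endoP => a; rewrite /= !endo_evalZ. Qed.
Lemma endoMZr (c : int) f g : endoM f (c *: g) = c *: endoM f g.
Proof. by apply: endoP => a; rewrite /= !endo_evalZ raddfMz. Qed.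
HB.instance Definition _ := Lmodule_isNUAlgebra.Build int endo
  endoMA endoMDl endoMDr endoMZl endoMZr.
End Endo.

Section Wreath.
Variables (k : comPzRingType) (A : nuAlgType k) (n : nat).
Local Notation NH := (nilHecke n).

Definition fupd (a : {ffun 'I_n -> A}) p u : {ffun 'I_n -> A} :=
  [ffun q => if q == p then u else a q].

(* The module A^(tensor n) (over k) tensored with NH (over Z) is generated by
   the symbols of pure tensors (a_1, ..., a_n; h), subject to k-multilinearity
   in the a_p and additivity in h. *)
Definition wr_rel (V : lmodType k) (f : {ffun 'I_n -> A} * NH -> V) : Prop :=
  (forall a p c u v h,
     f (fupd a p (c *: u + v), h) = c *: f (fupd a p u, h) + f (fupd a p v, h)) /\
  (forall a h h', f (a, h + h') = f (a, h) + f (a, h')).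

Definition wreath := pmod wr_rel.
HB.instance Definition _ := GRing.Lmodule.on wreath.

Definition pure (a : {ffun 'I_n -> A}) (h : NH) : wreath :=
  pmod_gen wr_rel (a, h).

Lemma pure_rel : wr_rel (pmod_gen wr_rel).
Proof.
split=> [a p c u v h|a h h']; apply: pmod_ext => V f Rf.
  by rewrite (pmod_lift_linear Rf) !(pmod_lift_gen Rf) Rf.1.
by rewrite (pmod_evD Rf) !(pmod_lift_gen Rf) Rf.2.
Qed.

Definition fmul (a b : {ffun 'I_n -> A}) : {ffun 'I_n -> A} :=
  [ffun p => a p ** b p].

(* T_i (a (x) h) = s_i(a) (x) T_i h, equivalent to a T_i = T_i s_i(a). *)
Definition wr_T1 (i : 'I_n.-1) (x : {ffun 'I_n -> A} * NH) : wreath :=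
  pure (sact i x.1) (nhT i ** x.2).
Lemma wr_T1_rel i : wr_rel (wr_T1 i).
Proof.
have E a p u : sact i (fupd a p u) = fupd (sact i a) (sref i p) u.
  by apply/ffunP => q; rewrite !ffunE (canF_eq (tpermK _ _)).
split=> [a p c u v h|a h h']; rewrite /wr_T1 /=.
  by rewrite !E; apply: pure_rel.1.
by rewrite nmulDr; apply: pure_rel.2.
Qed.
Definition wr_T (i : 'I_n.-1) : endo wreath :=
  Endo (pmod_lift_linear (wr_T1_rel i)).

Definition wr_act1 (o : option 'I_n.-1) : endo wreath :=
  if o is Some i then wr_T i else endo1 wreath.

Lemma wr_T_pure i a h : wr_T i (pure a h) = pure (sact i a) (nhT i ** h).
Proof. exact: pmod_lift_gen (wr_T1_rel i) _. Qed.

Lemma endo_ext (f g : endo wreath) :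
  (forall a h, f (pure a h) = g (pure a h)) -> f = g.
Proof.
move=> E; apply: endoP; elim/pmod_ind => [[a h]||c a b IHa IHb].
- exact: E.
- by rewrite !linear0.
- by rewrite !endo_lin IHa IHb.
Qed.

Lemma pure0r a : pure a 0 = 0.
Proof.
by have := pure_rel.2 a 0 0; rewrite addr0 -[LHS]addr0 => /addrI.
Qed.

Lemma wr_act1_rel : nh_rel wr_act1.
Proof.
have := @nilHecke_rel n; case=> _ _ Tsq Tfar Tbr.
split=> [a|a|i|i j ij|i j ij]; first exact: endoP; first exact: endoP.
- apply: endo_ext => a h; change (wr_T i (wr_T i (pure a h)) = 0).
  rewrite !wr_T_pure nmulA Tsq.
  by rewrite -[0 in LHS](scale0r 0) nmulZl scale0r pure0r.
- apply: endo_ext => a h.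
  change (wr_T i (wr_T j (pure a h)) = wr_T j (wr_T i (pure a h))).
  by rewrite !wr_T_pure !nmulA sact_far // Tfar.
- apply: endo_ext => a h.
  change (wr_T i (wr_T j (wr_T i (pure a h))) =
          wr_T j (wr_T i (wr_T j (pure a h)))).
  by rewrite !wr_T_pure !nmulA sact_braid // Tbr.
Qed.

Definition wr_act (h : NH) : wreath -> wreath := palg_lift wr_act1 h.

Definition wr_lmul1 (a : {ffun 'I_n -> A}) (x : {ffun 'I_n -> A} * NH) : wreath :=
  pure (fmul a x.1) x.2.
Definition wr_lmul a : wreath -> wreath := pmod_lift (wr_lmul1 a).

Lemma wr_lmul1_rel a : wr_rel (wr_lmul1 a).
Proof.
have E b p u : fmul a (fupd b p u) = fupd (fmul a b) p (a p ** u).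
  by apply/ffunP => q; rewrite !ffunE; case: eqP => [->|].
split=> [b p c u v h|b h h']; rewrite /wr_lmul1 /=; last exact: pure_rel.2.
by rewrite !E nmulDr nmulZr; apply: pure_rel.1.
Qed.

(* Characterized by (a (x) h) w = a (h w), where A^(tensor n) acts on the left
   factor by multiplication, and NH through wr_T. *)
Definition wr_mul (v w : wreath) : wreath :=
  pmod_lift (fun x => wr_lmul x.1 (wr_act x.2 w)) v.

Lemma wr_lmul_pure a b h : wr_lmul a (pure b h) = pure (fmul a b) h.
Proof. exact: pmod_lift_gen (wr_lmul1_rel a) _. Qed.

Lemma wr_lmul_linear a : linear (wr_lmul a).
Proof. exact: pmod_lift_linear (wr_lmul1_rel a). Qed.
HB.instance Definition _ a := GRing.isLinear.Build k wreath wreath *:%R _ (wr_lmul_linear a).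

Lemma wr_act_linear h : linear (wr_act h).
Proof. exact: endo_lin. Qed.
HB.instance Definition _ h := GRing.isLinear.Build k wreath wreath *:%R _ (wr_act_linear h).

Lemma wr_actD h h' w : wr_act (h + h') w = wr_act h w + wr_act h' w.
Proof. by rewrite /wr_act (palg_evD wr_act1_rel). Qed.
Lemma wr_actM h h' w : wr_act (h ** h') w = wr_act h (wr_act h' w).
Proof. by rewrite /wr_act (palg_evM wr_act1_rel). Qed.
Lemma wr_act_T i w : wr_act (nhT i) w = wr_T i w.
Proof. by rewrite /wr_act (palg_lift_gen wr_act1_rel). Qed.
Lemma wr_act_1 w : wr_act (nh1 n) w = w.
Proof. by rewrite /wr_act (palg_lift_gen wr_act1_rel). Qed.
Lemma wr_actZ (c : int) h w : wr_act (c *: h) w = wr_act h w *~ c.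
Proof. by rewrite /wr_act (palg_evZ wr_act1_rel) endo_evalZ. Qed.

Lemma wr_mul_rel w : wr_rel (fun x => wr_lmul x.1 (wr_act x.2 w)).
Proof.
split=> [a p c u v h|a h h'] /=; last by rewrite wr_actD linearD.
elim/pmod_ind: (wr_act h w) => [[b h']||c' b b' IHb IHb'].
- rewrite !wr_lmul_pure.
  have E z : fmul (fupd a p z) b = fupd (fmul a b) p (z ** b p).
    by apply/ffunP => q; rewrite !ffunE; case: eqP => [->|].
  by rewrite !E nmulDl nmulZl; apply: pure_rel.1.
- by rewrite !linear0 addr0.
- rewrite !linearP /= IHb IHb' !scalerDr !scalerA [c' * c]mulrC.
  by rewrite addrACA.
Qed.

Lemma wr_mul_linl w : linear (wr_mul^~ w).
Proof. exact: pmod_lift_linear (wr_mul_rel w). Qed.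
Lemma wr_mul0l w : wr_mul 0 w = 0.
Proof. exact: pmod_ev0 (wr_mul_rel w). Qed.
Lemma wr_mul_pure a h w : wr_mul (pure a h) w = wr_lmul a (wr_act h w).
Proof. exact: pmod_lift_gen (wr_mul_rel w) _. Qed.

Lemma wr_mul_linr v : linear (wr_mul v).
Proof.
move=> c w w'; elim/pmod_ind: v => [[a h]||d v v' IHv IHv'].
- by rewrite !wr_mul_pure !linearP.
- by rewrite !wr_mul0l scaler0 addr0.
- rewrite !wr_mul_linl IHv IHv' !scalerDr !scalerA [d * c]mulrC.
  by rewrite addrACA.
Qed.
HB.instance Definition _ v := GRing.isLinear.Build k wreath wreath *:%R _ (wr_mul_linr v).

Lemma wr_lmul_mul a v w : wr_lmul a (wr_mul v w) = wr_mul (wr_lmul a v) w.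
Proof.
elim/pmod_ind: v => [[b h]||c v v' IHv IHv'].
- rewrite wr_lmul_pure !wr_mul_pure.
  elim/pmod_ind: (wr_act h w) => [[b' h']||c v v' IHv IHv'].
  + rewrite !wr_lmul_pure; congr pure.
    by apply/ffunP => p; rewrite !ffunE nmulA.
  + by rewrite !linear0.
  + by rewrite !linearP /= IHv IHv'.
- by rewrite linear0 !wr_mul0l linear0.
- by rewrite linearP /= !wr_mul_linl linearP /= IHv IHv'.
Qed.

Lemma wr_act_mul h v w : wr_act h (wr_mul v w) = wr_mul (wr_act h v) w.
Proof.
elim/palg_ind: h v => [[i|]||c h h' IHh IHh'|h h' IHh IHh'] v.
- rewrite -/(nhT i) !wr_act_T; elim/pmod_ind: v => [[b h]||c v v' IHv IHv'].
  + rewrite wr_T_pure !wr_mul_pure wr_actM wr_act_T.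
    elim/pmod_ind: (wr_act h w) => [[b' h']||c v v' IHv IHv'].
    * rewrite wr_T_pure !wr_lmul_pure wr_T_pure; congr pure.
      by apply/ffunP => p; rewrite !ffunE.
    * by rewrite !linear0.
    * by rewrite !(wr_lmul_linear, endo_lin) IHv IHv'.
  + by rewrite linear0 !wr_mul0l linear0.
  + by rewrite endo_lin !wr_mul_linl endo_lin IHv IHv'.
- by rewrite -/(nh1 n) !wr_act_1.
- by rewrite -[0 in LHS](scale0r 0) -[0 in RHS](scale0r 0) !wr_actZ !mulr0z wr_mul0l.
- rewrite !wr_actD !wr_actZ IHh IHh'.
  have E : additive (wr_mul^~ w).
    by move=> a b; have := wr_mul_linl w (-1) b a; rewrite !scaleN1r ![- _ + _]addrC.
  pose f : {additive wreath -> wreath} := HB.pack (wr_mul^~ w) (GRing.isAdditive.Build _ _ _ E).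
  by rewrite -[RHS]/(f _) raddfD raddfMz.
- by rewrite !wr_actM IHh' IHh.
Qed.

Lemma wr_mulA : associative wr_mul.
Proof.
move=> u v w; elim/pmod_ind: u => [[a h]||c u u' IHu IHu'].
- by rewrite !wr_mul_pure wr_act_mul wr_lmul_mul.
- by rewrite !wr_mul0l.
- by rewrite !wr_mul_linl IHu IHu'.
Qed.
Lemma wr_mulDl : left_distributive wr_mul +%R.
Proof. by move=> a b c; have := wr_mul_linl c 1 a b; rewrite !scale1r. Qed.
Lemma wr_mulDr : right_distributive wr_mul +%R.
Proof. by move=> a b c; apply: linearD. Qed.
Lemma wr_mulZl (c : k) a b : wr_mul (c *: a) b = c *: wr_mul a b.
Proof. by have := wr_mul_linl b c a 0; rewrite wr_mul0l !addr0. Qed.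
Lemma wr_mulZr (c : k) a b : wr_mul a (c *: b) = c *: wr_mul a b.
Proof. exact: linearZ. Qed.
HB.instance Definition _ := Lmodule_isNUAlgebra.Build k wreath
  wr_mulA wr_mulDl wr_mulDr wr_mulZl wr_mulZr.
End Wreath.

(* k^(I)[x] is the direct sum of copies of k[x] indexed by I, as finitely
   supported functions from I to k[x] with pointwise operations. *)
Section PolySum.
Variables (k : comNzRingType) (I : choiceType).

Definition polysum := {fsfun I -> {poly k} with 0}.
HB.instance Definition _ := Choice.on polysum.

Definition ps_zero : polysum := [fsfun with 0].
Definition ps_add (f g : polysum) : polysum :=
  [fsfun i in (finsupp f `|` finsupp g)%fset => f i + g i | 0].
Definition ps_opp (f : polysum) : polysum := [fsfun i in finsupp f => - f i | 0].
Definition ps_scale (c : k) (f : polysum) : polysum :=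
  [fsfun i in finsupp f => c *: f i | 0].
Definition ps_mul (f g : polysum) : polysum :=
  [fsfun i in finsupp f => f i * g i | 0].

Lemma ps_zeroE i : ps_zero i = 0. Proof. by rewrite fsfunE. Qed.
Lemma ps_addE f g i : ps_add f g i = f i + g i.
Proof.
rewrite fsfunE inE; case: finsuppP => //= _; case: finsuppP => //= _.
by rewrite addr0.
Qed.
Lemma ps_oppE f i : ps_opp f i = - f i.
Proof. by rewrite fsfunE; case: finsuppP => //= _; rewrite oppr0. Qed.
Lemma ps_scaleE c f i : ps_scale c f i = c *: f i.
Proof. by rewrite fsfunE; case: finsuppP => //= _; rewrite scaler0. Qed.
Lemma ps_mulE f g i : ps_mul f g i = f i * g i.
Proof. by rewrite fsfunE; case: finsuppP => //= _; rewrite mul0r. Qed.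
Definition psE := (ps_zeroE, ps_addE, ps_oppE, ps_scaleE, ps_mulE).

Lemma ps_addA : associative ps_add.
Proof. by move=> f g h; apply/fsfunP => i; rewrite !psE addrA. Qed.
Lemma ps_addC : commutative ps_add.
Proof. by move=> f g; apply/fsfunP => i; rewrite !psE addrC. Qed.
Lemma ps_add0 : left_id ps_zero ps_add.
Proof. by move=> f; apply/fsfunP => i; rewrite !psE add0r. Qed.
Lemma ps_addN : left_inverse ps_zero ps_opp ps_add.
Proof. by move=> f; apply/fsfunP => i; rewrite !psE addNr. Qed.
HB.instance Definition _ :=
  GRing.isZmodule.Build polysum ps_addA ps_addC ps_add0 ps_addN.

Lemma ps_scaleA c d f : ps_scale c (ps_scale d f) = ps_scale (c * d) f.
Proof. by apply/fsfunP => i; rewrite !psE scalerA. Qed.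
Lemma ps_scale1 : left_id 1 ps_scale.
Proof. by move=> f; apply/fsfunP => i; rewrite !psE scale1r. Qed.
Lemma ps_scaleDr : right_distributive ps_scale +%R.
Proof. by move=> c f g; apply/fsfunP => i; rewrite !psE scalerDr. Qed.
Lemma ps_scaleDl f : {morph ps_scale^~ f : c d / c + d}.
Proof. by move=> c d; apply/fsfunP => i; rewrite !psE scalerDl. Qed.
HB.instance Definition _ := GRing.Zmodule_isLmodule.Build k polysum
  ps_scaleA ps_scale1 ps_scaleDr ps_scaleDl.

Lemma ps_mulA : associative ps_mul.
Proof. by move=> f g h; apply/fsfunP => i; rewrite !psE mulrA. Qed.
Lemma ps_mulDl : left_distributive ps_mul +%R.
Proof. by move=> f g h; apply/fsfunP => i; rewrite !psE mulrDl. Qed.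
Lemma ps_mulDr : right_distributive ps_mul +%R.
Proof. by move=> f g h; apply/fsfunP => i; rewrite !psE mulrDr. Qed.
Lemma ps_mulZl (c : k) f g : ps_mul (c *: f) g = c *: ps_mul f g.
Proof. by apply/fsfunP => i; rewrite !psE scalerAl. Qed.
Lemma ps_mulZr (c : k) f g : ps_mul f (c *: g) = c *: ps_mul f g.
Proof. by apply/fsfunP => i; rewrite !psE scalerAr. Qed.
HB.instance Definition _ := Lmodule_isNUAlgebra.Build k polysum
  ps_mulA ps_mulDl ps_mulDr ps_mulZl ps_mulZr.

Definition ps_single (i : I) (p : {poly k}) : polysum :=
  [fsfun j in [fset i]%fset => p | 0].
End PolySum.

Section KLR.
Variables (k : comNzRingType) (I : choiceType) (n : nat).
Variable Q : I -> I -> {mpoly k[2]}.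
Local Notation L := {ffun 'I_n -> I}.

Variant klr_gen : Type :=
  | GOne of L | GX of 'I_n & L | GTau of 'I_n.-1 & L.

Section Relations.
Variables (B : nuAlgType k) (f : klr_gen -> B).
Local Notation e nu := (f (GOne nu)).
Local Notation x p nu := (f (GX p nu)).
Local Notation t i nu := (f (GTau i nu)).

(* x_{1,nu}^{m_1} ... x_{n,nu}^{m_n}, with empty product 1_nu. *)
Definition xmon (nu : L) (m : 'X_{1..n}) : B :=
  foldr (fun p b => iter (m p) (nmul (x p nu)) b) (e nu) (enum 'I_n).

(* P(x_{1,nu}, ..., x_{n,nu}), with constant terms multiplied by 1_nu. *)
Definition xpol (nu : L) (P : {mpoly k[n]}) : B :=
  \sum_(m <- msupp P) P@_m *: xmon nu m.

Record klr_rel : Prop := KLRRel {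
  klr_ee : forall nu nu' : L, e nu ** e nu' = if nu == nu' then e nu else 0;
  klr_te : forall i (nu : L), t i nu = e (sact i nu) ** t i nu ** e nu;
  klr_xe : forall p (nu : L), x p nu = e nu ** x p nu ** e nu;
  klr_xx : forall p q (nu : L), x p nu ** x q nu = x q nu ** x p nu;
  klr_tt : forall i (nu : L), t i (sact i nu) ** t i nu =
    xpol nu (Q (nu (sl i)) (nu (sr i)) \mPo [tuple 'X_(sl i); 'X_(sr i)]);
  klr_far : forall i j (nu : L), far i j ->
    t i (sact j nu) ** t j nu = t j (sact i nu) ** t i nu;
  (* P is the quotient of
     Q_{nu_i,nu_{i+1}}(x_{i+2}, x_{i+1}) - Q_{nu_i,nu_{i+1}}(x_i, x_{i+1})
     by x_{i+2} - x_i; it exists and is unique. *)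
  klr_braid : forall (i j : 'I_n.-1) (nu : L) (P : {mpoly k[n]}),
    j = i.+1 :> nat -> nu (sl i) = nu (sr j) ->
    ('X_(sr j) - 'X_(sl i)) * P =
      (Q (nu (sl i)) (nu (sr i)) \mPo [tuple 'X_(sr j); 'X_(sr i)]) -
      (Q (nu (sl i)) (nu (sr i)) \mPo [tuple 'X_(sl i); 'X_(sr i)]) ->
    t j (sact i (sact j nu)) ** t i (sact j nu) ** t j nu
    - t i (sact j (sact i nu)) ** t j (sact i nu) ** t i nu = xpol nu P;
  klr_braid0 : forall (i j : 'I_n.-1) (nu : L),
    j = i.+1 :> nat -> nu (sl i) <> nu (sr j) ->
    t j (sact i (sact j nu)) ** t i (sact j nu) ** t j nu
    - t i (sact j (sact i nu)) ** t j (sact i nu) ** t i nu = 0;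
  klr_tx : forall i p (nu : L),
    t i nu ** x p nu - x (sref i p) (sact i nu) ** t i nu =
    if (p == sl i) && (nu (sl i) == nu (sr i)) then - e nu
    else if (p == sr i) && (nu (sl i) == nu (sr i)) then e nu else 0
}.
End Relations.

(* H_n(Q) *)
Definition klr := palg klr_rel.
HB.instance Definition _ := NUAlgebra.on klr.
Definition klr_elt (g : klr_gen) : klr := palg_gen klr_rel g.

Lemma xmon_lift (B : nuAlgType k) (f : klr_gen -> B) (Rf : klr_rel f) nu m :
  palg_lift f (xmon klr_elt nu m : klr) = xmon f nu m.
Proof.
rewrite /xmon; elim: (enum 'I_n) => [|p l IHl] /=.
  exact: palg_lift_gen Rf _.
elim: (m p) => //= d IHd.
by rewrite (palg_liftM Rf) IHd (palg_lift_gen Rf).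
Qed.

Lemma xpol_lift (B : nuAlgType k) (f : klr_gen -> B) (Rf : klr_rel f) nu P :
  palg_lift f (xpol klr_elt nu P : klr) = xpol f nu P.
Proof.
rewrite /xpol; elim: (msupp P : seq _) => [|m l IHl].
  by rewrite !big_nil; apply: palg_ev0.
by rewrite !big_cons (palg_lift_linear Rf) IHl xmon_lift.
Qed.

Lemma klr_relP : klr_rel klr_elt.
Proof.
split=> *; apply: palg_ext => B f Rf;
  case: (Rf) => R1 R2 R3 R4 R5 R6 R7 R8 R9;
  rewrite ?(xpol_lift Rf) ?(palg_evD Rf) ?(palg_evN Rf) ?(palg_liftM Rf)
    ?(palg_lift_gen Rf) ?(palg_ev0 Rf); auto.
- by rewrite R1; case: ifP; rewrite ?(palg_lift_gen Rf) ?(palg_ev0 Rf).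
- rewrite R9; case: ifP => _; first by rewrite (palg_evN Rf) (palg_lift_gen Rf).
  by case: ifP; rewrite ?(palg_lift_gen Rf) ?(palg_ev0 Rf).
Qed.

(* The smallest algebra filtration with 1_nu, x_{p,nu} in degree 0 and
   tau_{i,nu} in degree 1. *)
Inductive klr_fil : nat -> klr -> Prop :=
  | klr_fil1 nu : klr_fil 0 (klr_elt (GOne nu))
  | klr_filx p nu : klr_fil 0 (klr_elt (GX p nu))
  | klr_filt i nu : klr_fil 1 (klr_elt (GTau i nu))
  | klr_fil0 d : klr_fil d 0
  | klr_fil_lin d c a b :
      klr_fil d a -> klr_fil d b -> klr_fil d (c *: a + b)
  | klr_filS d a : klr_fil d a -> klr_fil d.+1 a
  | klr_filM d e a b :
      klr_fil d a -> klr_fil e b -> klr_fil (d + e) (a ** b).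

Definition klr_filtration : filtration klr :=
  Filtration klr_fil0 klr_fil_lin klr_filS klr_filM.

Local Notation gr_klr := (gr klr_filtration).
Local Notation wreath_klr := (wreath (polysum k I) n).

(* The elements 1_nu, x_p 1_nu and T_i 1_nu of the wreath product. *)
Definition w_one (nu : L) : wreath_klr :=
  pure [ffun q => ps_single (nu q) (1 : {poly k})] (nh1 n).
Definition w_x (p : 'I_n) (nu : L) : wreath_klr :=
  pure [ffun q => ps_single (nu q) (if q == p then 'X else 1 : {poly k})] (nh1 n).
Definition w_T (i : 'I_n.-1) (nu : L) : wreath_klr :=
  wr_act (nhT i) (w_one nu).

(* As the w_one, w_x and w_T generate the wreath product, there is at most one
   such morphism. *)
Definition pbw_morphism (phi : {linear wreath_klr -> gr_klr}) : Prop :=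
  [/\ forall a b, phi (a ** b) = phi a ** phi b,
      forall nu, phi (w_one nu) = gr_class (F := klr_filtration) (klr_fil1 nu),
      forall p nu, phi (w_x p nu) = gr_class (F := klr_filtration) (klr_filx p nu)
    & forall i nu, phi (w_T i nu) = gr_class (F := klr_filtration) (klr_filt i nu)].

Definition pbw_property : Prop :=
  exists phi : {linear wreath_klr -> gr_klr}, pbw_morphism phi /\ bijective phi.

(* tau_{i_1, s_{i_2}...s_{i_r}(nu)} ... tau_{i_r,nu} b *)
Fixpoint tau_word (w : seq 'I_n.-1) (nu : L) (b : klr) : klr :=
  if w is i :: w' then
    klr_elt (GTau i (foldr (@sact n I) nu w')) ** tau_word w' nu b
  else b.

Definition klr_S (J : pred (seq 'I_n.-1))
    (t : {w | J w} * 'X_{1..n} * L) : klr :=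
  tau_word (val t.1.1) t.2 (xmon klr_elt t.2 t.1.2).
End KLR.
Arguments klr_S {k I n} Q J t.

(* The order of the factors differs from that of composition of maps in the
   product of 'S_n; this does not affect reduced_family, as inversion is a
   bijection of 'S_n. *)
Definition word_perm n (w : seq 'I_n.-1) : 'S_n := (\prod_(i <- w) sref i)%g.

Definition reduced n (w : seq 'I_n.-1) : Prop :=
  forall w', word_perm w' = word_perm w -> (size w <= size w')%N.

Definition reduced_family n (J : pred (seq 'I_n.-1)) : Prop :=
  (forall w, J w -> reduced w) /\
  (forall g : 'S_n, exists! w, J w /\ word_perm w = g).

Definition generating (k : nzRingType) (V : lmodType k) (T : choiceType)
    (b : T -> V) : Prop :=
  forall v, exists c : {fsfun T -> k with 0},
    v = \sum_(t <- finsupp c) c t *: b t.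

Definition independent (k : nzRingType) (V : lmodType k) (T : choiceType)
    (b : T -> V) : Prop :=
  forall c : {fsfun T -> k with 0},
    \sum_(t <- finsupp c) c t *: b t = 0 -> forall t, c t = 0.

Definition is_basis (k : nzRingType) (V : lmodType k) (T : choiceType)
    (b : T -> V) : Prop := generating b /\ independent b.

(* Main.v *)
Require Import Defs.
From HB Require Import structures.
From mathcomp Require Import all_boot all_order all_fingroup all_algebra.
From mathcomp Require Import finmap mpoly zify ring.
From mathcomp Require Import generic_quotient boolp.

(** The generators tau_i multiply like simple reflections, up to terms with
    fewer factors, so S always generates: every word in the tau_i can be
    changed by braid and commutation moves, which only create shorter words,
    either into the chosen reduced word of its permutation or into a word
    containing tau_i tau_i, which is a polynomial in the x_p. This is
    Matsumoto's theorem ([reduced_braid_eq], [word_cases]) and yields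
    [klr_S_generating]. The content of the theorem is thus the independence of
    S.

    If S is independent, computing tau_i tau_i tau_i 1_nu in two ways, for nu
    with distinct entries a, b at i and i + 1, gives
    tau_i (Q_ab(x_i, x_(i+1)) - Q_ba(x_(i+1), x_i)) 1_nu = 0, hence the symmetry
    of Q ([basis_symmetric]).

    Conversely, suppose that Q is symmetric, and that Q_ij(u, v) =
    P_ij(u, v) P_ji(v, u) for i <> j. Then H_n(Q) acts on a product of copies
    of k[x_1, ..., x_n] indexed by the sequences nu: tau_i acts on the copy nu
    by the divided difference (s_i f - f) / (x_i - x_(i+1)) if nu_i = nu_(i+1),
    and by s_i followed by a multiplication by P_(nu_i,nu_(i+1))(x_(i+1), x_i)
    otherwise ([rep_klr]). Multiplied by a power of the discriminant, a reduced
    word acts by its permutation with a coefficient built from the P_ij, plus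
    permutations of shorter words ([Theta_expand]). If the P_ij are not zero
    divisors, the independence of the permutations over the polynomials
    ([perm_independent]) shows that S is independent. In general this fails, for
    instance if Q_ij = 0; one then replaces k by k[t] and Q_ij by Q_ij + t for
    i <> j. These are not zero divisors, so the deformed algebra is free over
    k[t] with basis its own family S, and its reduction modulo t is a k-algebra
    satisfying the relations of H_n(Q) in which S is independent
    ([klr_S_independent]). For the P_ij, one chooses an orientation of each pair
    {i, j} and takes Q_ij in one direction and 1 in the other.

    The PBW property is a reformulation of the independence of S. The wreath
    product has the basis T_w x^m 1_nu ([wreath_basis]); here the independence
    of the T_w in the nil Hecke algebra is itself the independence of S for one
    label and Q = 0 over the integers ([nhw_dual]). The symbols of the elements
    of S in gr H_n(Q) are independent if and only if S is ([gr_independent],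
    [klr_S_independent_gr]). Both algebras satisfy the same graded relations,
    which determine the product of a generator and a basis element
    ([graded_table]), so that the linear bijection between the two bases is
    multiplicative ([basis_pbw]), and every PBW morphism is of this form
    ([pbw_morphism_basis]). *)

Set Implicit Arguments.
Unset Strict Implicit.
Unset Printing Implicit Defensive.
Import GRing.Theory.
Local Open Scope ring_scope.
Local Open Scope quotient_scope.

(** * Bases indexed by a choice type *)

Section LinearCombinations.
Variables (k : nzRingType) (T : choiceType).
Implicit Types (c : {fsfun T -> k with 0}) (P : T -> Prop).

Section Span.
Variables (V : lmodType k) (b : T -> V).

(** An inductive form of the span of the b t with P t, closed under linear
    combinations without reindexing finitely supported functions. *)
Inductive span P : V -> Prop :=
  | span0 : span P 0
  | span_cons (a : k) t v : P t -> span P v -> span P (a *: b t + v).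

Lemma span_gen P t : P t -> span P (b t).
Proof. by move=> Pt; rewrite -[b t]addr0 -[b t]scale1r; do 2?constructor. Qed.

Lemma spanD P u v : span P u -> span P v -> span P (u + v).
Proof.
move=> Pu Pv; elim: Pu => [|c t w Pt _ IH]; first by rewrite add0r.
by rewrite -addrA; constructor.
Qed.

Lemma spanS P P' v : (forall t, P t -> P' t) -> span P v -> span P' v.
Proof. by move=> PP'; elim=> [|c t w /PP' Pt _ IH]; constructor. Qed.

Lemma spanZ P (a : k) v : span P v -> span P (a *: v).
Proof.
elim=> [|d t w Pt _ IH]; first by rewrite scaler0; constructor.
by rewrite scalerDr scalerA; constructor.
Qed.

Lemma span_lin P (a : k) u v : span P u -> span P v -> span P (a *: u + v).
Proof. by move=> Pu Pv; apply: spanD => //; apply: spanZ. Qed.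
End Span.

Definition fscomb (V : lmodType k) (b : T -> V) c : V :=
  \sum_(t <- finsupp c) c t *: b t.

Lemma fscombE (V : lmodType k) (b : T -> V) c (A : {fset T}) :
  (finsupp c `<=` A)%fset -> fscomb b c = \sum_(t <- A) c t *: b t.
Proof.
move=> cA; apply: big_fset_incl => // t _.
by rewrite memNfinsupp => /eqP ->; rewrite scale0r.
Qed.

Definition fslin (a : k) c c' : {fsfun T -> k with 0} :=
  [fsfun t in (finsupp c `|` finsupp c')%fset => a * c t + c' t].

Lemma fslinE a c c' t : fslin a c c' t = a * c t + c' t.
Proof.
rewrite fsfunE inE; case: finsuppP => //= _; case: finsuppP => //= _.
by rewrite mulr0 addr0.
Qed.

Lemma fscomb_lin (V : lmodType k) (b : T -> V) a c c' :
  fscomb b (fslin a c c') = a *: fscomb b c + fscomb b c'.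
Proof.
pose A := (finsupp c `|` finsupp c')%fset.
have sA : (finsupp (fslin a c c') `<=` A)%fset.
  apply/fsubsetP => t; rewrite mem_finsupp fslinE.
  apply: contraR; rewrite in_fsetU negb_or => /andP[].
  by rewrite !memNfinsupp => /eqP -> /eqP ->; rewrite mulr0 addr0.
rewrite (fscombE b sA) (fscombE b (fsubsetUl _ _ : finsupp c `<=` A)%fset).
rewrite (fscombE b (fsubsetUr _ _ : finsupp c' `<=` A)%fset).
rewrite scaler_sumr -big_split /=; apply: eq_bigr => t _.
by rewrite fslinE scalerDl scalerA.
Qed.

Definition fsone (t : T) : {fsfun T -> k with 0} := [fsfun u in [fset t]%fset => 1].

Lemma fsoneE t u : fsone t u = (u == t)%:R.
Proof. by rewrite fsfunE inE; case: eqP. Qed.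

Lemma fscomb_one (V : lmodType k) (b : T -> V) t : fscomb b (fsone t) = b t.
Proof.
rewrite (@fscombE _ _ _ [fset t]%fset); last first.
  by apply/fsubsetP => u; rewrite mem_finsupp fsoneE in_fset1; case: (u == t); rewrite ?eqxx.
by rewrite big_seq_fset1 fsoneE eqxx scale1r.
Qed.

Lemma span_fscomb (V : lmodType k) (b : T -> V) P v :
  span b P v -> exists2 c : {fsfun T -> k with 0}, forall t, c t != 0 -> P t & v = fscomb b c.
Proof.
elim=> [|a t w Pt _ [c cP ->]].
  exists [fsfun]; first by move=> t; rewrite fsfunE eqxx.
  by rewrite /fscomb big1 // => t _; rewrite fsfunE scale0r.
exists (fslin a (fsone t) c); last by rewrite fscomb_lin fscomb_one.
move=> u; rewrite fslinE fsoneE; case: (u =P t) => [->//|_] /=.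
by rewrite mulr0 add0r => /cP.
Qed.

Lemma generatingE (V : lmodType k) (b : T -> V) :
  (forall v, span b (fun=> True) v) -> generating b.
Proof. by move=> H v; have [c _ ->] := span_fscomb (H v); exists c. Qed.

Section Basis.
Variables (V : lmodType k) (b : T -> V).
Hypothesis Hb : is_basis b.

Lemma fscomb_inj : injective (fscomb b).
Proof.
move=> c c' E; apply/fsfunP => t; apply/eqP; rewrite -subr_eq0; apply/eqP.
have := Hb.2 (fslin (-1) c' c); rewrite -/(fscomb _ _) fscomb_lin E scaleN1r addNr.
by move/(_ erefl t); rewrite fslinE mulN1r addrC.
Qed.

(** The universal property of a basis. *)
Lemma basis_extend (W : lmodType k) (f : T -> W) :
  exists phi : {linear V -> W}, forall t, phi (b t) = f t.
Proof.
have [co coE] : {co | forall v, v = fscomb b (co v)}.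
  exists (fun v => sval (cid (Hb.1 v))) => v; exact: (svalP (cid (Hb.1 v))).
pose phi v := fscomb f (co v).
have phiL : linear phi.
  move=> a u v; rewrite /phi -fscomb_lin; congr fscomb; apply: fscomb_inj.
  by rewrite -coE fscomb_lin -!coE.
pose phi' : {linear V -> W} := HB.pack phi (GRing.isLinear.Build k V W *:%R _ phiL).
exists phi' => t; change (phi (b t) = f t).
by rewrite /phi -[RHS](fscomb_one f); congr fscomb; apply: fscomb_inj; rewrite -coE fscomb_one.
Qed.
End Basis.
End LinearCombinations.

Lemma basis_coord (k : nzRingType) (V : lmodType k) (T : choiceType) (b : T -> V) :
  is_basis b -> forall t, exists phi : {linear V -> k^o}, forall u, phi (b u) = (u == t)%:R.
Proof. by move=> Hb t; exact: (basis_extend Hb). Qed.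

Lemma linear_fscomb (k : nzRingType) (V W : lmodType k) (T : choiceType) (b : T -> V)
    (phi : {linear V -> W}) c : phi (fscomb b c) = fscomb (phi \o b) c.
Proof. by rewrite /fscomb linear_sum; apply: eq_bigr => t _; rewrite linearZ. Qed.

Lemma independent_dual (k : nzRingType) (V : lmodType k) (T : choiceType) (b : T -> V) :
  (forall t, exists phi : {linear V -> k^o}, forall u, phi (b u) = (u == t)%:R) ->
  independent b.
Proof.
move=> H c; rewrite -/(fscomb _ _) => c0 t; have [phi phiE] := H t.
have : phi (fscomb b c) = 0 by rewrite c0 linear0.
rewrite linear_fscomb; case: (finsuppP c t) => // tc.
rewrite /fscomb (big_fsetD1 t) //= phiE eqxx big1_seq ?addr0; first by rewrite [_ *: _]mulr1.
by move=> u; rewrite !inE phiE => /andP[_ /andP[/negPf -> _]]; rewrite scaler0.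
Qed.

(** * Reduced words in the symmetric group *)

Section Words.
Variable n : nat.
Local Notation word := (seq 'I_n.-1).
Implicit Types (w : word) (i j : 'I_n.-1) (v : 'S_n).

Lemma sl_neq_sr i : sl i != sr i.
Proof. by rewrite -val_eqE /=; lia. Qed.

Lemma sref_sl i : sref i (sl i) = sr i. Proof. exact: tpermL. Qed.
Lemma sref_sr i : sref i (sr i) = sl i. Proof. exact: tpermR. Qed.
Lemma srefK i : involutive (sref i). Proof. exact: tpermK. Qed.
Lemma sref2 i : (sref i * sref i)%g = 1%g. Proof. exact: tperm2. Qed.
Lemma srefV i : (sref i)^-1%g = sref i. Proof. exact: tpermV. Qed.
Lemma srefKg i v : (sref i * (sref i * v))%g = v.
Proof. by rewrite mulgA sref2 mul1g. Qed.

Lemma sref_lt i (p q : 'I_n) :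
  (p < q)%N -> (p, q) != (sl i, sr i) -> (sref i p < sref i q)%N.
Proof.
rewrite xpair_eqE -!val_eqE /= /sref.
case: tpermP => [->|->|/eqP + /eqP +]; case: tpermP => [->|->|/eqP + /eqP +] //=;
  rewrite -?val_eqE /=; lia.
Qed.

Definition inversions v :=
  [set pq : 'I_n * 'I_n | (pq.1 < pq.2)%N && (v pq.2 < v pq.1)%N].
Definition inv v := #|inversions v|.

(** Composing with s_i moves the pairs of positions other than (i, i + 1)
    around without changing their relative order; only that pair becomes an
    inversion. *)
Lemma inv_up i v : (v (sl i) < v (sr i))%N -> inv (sref i * v) = (inv v).+1.
Proof.
move=> up; pose f (pq : 'I_n * 'I_n) := (sref i pq.1, sref i pq.2).
have fK : involutive f by move=> [p q]; rewrite /f /= !srefK.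
have -> : inv (sref i * v) = #|(sl i, sr i) |: f @: inversions v|.
  rewrite /inv; congr #|pred_of_set _|; apply/setP => -[p q].
  rewrite !inE /= !permM.
  have -> : ((p, q) \in f @: inversions v) = (f (p, q) \in inversions v).
    by rewrite -{1}[(p, q)]fK mem_imset //; apply: inv_inj.
  rewrite inE /=.
  have [[-> ->]|ne] := eqVneq (p, q) (sl i, sr i).
    by rewrite !(sref_sl, sref_sr) up /= ltnSn.
  rewrite /=; apply/andP/andP => -[pq vpq]; split=> //; first exact: sref_lt.
  have := @sref_lt i _ _ pq; rewrite !srefK; apply.
  apply/eqP => -[E1 E2]; move: vpq; rewrite E1 E2 => /ltnW; rewrite leqNgt => /negP; apply.
  exact: up.
rewrite cardsU1 card_imset; last exact: inv_inj.
suff -> : (sl i, sr i) \notin f @: inversions v by [].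
rewrite -[(sl i, sr i)]fK mem_imset; last exact: inv_inj.
by rewrite inE /= /f /= sref_sl sref_sr /=; apply/negP => /andP[]; lia.
Qed.

Lemma inv_down i v : (v (sr i) < v (sl i))%N -> inv v = (inv (sref i * v)).+1.
Proof.
move=> down; rewrite -{1}[v](srefKg i) inv_up //.
by rewrite !permM sref_sl sref_sr.
Qed.

Lemma descentVascent i v :
  (v (sr i) < v (sl i))%N \/ (v (sl i) < v (sr i))%N.
Proof.
have : v (sr i) != v (sl i) by rewrite (inj_eq perm_inj) eq_sym sl_neq_sr.
by rewrite neq_ltn => /orP.
Qed.

Lemma inv_sref_le i v : (inv (sref i * v) <= (inv v).+1)%N.
Proof. by case: (descentVascent i v) => [/inv_down ->|/inv_up ->] //; lia. Qed.

Lemma inv1 : inv 1 = 0%N.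
Proof.
apply/eqP; rewrite cards_eq0; apply/eqP/setP => -[p q]; rewrite !inE /= !perm1.
by apply/negP => /andP[]; lia.
Qed.

Lemma word_perm_cons i w : word_perm (i :: w) = (sref i * word_perm w)%g.
Proof. by rewrite /word_perm big_cons. Qed.
Lemma word_perm_nil : word_perm [::] = 1%g :> 'S_n.
Proof. by rewrite /word_perm big_nil. Qed.
Lemma word_perm_cat w w' : word_perm (w ++ w') = (word_perm w * word_perm w')%g.
Proof. by rewrite /word_perm big_cat. Qed.

Lemma inv_word_le w : (inv (word_perm w) <= size w)%N.
Proof.
elim: w => [|i w IH]; first by rewrite word_perm_nil inv1.
by rewrite word_perm_cons (leq_trans (inv_sref_le _ _)).
Qed.

(** A permutation without descents is increasing, hence moves no point down;
    as the same holds for its inverse, it is the identity. *)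
Lemma no_descent v : (forall i, (v (sl i) < v (sr i))%N) -> v = 1%g.
Proof.
have ge (u : 'S_n) : {homo u : p q / (p < q)%N} -> forall p : 'I_n, (p <= u p)%N.
  move=> hu [m Hm]; elim: m Hm => //= m IH Hm.
  by apply: leq_ltn_trans (IH (ltnW Hm)) _; apply: hu => /=.
move=> up; have hv : {homo v : p q / (p < q)%N}.
  move=> [p Hp] [q Hq] /= pq.
  elim: q Hq pq => // q IH Hq pq.
  have Hi : (q < n.-1)%N by lia.
  have E1 : sl (Ordinal Hi) = Ordinal (ltnW Hq) by apply: val_inj.
  have E2 : sr (Ordinal Hi) = Ordinal Hq by apply: val_inj.
  have := up (Ordinal Hi); rewrite E1 E2; apply: leq_trans; rewrite ltnS.
  have [/val_eqP /= E|ne] := eqVneq (Ordinal Hp) (Ordinal (ltnW Hq)).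
    by rewrite leq_eqVlt; apply/orP; left; apply/eqP; congr (val (v _)); apply: val_inj; apply/eqP.
  apply: ltnW; apply: IH; move: ne; rewrite -val_eqE /=; lia.
have hv' : {homo v^-1%g : p q / (p < q)%N}.
  move=> p q pq; rewrite ltnNge leq_eqVlt; apply/negP => /orP[/eqP/val_inj/perm_inj E|/hv].
    by rewrite E ltnn in pq.
  by rewrite !permKV; lia.
apply/permP => p; apply: val_inj; rewrite perm1 /=; apply/eqP.
by rewrite eqn_leq ge // andbT -{2}[p](permK v) ge.
Qed.

Lemma inv_word v : exists2 w, word_perm w = v & size w = inv v.
Proof.
elim: {v}(inv v) {-2}v (erefl (inv v)) => [|d IH] v Ev.
  exists [::] => //; rewrite word_perm_nil; apply/esym/no_descent => i.
  by case: (descentVascent i v) => // /inv_down; rewrite Ev.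
have [/forallP H|] := boolP [forall i, (v (sl i) < v (sr i))%N].
  by rewrite (no_descent H) inv1 in Ev.
rewrite negb_forall => /existsP[i ni].
case: (descentVascent i v) => [down|up]; last by rewrite up in ni.
have := inv_down down; rewrite Ev => -[/esym/IH[w Ew Sw]].
by exists (i :: w); rewrite ?word_perm_cons ?Ew ?srefKg //= Sw -(inv_down down).
Qed.

Lemma reducedE w : reduced w <-> size w = inv (word_perm w).
Proof.
split=> [red|E w' Ew']; last by rewrite E -Ew' inv_word_le.
have [w' Ew' Sw'] := inv_word (word_perm w).
by apply/eqP; rewrite eqn_leq inv_word_le -Sw' red.
Qed.

(** Equality in the positive braid monoid. Unlike the equality of permutations
    it preserves the length, and within a class the product of the tau_i along
    a word changes only by products with fewer factors. *)
Inductive braid_eq : word -> word -> Prop :=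
  | beq_refl w : braid_eq w w
  | beq_sym w w' : braid_eq w w' -> braid_eq w' w
  | beq_trans w' w w'' : braid_eq w w' -> braid_eq w' w'' -> braid_eq w w''
  | beq_far a b i j : far i j -> braid_eq (a ++ i :: j :: b) (a ++ j :: i :: b)
  | beq_braid a b i j : j = i.+1 :> nat ->
      braid_eq (a ++ i :: j :: i :: b) (a ++ j :: i :: j :: b).

Lemma beq_cons i w w' : braid_eq w w' -> braid_eq (i :: w) (i :: w').
Proof.
elim=> {w w'} [w|w w' _ IH|w' w w'' _ IH1 _ IH2|a b j l jl|a b j l jl].
- exact: beq_refl.
- exact: beq_sym.
- exact: beq_trans IH1 IH2.
- by have := @beq_far (i :: a) b _ _ jl.
- by have := @beq_braid (i :: a) b _ _ jl.
Qed.

Lemma beq_size w w' : braid_eq w w' -> size w = size w'.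
Proof.
by elim=> {w w'} [w|w w' _ ->|w' w w'' _ -> _ ->|a b j l _|a b j l _] //;
  rewrite !size_cat.
Qed.

Lemma beq_perm w w' : braid_eq w w' -> word_perm w = word_perm w'.
Proof.
elim=> {w w'} [w|w w' _ ->|w' w w'' _ -> _ ->|a b i j ij|a b i j ij] //;
  rewrite !word_perm_cat !word_perm_cons; congr (_ * _)%g.
  by rewrite !mulgA s_far.
by rewrite !mulgA s_braid.
Qed.

(** Matsumoto's theorem. If two reduced words start with distinct letters i and
    j, then both i and j are descents of the permutation, which therefore has a
    reduced word starting with the longest element of the subgroup generated by
    s_i and s_j; the two expressions of that element differ by one braid or
    commutation move. *)
Lemma reduced_braid_eq w w' :
  size w = inv (word_perm w) -> size w' = inv (word_perm w') ->
  word_perm w = word_perm w' -> braid_eq w w'.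
Proof.
have step d u u' i : size u = inv (word_perm u) -> size u = d -> u = i :: u' ->
    size u' = inv (word_perm u') /\ (word_perm u (sr i) < word_perm u (sl i))%N.
  move=> + _ Eu; rewrite Eu /= word_perm_cons => Su.
  have le1 := inv_word_le u'.
  case: (descentVascent i (sref i * word_perm u')) => [down|up].
    by split=> //; have := inv_down down; rewrite srefKg; lia.
  by have := inv_up up; rewrite srefKg; lia.
have [d] := ubnP (size w); elim: d w w' => // d IH w w' ltd Sw Sw' E.
case: w w' => [|i u] [|j u'] in ltd Sw Sw' E *.
- exact: beq_refl.
- by rewrite -E word_perm_nil inv1 in Sw'.
- by rewrite E word_perm_nil inv1 in Sw.
have [Su di] := step _ _ _ _ Sw erefl erefl.
have [Su' dj] := step _ _ _ _ Sw' erefl erefl.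
have [ij|ij] := eqVneq i j.
  move: E; rewrite ij !word_perm_cons => /mulgI E.
  by apply: beq_cons; apply: IH.
(* It suffices to find a reduced word of the permutation that starts with i
   and becomes, by one move, a word that starts with j. *)
have key (a b : 'I_n.-1) c c' : size c = size c' ->
   braid_eq (i :: a :: c) (j :: b :: c') ->
   word_perm (i :: a :: c) = word_perm (i :: u) ->
   size c = (size u).-1 -> (0 < size u)%N -> braid_eq (i :: u) (j :: u').
  move=> Scc cc' Ec Sc u0.
  have Su2 : size u = size u' by move: Sw Sw'; rewrite E /=; lia.
  have E' := beq_perm cc'.
  apply: (@beq_trans (i :: a :: c)).
    apply: beq_cons; move: Ec; rewrite [LHS]word_perm_cons [RHS]word_perm_cons => /mulgI Ec.
    by apply: IH => //; rewrite ?Ec -?Su //=; lia.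
  apply: (beq_trans cc').
  apply: beq_cons; apply/beq_sym.
  have Ec' : word_perm u' = word_perm (b :: c').
    by apply: (@mulgI _ (sref j)); rewrite -!word_perm_cons -E -Ec E'.
  apply: IH => //; first by rewrite -Su2.
  by rewrite -Ec' -Su' /= -Scc; lia.
set v := word_perm (i :: u) in Sw E di key *.
rewrite -E in dj.
have Eiv := inv_down di.
have [farij|] := boolP (far i j).
  have djs : ((sref i * v)%g (sr j) < (sref i * v)%g (sl j))%N.
    rewrite !permM /sref !tpermD //; move: farij; rewrite /far -?val_eqE /=; lia.
  have Ejv := inv_down djs.
  have [c Ec Sc] := inv_word (sref j * (sref i * v)).
  have Ssu : size u = inv (sref i * v) by move: Sw; rewrite /= Eiv => -[].
  apply: (key j i c c) => //; last by rewrite Ssu Ejv.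
  - exact: (@beq_far [::]).
  - by rewrite !word_perm_cons Ec !srefKg.
  - by rewrite Sc Ssu Ejv.
move=> nfar.
have nb : (j = i.+1 :> nat) \/ (i = j.+1 :> nat).
  by move: nfar ij; rewrite /far -val_eqE /=; lia.
have Ssu : size u = inv (sref i * v) by move: Sw; rewrite /= Eiv => -[].
case: nb => nb.
- have Elr : sl j = sr i by apply: val_inj.
  have sirj : sref i (sr j) = sr j by rewrite /sref tpermD // -val_eqE /=; lia.
  have sjli : sref j (sl i) = sl i by rewrite /sref tpermD // -val_eqE /=; lia.
  have d1 : ((sref i * v)%g (sr j) < (sref i * v)%g (sl j))%N.
    rewrite !permM sirj Elr sref_sr; apply: ltn_trans di.
    by rewrite -Elr.
  have E1 := inv_down d1.
  have d2 : ((sref j * (sref i * v))%g (sr i) < (sref j * (sref i * v))%g (sl i))%N.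
    by rewrite !permM sjli sref_sl -Elr sref_sl sirj.
  have E2 := inv_down d2.
  have [c Ec Sc] := inv_word (sref i * (sref j * (sref i * v))).
  apply: (key j i (i :: c) (j :: c)) => //=.
  + exact: (@beq_braid [::]).
  + by rewrite !word_perm_cons Ec !srefKg.
  + by rewrite Sc Ssu E1 E2.
  + by rewrite Ssu E1.
- have Elr : sl i = sr j by apply: val_inj.
  have silj : sref i (sl j) = sl j by rewrite /sref tpermD // -val_eqE /=; lia.
  have sjri : sref j (sr i) = sr i by rewrite /sref tpermD // -val_eqE /=; lia.
  have d1 : ((sref i * v)%g (sr j) < (sref i * v)%g (sl j))%N.
    rewrite !permM silj -Elr sref_sl; apply: ltn_trans dj.
    by rewrite -Elr.
  have E1 := inv_down d1.
  have d2 : ((sref j * (sref i * v))%g (sr i) < (sref j * (sref i * v))%g (sl i))%N.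
    by rewrite !permM sjri sref_sr Elr sref_sr silj.
  have E2 := inv_down d2.
  have [c Ec Sc] := inv_word (sref i * (sref j * (sref i * v))).
  apply: (key j i (i :: c) (j :: c)) => //=.
  + by apply/beq_sym; exact: (@beq_braid [::]).
  + by rewrite !word_perm_cons Ec !srefKg.
  + by rewrite Sc Ssu E1 E2.
  + by rewrite Ssu E1.
Qed.

(** At the shortest suffix that is not reduced, the first letter i is a descent
    of the rest, so by Matsumoto's theorem the rest can be rewritten with i in
    front. *)
Lemma braid_eq_reducedVsquare w :
  size w = inv (word_perm w) \/ exists a i b, braid_eq w (a ++ i :: i :: b).
Proof.
elim: w => [|i w [Sw|[a [j [b ab]]]]]; last 1 first.
- by right; exists (i :: a), j, b; apply: (beq_cons i ab).
- by left; rewrite word_perm_nil inv1.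
case: (descentVascent i (word_perm w)) => [down|up].
  have [c Ec Sc] := inv_word (sref i * word_perm w).
  right; exists [::], i, c; apply: beq_cons; apply: reduced_braid_eq => //.
    by rewrite word_perm_cons Ec srefKg /= Sc -inv_down.
  by rewrite word_perm_cons Ec srefKg.
by left; rewrite word_perm_cons inv_up //= Sw.
Qed.

Variables (J : pred word) (HJ : reduced_family J).

Lemma family_reduced w : J w -> size w = inv (word_perm w).
Proof. by move=> /HJ.1/reducedE. Qed.

Lemma family_inj w w' : J w -> J w' -> word_perm w = word_perm w' -> w = w'.
Proof.
move=> Jw Jw' E; have [u [_ U]] := HJ.2 (word_perm w).
by rewrite -(U w) // (U w').
Qed.

Lemma family_word v : exists2 w, J w & word_perm w = v.
Proof. by have [w [[Jw Ew] _]] := HJ.2 v; exists w. Qed.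

Lemma word_cases w :
  (exists2 u, J u & braid_eq w u) \/ exists a i b, braid_eq w (a ++ i :: i :: b).
Proof.
case: (braid_eq_reducedVsquare w) => [Sw|]; last by right.
have [u Ju Eu] := family_word (word_perm w).
by left; exists u => //; apply: reduced_braid_eq => //; apply: family_reduced.
Qed.
End Words.

(** * Polynomials in the x_p and words in the tau_i *)

HB.instance Definition _ (k : pzRingType) (A : nuAlgType k) (a : A) :=
  GRing.isLinear.Build k A A *:%R (nmul a)
    (fun c u v => etrans (nmulDr a (c *: u) v) (congr1 (+%R^~ _) (nmulZr c a u))).

Section RightMultiplication.
Variables (k : pzRingType) (A : nuAlgType k).
Definition nmulr (b a : A) := a ** b.
Lemma nmulr_linear b : linear (nmulr b).
Proof. by move=> c u v; rewrite /nmulr nmulDl nmulZl. Qed.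
HB.instance Definition _ b := GRing.isLinear.Build k A A *:%R (nmulr b) (nmulr_linear b).
Lemma nmul0l (a : A) : 0 ** a = 0. Proof. exact: (linear0 (nmulr a)). Qed.
Lemma nmulNl (a b : A) : (- a) ** b = - (a ** b). Proof. exact: (linearN (nmulr b)). Qed.
Lemma nmulBl (a b c : A) : (a - b) ** c = a ** c - b ** c.
Proof. exact: (linearB (nmulr c)). Qed.
End RightMultiplication.

(** Identities that are linear in an argument are checked on a spanning family. *)
Section SpanningFamilies.
Variables (k : nzRingType) (T : choiceType) (P : T -> Prop).

Lemma span_cancel (V W : lmodType k) (phi : {linear V -> W}) (psi : {linear W -> V})
    (b : T -> V) (c : T -> W) v :
  (forall t, phi (b t) = c t) -> (forall t, psi (c t) = b t) ->
  span b P v -> psi (phi v) = v.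
Proof.
move=> Hphi Hpsi; elim=> [|d t w _ _ IH]; first by rewrite !linear0.
by rewrite !linearP IH Hphi Hpsi.
Qed.

Variables (A B : nuAlgType k) (phi : {linear A -> B}) (b : T -> A).

Lemma span_intertwine a a' v :
  (forall t, phi (a ** b t) = a' ** phi (b t)) -> span b P v -> phi (a ** v) = a' ** phi v.
Proof.
move=> H; elim=> [|d t w _ _ IH]; first by rewrite !linear0.
by rewrite !linearP IH H.
Qed.

Lemma span_multiplicative v :
  (forall t w, phi (b t ** w) = phi (b t) ** phi w) ->
  span b P v -> forall w, phi (v ** w) = phi v ** phi w.
Proof.
move=> H; elim=> [|d t u _ _ IH] w; first by rewrite nmul0l !linear0 nmul0l.
by rewrite nmulDl nmulZl !linearP IH H nmulDl nmulZl.
Qed.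
End SpanningFamilies.

Lemma mnm_ind n (P : 'X_{1..n} -> Prop) :
  P 0%MM -> (forall i m, P m -> P (U_(i) + m)%MM) -> forall m, P m.
Proof.
move=> P0 PS m; have [d] := ubnP (mdeg m); elim: d m => // d IH m.
have [->//|m0] := eqVneq m 0%MM.
have [i mi] : exists i, m i != 0%N.
  apply/existsP; apply: contraNT m0; rewrite negb_exists => /forallP H.
  by apply/eqP/mnmP => i; move: (H i); rewrite negbK mnm0E => /eqP.
have Em : (m = U_(i) + (m - U_(i)))%MM by rewrite addmC submK // lep1mP.
by rewrite {1}Em mdegD mdeg1 ltnS => /IH; rewrite [in P m]Em; apply: PS.
Qed.

Lemma mpoly_gen_ind (k : comNzRingType) n (P : {mpoly k[n]} -> Prop) :
  (forall c p q, P p -> P q -> P (c *: p + q)) -> P 1 ->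
  (forall i p, P p -> P ('X_i * p)) -> forall p, P p.
Proof.
move=> Pl P1 PX.
have P0 : P 0 by rewrite -(addNr 1) -scaleN1r; apply: Pl.
elim/mpolyind => // c m p _ _ Pp; apply: Pl => //.
elim/mnm_ind: m => [|i m Pm]; first by rewrite mpolyX0.
by rewrite mpolyXD; apply: PX.
Qed.

Section Words.
Variables (k : comNzRingType) (I : choiceType) (n : nat).
Local Notation L := {ffun 'I_n -> I}.
Local Notation word := (seq 'I_n.-1).

(** The sequence of labels after the crossings of a word, read from the right. *)
Definition wact (T : Type) (w : word) (a : {ffun 'I_n -> T}) := foldr (@sact n T) a w.

Lemma wactE T w (a : {ffun 'I_n -> T}) p : wact w a p = a (word_perm w p).
Proof.
elim: w p => [|i w IH] p /=; first by rewrite word_perm_nil perm1.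
by rewrite word_perm_cons ffunE IH permM.
Qed.

Lemma eq_wact T w w' (a : {ffun 'I_n -> T}) :
  word_perm w = word_perm w' -> wact w a = wact w' a.
Proof. by move=> E; apply/ffunP => p; rewrite !wactE E. Qed.

Lemma wact_cat T w w' (a : {ffun 'I_n -> T}) : wact (w ++ w') a = wact w (wact w' a).
Proof. exact: foldr_cat. Qed.

Section Family.
Variables (B : nuAlgType k) (f : klr_gen I n -> B).
Local Notation e nu := (f (GOne nu)).
Local Notation x p nu := (f (GX p nu)).
Local Notation t i nu := (f (GTau i nu)).

(** The relations shared by H_n(Q), its associated graded algebra and the
    wreath product. *)
Record quiver_rel : Prop := QuiverRel {
  qr_ee : forall nu nu' : L, e nu ** e nu' = if nu == nu' then e nu else 0;
  qr_te : forall i (nu : L), t i nu = e (sact i nu) ** t i nu ** e nu;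
  qr_xe : forall p (nu : L), x p nu = e nu ** x p nu ** e nu;
  qr_xx : forall p q (nu : L), x p nu ** x q nu = x q nu ** x p nu
}.

Fixpoint tauw (w : word) (nu : L) (b : B) : B :=
  if w is i :: w' then t i (wact w' nu) ** tauw w' nu b else b.

Definition word_mon (s : word * 'X_{1..n} * L) : B :=
  tauw s.1.1 s.2 (xmon f s.2 s.1.2).

Lemma tauw_cat w w' nu b : tauw (w ++ w') nu b = tauw w (wact w' nu) (tauw w' nu b).
Proof. by elim: w => //= i w ->; rewrite wact_cat. Qed.

Lemma tauw_linear w nu : linear (tauw w nu).
Proof. by elim: w => //= i w IH c u v; rewrite IH linearP. Qed.
HB.instance Definition _ w nu :=
  GRing.isLinear.Build k B B *:%R (tauw w nu) (tauw_linear w nu).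

Hypothesis fq : quiver_rel.

Lemma mul_ee nu : e nu ** e nu = e nu. Proof. by rewrite (qr_ee fq) eqxx. Qed.
Lemma mul_e_x p nu : e nu ** x p nu = x p nu.
Proof. by rewrite (qr_xe fq) !nmulA mul_ee. Qed.
Lemma mul_x_e p nu : x p nu ** e nu = x p nu.
Proof. by rewrite (qr_xe fq) -!nmulA mul_ee. Qed.
Lemma mul_e_t i nu : e (sact i nu) ** t i nu = t i nu.
Proof. by rewrite (qr_te fq) !nmulA mul_ee. Qed.
Lemma mul_t_e i nu : t i nu ** e nu = t i nu.
Proof. by rewrite (qr_te fq) -!nmulA mul_ee. Qed.

Lemma xmon0 nu : xmon f nu 0%MM = e nu.
Proof. by rewrite /xmon; elim: (enum _) => //= p l ->; rewrite mnm0E. Qed.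

Let xfold nu (l : seq 'I_n) (m : 'X_{1..n}) b :=
  foldr (fun p b => iter (m p) (nmul (x p nu)) b) b l.

Let xfoldC nu q l m b : xfold nu l m (x q nu ** b) = x q nu ** xfold nu l m b.
Proof.
elim: l => //= p l ->; elim: (m p) => //= d ->.
by rewrite !nmulA (qr_xx fq).
Qed.

Lemma xmonU nu q m : xmon f nu (U_(q) + m)%MM = x q nu ** xmon f nu m.
Proof.
rewrite /xmon -!/(xfold _ _ _ _).
have /(_ (enum 'I_n) (enum_uniq _)) E (l : seq 'I_n) : uniq l ->
    xfold nu l (U_(q) + m)%MM (e nu) =
    if q \in l then x q nu ** xfold nu l m (e nu) else xfold nu l m (e nu).
  elim: l => //= p l IH /andP[pl /IH ->]; rewrite inE mnmDE mnm1E.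
  have [->|qp] := eqVneq q p; first by rewrite /= (negPf pl).
  rewrite /=; case: ifP => // _.
  by elim: (m p) => //= d ->; rewrite !nmulA (qr_xx fq).
by rewrite E mem_enum.
Qed.

(** The range of the sum no longer depends on P, which makes xpol linear. *)
Lemma xpolwE nu P d : (msize P <= d)%N ->
  xpol f nu P = \sum_(m : 'X_{1..n < d}) P@_m *: xmon f nu m.
Proof.
move=> le_Pd; set S : subFinType _ := 'X_{1..n < d}.
rewrite /xpol (ssrcomplements.big_mksub S) ?msupp_uniq //=; first last.
  by move=> m /msize_mdeg_lt /leq_trans; apply.
by rewrite big_rmcond //= => m /memN_msupp_eq0 ->; rewrite scale0r.
Qed.

Lemma xpol_linear nu : linear (xpol f nu).
Proof.
move=> c P R; pose d := maxn (msize (c *: P + R)) (maxn (msize P) (msize R)).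
rewrite !(@xpolwE _ _ d) /d ?leq_max ?leqnn ?orbT //.
rewrite scaler_sumr -big_split; apply: eq_bigr => m _.
by rewrite mcoeffD mcoeffZ scalerDl scalerA.
Qed.
HB.instance Definition _ nu :=
  GRing.isLinear.Build k {mpoly k[n]} B *:%R (xpol f nu) (xpol_linear nu).

Lemma xpolXm nu m : xpol f nu 'X_[m] = xmon f nu m.
Proof. by rewrite /xpol msuppX big_seq1 mcoeffX eqxx scale1r. Qed.
Lemma xpol1 nu : xpol f nu 1 = e nu.
Proof. by rewrite -mpolyX0 xpolXm xmon0. Qed.
Lemma xpolXM nu p P : xpol f nu ('X_p * P) = x p nu ** xpol f nu P.
Proof.
elim/mpolyind: P => [|c m P _ _ IH]; first by rewrite mulr0 !linear0.
by rewrite mulrDr -scalerAr -mpolyXD !linearP /= IH !xpolXm xmonU.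
Qed.
Lemma mul_e_xpol nu P : e nu ** xpol f nu P = xpol f nu P.
Proof.
elim/mpoly_gen_ind: P => [c P R IH IH'||p P IH].
- by rewrite !linearP /= IH IH'.
- by rewrite xpol1 mul_ee.
- by rewrite xpolXM nmulA mul_e_x.
Qed.
Lemma xpolX nu p : xpol f nu 'X_p = x p nu.
Proof. by rewrite -[X in xpol _ _ X]mulr1 xpolXM xpol1 mul_x_e. Qed.

Lemma mul_e_tauw mu w nu P :
  e mu ** tauw w nu (xpol f nu P) =
  if mu == wact w nu then tauw w nu (xpol f nu P) else 0.
Proof.
case: w => [|i w] /=.
  by rewrite -mul_e_xpol nmulA (qr_ee fq); case: eqP => [->|_]; rewrite ?nmul0l.
rewrite nmulA -[t i _ in LHS]mul_e_t nmulA (qr_ee fq).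
by case: eqP => [->|_]; rewrite ?nmul0l // mul_e_t.
Qed.

Lemma mul_x_neq mu w nu p P : mu <> wact w nu ->
  x p mu ** tauw w nu (xpol f nu P) = 0.
Proof.
by move=> /eqP/negPf E; rewrite -mul_x_e -nmulA mul_e_tauw E linear0.
Qed.
Lemma mul_t_neq mu w nu i P : mu <> wact w nu ->
  t i mu ** tauw w nu (xpol f nu P) = 0.
Proof.
by move=> /eqP/negPf E; rewrite -mul_t_e -nmulA mul_e_tauw E linear0.
Qed.
End Family.
End Words.

(** * Divided differences *)

Section Polynomials.
Variables (k : comNzRingType) (n : nat).
Local Notation R := {mpoly k[n]}.
Implicit Types (p q : 'I_n) (f g : R).

Lemma msymXU (s : 'S_n) p : msym s 'X_p = 'X_(s p) :> R.
Proof.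
rewrite msymX; congr 'X_[_]; apply/mnmP => q; rewrite mnmE !mnm1E.
by rewrite -(inj_eq (@perm_inj _ s)) permKV.
Qed.

(** The leading coefficient is 1 or -1, whatever the zero divisors of k. *)
Lemma lreg_subX p q : p != q -> GRing.lreg ('X_p - 'X_q : R).
Proof.
move=> pq; have Upq : U_(p)%MM != U_(q)%MM :> 'X_{1..n}.
  apply: contra pq => /eqP/mnmP/(_ p); rewrite !mnm1E eqxx.
  by case: eqP => // ->.
apply: lreg_mleadc; case: (Order.TotalTheory.ltgtP (U_(p)%MM : 'X_{1..n}) U_(q)%MM) => [lt|lt|E].
- rewrite mleadDr ?mleadN ?mleadXm // mcoeffB !mcoeffX (negPf Upq) eqxx sub0r.
  by apply: lregN; apply: lreg1.
- rewrite mleadDl ?mleadN ?mleadXm // mcoeffB !mcoeffX eqxx.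
  by rewrite eq_sym (negPf Upq) subr0; apply: lreg1.
- by rewrite E eqxx in Upq.
Qed.

(** The map f |-> s(f) - f is a twisted derivation, so the divisibility passes
    from the variables to all polynomials. *)
Lemma tperm_divisible p q f :
  exists g, ('X_p - 'X_q) * g = msym (tperm p q) f - f.
Proof.
elim/mpoly_gen_ind: f => [c f f' [g Eg] [g' Eg']||a f [g Eg]].
- exists (c *: g + g'); rewrite mulrDr -scalerAr Eg Eg' linearP /=.
  by rewrite scalerBr opprD addrACA.
- by exists 0; rewrite msym1 subrr mulr0.
- have -> : msym (tperm p q) ('X_a * f) - 'X_a * f =
    'X_(tperm p q a) * (('X_p - 'X_q) * g) + ('X_(tperm p q a) - 'X_a) * f.
    by rewrite Eg msymM msymXU; ring.
  case: tpermP => [->|->|_ _].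
  + by exists ('X_q * g - f); ring.
  + by exists ('X_p * g + f); ring.
  + by exists ('X_a * g); ring.
Qed.

Lemma tperm_divisible_sig p q f :
  {g | ('X_p - 'X_q) * g = msym (tperm p q) f - f}.
Proof. exact: cid (tperm_divisible p q f). Qed.

(** The divided difference (s_i f - f) / (x_i - x_(i+1)). *)
Definition ddiff (i : 'I_n.-1) f : R := sval (tperm_divisible_sig (sl i) (sr i) f).

Lemma ddiffE i f : ('X_(sl i) - 'X_(sr i)) * ddiff i f = msym (sref i) f - f.
Proof. exact: svalP (tperm_divisible_sig _ _ _). Qed.

Lemma msym_srefK i f : msym (sref i) (msym (sref i) f) = f.
Proof. by rewrite -msymMm sref2 msym1m. Qed.

Definition subst2 (P : {mpoly k[2]}) (x y : R) : R := P \mPo [tuple x; y].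

Lemma mpoly2_ind (T : {mpoly k[2]} -> Prop) :
  (forall c P P', T P -> T P' -> T (c *: P + P')) -> T 1 ->
  (forall P, T P -> T ('X_0 * P)) -> (forall P, T P -> T ('X_1 * P)) -> forall P, T P.
Proof.
move=> Tl T1 TX0 TX1; apply: mpoly_gen_ind => // -[[|[|//]] Hi] P TP.
  by rewrite (_ : Ordinal Hi = 0); [apply: TX0 | apply: val_inj].
by rewrite (_ : Ordinal Hi = 1); [apply: TX1 | apply: val_inj].
Qed.

Lemma subst2_is_linear x y : linear (fun P => subst2 P x y).
Proof. by move=> c P P'; rewrite /subst2 linearP. Qed.
Lemma subst2_1 x y : subst2 1 x y = 1. Proof. exact: rmorph1. Qed.
Lemma subst2M P P' x y : subst2 (P * P') x y = subst2 P x y * subst2 P' x y.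
Proof. exact: rmorphM. Qed.
Lemma subst2_X0 x y : subst2 'X_0 x y = x.
Proof. by rewrite /subst2 comp_mpolyXU. Qed.
Lemma subst2_X1 x y : subst2 'X_1 x y = y.
Proof. by rewrite /subst2 comp_mpolyXU. Qed.

Lemma msym_subst2 (s : 'S_n) P x y : msym s (subst2 P x y) = subst2 P (msym s x) (msym s y).
Proof.
elim/mpoly2_ind: P => [c P P' IH IH'||P IH|P IH].
- by rewrite !subst2_is_linear linearP /= IH IH'.
- by rewrite !subst2_1 msym1.
- by rewrite !subst2M !subst2_X0 msymM IH.
- by rewrite !subst2M !subst2_X1 msymM IH.
Qed.

Lemma subst2_quotient P p q (y : R) (yE : msym (tperm p q) y = y) :
  exists g, ('X_q - 'X_p) * g = subst2 P 'X_q y - subst2 P 'X_p y.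
Proof.
have [g Eg] := tperm_divisible p q (subst2 P 'X_p y).
exists (- g); rewrite mulrN -mulNr opprB Eg msym_subst2 yE msymXU tpermL //.
Qed.
End Polynomials.

(** * Identities between divided differences and twisted permutations *)

Section Identities.
Variables (R : comNzRingType) (s1 s2 : {rmorphism R -> R}).

(** After multiplication by DA DB, both composites become the same combination
    of f, s1 f, s2 f and s1 (s2 f). *)
Lemma twisted_commute (A B : R -> R) (DA UA VA DB UB VB : R) :
  (forall f, s1 (s2 f) = s2 (s1 f)) ->
  (forall f, DA * A f = UA * s1 f - VA * f) ->
  (forall f, DB * B f = UB * s2 f - VB * f) ->
  s2 DA = DA -> s2 UA = UA -> s2 VA = VA -> s1 DB = DB -> s1 UB = UB -> s1 VB = VB ->
  GRing.lreg DA -> GRing.lreg DB -> forall f, A (B f) = B (A f).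
Proof.
move=> sC EA EB DA2 UA2 VA2 DB1 UB1 VB1 rA rB f.
apply: rA; apply: rB.
have E1 : DB * s1 (B f) = UB * s1 (s2 f) - VB * s1 f.
  by rewrite -{1}DB1 -rmorphM EB rmorphB !rmorphM UB1 VB1.
have E2 : DA * s2 (A f) = UA * s2 (s1 f) - VA * s2 f.
  by rewrite -{1}DA2 -rmorphM EA rmorphB !rmorphM UA2 VA2.
transitivity (UA * (DB * s1 (B f)) - VA * (DB * B f)); first by rewrite EA; ring.
transitivity (UB * (DA * s2 (A f)) - VB * (DA * A f)); last first.
  by rewrite (mulrCA DB) EB; ring.
by rewrite E1 E2 EA EB sC; ring.
Qed.

Variables x1 x2 x3 : R.
Hypotheses (s1x1 : s1 x1 = x2) (s1x2 : s1 x2 = x1) (s1x3 : s1 x3 = x3).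
Hypotheses (s2x1 : s2 x1 = x1) (s2x2 : s2 x2 = x3) (s2x3 : s2 x3 = x2).
Hypotheses (s1K : involutive s1) (s2K : involutive s2).
Hypothesis sbr : forall f, s1 (s2 (s1 f)) = s2 (s1 (s2 f)).
Variables d1 d2 : R -> R.
Hypothesis d1E : forall f, (x1 - x2) * d1 f = s1 f - f.
Hypothesis d2E : forall f, (x2 - x3) * d2 f = s2 f - f.
Hypotheses (r12 : GRing.lreg (x1 - x2)) (r13 : GRing.lreg (x1 - x3))
  (r23 : GRing.lreg (x2 - x3)).
Let sE := (s1x1, s1x2, s1x3, s2x1, s2x2, s2x3).

Let s1d1 f : s1 (d1 f) = d1 f.
Proof.
apply: r12; rewrite d1E; have := congr1 s1 (d1E f).
rewrite rmorphM !rmorphB s1K !sE => E.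
by transitivity (- ((x2 - x1) * s1 (d1 f))); [ring | rewrite E opprB].
Qed.
Let s2d2 f : s2 (d2 f) = d2 f.
Proof.
apply: r23; rewrite d2E; have := congr1 s2 (d2E f).
rewrite rmorphM !rmorphB s2K !sE => E.
by transitivity (- ((x3 - x2) * s2 (d2 f))); [ring | rewrite E opprB].
Qed.
Let s2d1 f : (x1 - x3) * s2 (d1 f) = s2 (s1 f) - s2 f.
Proof. by have := congr1 s2 (d1E f); rewrite rmorphM !rmorphB !sE. Qed.
Let s1d2 f : (x1 - x3) * s1 (d2 f) = s1 (s2 f) - s1 f.
Proof. by have := congr1 s1 (d2E f); rewrite rmorphM !rmorphB !sE. Qed.
Let s2s1d2 f : (x1 - x2) * s2 (s1 (d2 f)) = s2 (s1 (s2 f)) - s2 (s1 f).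
Proof. by have := congr1 s2 (s1d2 f); rewrite rmorphM !rmorphB !sE. Qed.
Let s1s2d1 f : (x2 - x3) * s1 (s2 (d1 f)) = s1 (s2 (s1 f)) - s1 (s2 f).
Proof. by have := congr1 s1 (s2d1 f); rewrite rmorphM !rmorphB !sE. Qed.

(** Multiplied by the Vandermonde product, both sides are the alternating sum
    of the six permutations of f. *)
Lemma ddiff_braid f : d2 (d1 (d2 f)) = d1 (d2 (d1 f)).
Proof.
apply: r12; apply: r13; apply: r23.
transitivity (s2 (s1 (s2 f)) - s2 (s1 f) - s1 (s2 f) + s1 f + s2 f - f).
  transitivity ((x1 - x2) * (x1 - x3) * ((x2 - x3) * d2 (d1 (d2 f)))); first by ring.
  rewrite d2E.
  transitivity ((x1 - x2) * ((x1 - x3) * s2 (d1 (d2 f)))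
     - (x1 - x3) * ((x1 - x2) * d1 (d2 f))); first by ring.
  rewrite s2d1 d1E s2d2.
  transitivity ((x1 - x2) * s2 (s1 (d2 f)) - (x1 - x3) * s1 (d2 f) + (x2 - x3) * d2 f).
    by ring.
  by rewrite s2s1d2 s1d2 d2E; ring.
transitivity ((x1 - x3) * (x2 - x3) * ((x1 - x2) * d1 (d2 (d1 f)))); last by ring.
rewrite d1E.
transitivity ((x2 - x3) * ((x1 - x3) * s1 (d2 (d1 f)))
   - (x1 - x3) * ((x2 - x3) * d2 (d1 f))); last by ring.
rewrite s1d2 d2E s1d1.
transitivity ((x2 - x3) * s1 (s2 (d1 f)) - (x1 - x3) * s2 (d1 f) + (x1 - x2) * d1 f).
  by rewrite s1s2d1 s2d1 d1E sbr; ring.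
by ring.
Qed.

(** The names of the next lemmas record the labels at three consecutive
    positions: equal labels cross by a divided difference, distinct ones by a
    permutation followed by a multiplication. Only the labels a, b, a produce a
    correction term. *)
Variables p q r : R -> R -> R.
Hypotheses (s1p : {morph s1 : x y / p x y}) (s2p : {morph s2 : x y / p x y}).
Hypotheses (s1q : {morph s1 : x y / q x y}) (s2q : {morph s2 : x y / q x y}).
Hypotheses (s1r : {morph s1 : x y / r x y}) (s2r : {morph s2 : x y / r x y}).

Lemma twisted_braid_aab f :
  d2 (p x2 x1 * s1 (p x3 x2 * s2 f)) = p x2 x1 * s1 (p x3 x2 * s2 (d1 f)).
Proof.
apply: r23; rewrite d2E !rmorphM !s1p !s2p !sE.
transitivity (p x2 x1 * p x3 x1 * ((x2 - x3) * s1 (s2 (d1 f)))); last by ring.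
by rewrite s1s2d1 sbr; ring.
Qed.

Lemma twisted_braid_abb f :
  p x3 x2 * s2 (p x2 x1 * s1 (d2 f)) = d1 (p x3 x2 * s2 (p x2 x1 * s1 f)).
Proof.
apply: r12; rewrite d1E !rmorphM !s1p !s2p !s1p !sE.
transitivity (p x3 x2 * p x3 x1 * ((x1 - x2) * s2 (s1 (d2 f)))); first by ring.
by rewrite s2s1d2 sbr; ring.
Qed.

Lemma twisted_braid_abc f :
  p x3 x2 * s2 (q x2 x1 * s1 (r x3 x2 * s2 f)) =
  r x2 x1 * s1 (q x3 x2 * s2 (p x2 x1 * s1 f)).
Proof. by rewrite !rmorphM !(s1p, s2p, s1q, s2q, s1r, s2r, sE) sbr; ring. Qed.

Lemma twisted_braid_aba f :
  (x3 - x1) * (p x3 x2 * s2 (d1 (q x3 x2 * s2 f)) - q x2 x1 * s1 (d2 (p x2 x1 * s1 f))) =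
  (p x3 x2 * q x2 x3 - p x1 x2 * q x2 x1) * f.
Proof.
transitivity (q x2 x1 * ((x1 - x3) * s1 (d2 (p x2 x1 * s1 f)))
  - p x3 x2 * ((x1 - x3) * s2 (d1 (q x3 x2 * s2 f)))); first by ring.
rewrite s1d2 s2d1 !rmorphM s1K s2K !(s1p, s2p, s1q, s2q, sE) sbr; ring.
Qed.
End Identities.

(** * The family S generates *)

Section Generation.
Variables (k : comNzRingType) (I : choiceType) (n : nat).
Variable Q : I -> I -> {mpoly k[2]}.
Local Notation L := {ffun 'I_n -> I}.
Local Notation word := (seq 'I_n.-1).
Local Notation H := (klr n Q).
Local Notation elt := (klr_elt Q).

Lemma quiver_of_klr (B : nuAlgType k) (f : klr_gen I n -> B) :
  klr_rel Q f -> quiver_rel f.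
Proof. by case. Qed.

Let Hrel := @klr_relP k I n Q.
Let Hq := quiver_of_klr Hrel.

Lemma tau_wordE w nu b : tau_word w nu b = tauw elt w nu b :> H.
Proof. by elim: w => //= i w ->. Qed.

Lemma klr_SE (J : pred word) (t : {w | J w} * 'X_{1..n} * L) :
  klr_S Q J t = word_mon elt (val t.1.1, t.1.2, t.2).
Proof. exact: tau_wordE. Qed.

Lemma lift_linear_map (B : nuAlgType k) (f : klr_gen I n -> B) (Rf : klr_rel Q f) :
  exists phi : {linear H -> B}, forall a, phi a = palg_lift f a.
Proof.
by exists (HB.pack_for {linear H -> B} (palg_lift f : H -> B)
  (GRing.isLinear.Build k H B *:%R _ (palg_lift_linear Rf))).
Qed.

Lemma lift_tauw (B : nuAlgType k) (f : klr_gen I n -> B) (Rf : klr_rel Q f) w nu b :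
  palg_lift f (tauw elt w nu b) = tauw f w nu (palg_lift f b).
Proof.
by elim: w => //= i w IH; rewrite (palg_liftM Rf) IH (palg_lift_gen Rf).
Qed.

Lemma lift_word_mon (B : nuAlgType k) (f : klr_gen I n -> B) (Rf : klr_rel Q f) s :
  palg_lift f (word_mon elt s) = word_mon f s.
Proof. by rewrite /word_mon lift_tauw // xmon_lift. Qed.

Lemma fil_le d d' (a : H) : (d <= d')%N -> klr_fil d a -> klr_fil d' a.
Proof. by move=> /subnK <- Fa; elim: (d' - d)%N => // e; apply: klr_filS. Qed.

Lemma fil_add d (a b : H) : klr_fil d a -> klr_fil d b -> klr_fil d (a + b).
Proof. by move=> Fa Fb; rewrite -[a]scale1r; apply: klr_fil_lin. Qed.

Lemma fil_xpol nu P : klr_fil 0 (xpol elt nu P : H).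
Proof.
elim/mpoly_gen_ind: P => [c P P' IH IH'||p P IH].
- by rewrite (xpol_linear _ nu); apply: klr_fil_lin.
- by rewrite xpol1; apply: klr_fil1.
- by rewrite (xpolXM Hq); apply: (klr_filM (d := 0) (e := 0)) => //; apply: klr_filx.
Qed.

Lemma fil_tauw w nu d (b : H) : klr_fil d b -> klr_fil (size w + d) (tauw elt w nu b).
Proof.
by move=> Fb; elim: w => //= i w IH; apply: (klr_filM (d := 1)) => //; apply: klr_filt.
Qed.

Lemma fil_word_mon (s : word * 'X_{1..n} * L) : klr_fil (size s.1.1) (word_mon elt s : H).
Proof.
rewrite -[size _]addn0; apply: fil_tauw; rewrite -xpolXm; exact: fil_xpol.
Qed.

(** The coefficients of the commutator of tau_i and x_p lie in degree 0, so
    that left multiplication by a generator respects the length of words. *)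
Local Notation wspan d := (span (word_mon elt : _ -> H) (fun s => size s.1.1 <= d)%N).

Lemma wspan_word w nu m d : (size w <= d)%N -> wspan d (tauw elt w nu (xmon elt nu m) : H).
Proof.
by move=> wd; have := @span_gen _ _ _ (word_mon elt : _ -> H)
   (fun s => size s.1.1 <= d)%N (w, m, nu) wd.
Qed.

Lemma wspan_mul (g : klr_gen I n) d d' :
  (forall w nu m, (size w <= d)%N ->
     wspan d' (elt g ** tauw elt w nu (xmon elt nu m) : H)) ->
  forall u, wspan d u -> wspan d' (elt g ** u).
Proof.
move=> Hg u; elim=> [|c [[w m] nu] v /= wd _ IH].
  by rewrite linear0; apply: span0.
by rewrite linearP; apply: span_lin => //; apply: Hg.
Qed.

Lemma wspan_e nu d u : wspan d u -> wspan d (elt (GOne nu) ** u).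
Proof.
apply: wspan_mul => w mu m wd; rewrite -xpolXm (mul_e_tauw Hq).
by case: eqP => _; rewrite ?xpolXm; [apply: wspan_word | apply: span0].
Qed.

Lemma wspan_t i nu d u : wspan d u -> wspan d.+1 (elt (GTau i nu) ** u).
Proof.
apply: wspan_mul => w mu m wd.
have [->|ne] := eqVneq nu (wact w mu); first exact: (@wspan_word (i :: w)).
by rewrite -xpolXm (mul_t_neq Hq _ _ (elimN eqP ne)); apply: span0.
Qed.

Lemma wspan_x p nu d u : wspan d u -> wspan d (elt (GX p nu) ** u).
Proof.
apply: wspan_mul => w mu m; elim: w d p nu => [|i w IH] d p nu wd.
  have [->|/eqP ne] := eqVneq nu (wact [::] mu); last first.
    by rewrite -xpolXm (mul_x_neq Hq _ _ ne); apply: span0.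
  by rewrite /= -(xmonU Hq); apply: (@wspan_word [::]).
have [Enu|/eqP ne] := eqVneq nu (wact (i :: w) mu); last first.
  by rewrite -xpolXm (mul_x_neq Hq _ _ ne); apply: span0.
case: d wd => // d wd; have := klr_tx Hrel i (sref i p) (wact w mu).
rewrite srefK /= in Enu *; rewrite -Enu => E.
rewrite nmulA -[elt (GX p nu) ** _](subKr (elt (GTau i (wact w mu)) ** elt (GX (sref i p) (wact w mu)))) E.
rewrite nmulBl -nmulA; apply: spanD; first by apply: wspan_t; apply: IH.
rewrite -scaleN1r; apply: spanZ.
have We : wspan d.+1 (elt (GOne (wact w mu)) ** tauw elt w mu (xmon elt mu m)).
  by apply: wspan_e; apply: wspan_word; apply: leqW.
case: ifP => _; first by rewrite nmulNl -scaleN1r; apply: spanZ.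
by case: ifP => _ //; rewrite nmul0l; apply: span0.
Qed.

Lemma fil_wspan_mul d (a : H) : klr_fil d a ->
  forall e u, wspan e u -> wspan (d + e) (a ** u).
Proof.
elim=> {d a} [nu|p nu|i nu|d|d c a b _ IHa _ IHb|d a _ IH|d d' a b _ IHa _ IHb] e u Wu.
- exact: wspan_e.
- exact: wspan_x.
- exact: wspan_t.
- by rewrite nmul0l; apply: span0.
- by rewrite nmulDl nmulZl; apply: span_lin; [apply: IHa | apply: IHb].
- by apply: spanS (IH _ _ Wu) => s /leq_trans; apply; rewrite addSn.
- by rewrite -nmulA -addnA; apply: IHa; apply: IHb.
Qed.

Lemma fil_wspan d (a : H) : klr_fil d a -> wspan d a.
Proof.
elim=> {d a} [nu|p nu|i nu|d|d c a b _ IHa _ IHb|d a _ IH|d d' a b Fa _ _ IHb].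
- by rewrite -(xmon0 elt); apply: (@wspan_word [::]).
- by rewrite -(xpolX Hq) xpolXm; apply: (@wspan_word [::]).
- by rewrite -(mul_t_e Hq) -(xmon0 elt); apply: (@wspan_word [:: i]).
- exact: span0.
- exact: span_lin.
- by apply: spanS IH => s /leq_trans; apply.
- exact: (fil_wspan_mul Fa).
Qed.

Lemma fil_exhaustive (a : H) : exists d, klr_fil d a.
Proof.
elim/palg_ind: a => [[nu|p nu|i nu]||c a b [d Fa] [e Fb]|a b [d Fa] [e Fb]].
- by exists 0%N; apply: klr_fil1.
- by exists 0%N; apply: klr_filx.
- by exists 1%N; apply: klr_filt.
- by exists 0%N; apply: klr_fil0.
- exists (maxn d e); apply: klr_fil_lin; [apply: fil_le Fa|apply: fil_le Fb].
    exact: leq_maxl.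
  exact: leq_maxr.
- by exists (d + e)%N; apply: klr_filM.
Qed.

Lemma fil_braid (i j : 'I_n.-1) nu (b : H) d : j = i.+1 :> nat -> klr_fil d b ->
  klr_fil d (tauw elt [:: i; j; i] nu b - tauw elt [:: j; i; j] nu b).
Proof.
move=> ij Fb; rewrite -opprB -scaleN1r -[_ *: _]addr0.
apply: klr_fil_lin; last exact: klr_fil0.
rewrite /= !nmulA -nmulBl; have [E|/eqP ne] := eqVneq (nu (sl i)) (nu (sr j)); last first.
  by rewrite (klr_braid0 Hrel ij ne) nmul0l; apply: klr_fil0.
have [|P EP] := @subst2_quotient k n (Q (nu (sl i)) (nu (sr i))) (sl i) (sr j) 'X_(sr i).
  by rewrite msymXU tpermD // -val_eqE /=; lia.
rewrite (klr_braid Hrel ij E EP); apply: (klr_filM (d := 0)) => //.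
exact: fil_xpol.
Qed.

(** A move inside a word changes the product of the tau_i by a product in which
    the letters of the move are replaced by a polynomial. *)
Lemma fil_braid_eq w w' nu P : braid_eq w w' ->
  klr_fil (size w).-1 (tauw elt w nu (xpol elt nu P) - tauw elt w' nu (xpol elt nu P) : H).
Proof.
elim=> {w w'} [w|w w' ww' IH|w' w w'' ww' IH1 _ IH2|a b i j ij|a b i j ij].
- by rewrite subrr; apply: klr_fil0.
- rewrite -opprB -scaleN1r -[_ *: _]addr0 -(beq_size ww').
  by apply: klr_fil_lin => //; apply: klr_fil0.
- rewrite -[X in klr_fil _ X](subrKA (tauw elt w' nu (xpol elt nu P))).
  by apply: fil_add => //; rewrite (beq_size ww').
- have E (c : H) : tauw elt (i :: j :: b) nu c = tauw elt (j :: i :: b) nu c.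
    by rewrite /= !nmulA (klr_far Hrel _ ij).
  by rewrite !tauw_cat E [wact (i :: j :: b) nu](sact_far _ ij) subrr; apply: klr_fil0.
- rewrite !tauw_cat /= (sact_braid _ ij) -linearB /=.
  apply: (@fil_le (size a + (size b + 0))%N); first by rewrite size_cat /=; lia.
  apply: fil_tauw; apply: (fil_braid _ ij).
  by apply: fil_tauw; apply: fil_xpol.
Qed.

Lemma fil_square a i b nu P :
  klr_fil (size a + size b) (tauw elt (a ++ i :: i :: b) nu (xpol elt nu P) : H).
Proof.
rewrite tauw_cat; apply: fil_tauw => /=; rewrite nmulA (klr_tt Hrel).
rewrite -[size b]add0n; apply: klr_filM; first exact: fil_xpol.
by rewrite -[size b]addn0; apply: fil_tauw; apply: fil_xpol.
Qed.

Variables (J : pred word) (HJ : reduced_family J).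

Local Notation Jspan d :=
  (span (klr_S Q J) (fun t => size (val t.1.1) <= d)%N).

(** By induction on the length: modulo shorter words, a word is either the one
    of J or contains a square, which is a polynomial. *)
Lemma wspan_Jspan d (a : H) : wspan d a -> Jspan d a.
Proof.
elim: d {-2}d (leqnn d) a => [|D IH] d dD a.
  have Jw (w : word) m nu : (size w <= d)%N -> Jspan d (word_mon elt (w, m, nu)).
    move=> wd; have /size0nil -> : size w = 0%N by lia.
    have [u Ju Eu] := family_word HJ 1%g.
    have Su := family_reduced HJ Ju; rewrite Eu inv1 in Su.
    have := @span_gen _ _ _ (klr_S Q J) (fun t => size (val t.1.1) <= d)%N
        (exist _ u Ju, m, nu).
    by rewrite klr_SE /= (size0nil Su); apply.
  elim=> [|c [[w m] nu] v /= wd _ IHv]; first exact: span0.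
  by apply: span_lin => //; apply: Jw.
have low e (b : H) : (e < d)%N -> klr_fil e b -> Jspan d b.
  move=> ed Fb; apply: spanS (IH e _ _ (fil_wspan Fb)); last by lia.
  by move=> t /leq_trans; apply; apply: ltnW.
have Jw (w : word) m nu : (size w <= d)%N -> Jspan d (word_mon elt (w, m, nu)).
  move=> wd; rewrite /word_mon /= -xpolXm.
  case: (word_cases HJ w) => [[u Ju wu]|[b [i [c' wu]]]].
    rewrite -[X in Jspan d X](subrK (tauw elt u nu (xpol elt nu 'X_[m]))).
    apply: spanD; last first.
      have := @span_gen _ _ _ (klr_S Q J) (fun t => size (val t.1.1) <= d)%N
        (exist _ u Ju, m, nu).
      by rewrite klr_SE /word_mon /= xpolXm -(beq_size wu); apply.
    case: (posnP (size w)) => [w0|w0].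
      move: (beq_size wu); rewrite w0 => /esym/size0nil ->.
      by move/size0nil: w0 => ->; rewrite subrr; apply: span0.
    by apply: low (fil_braid_eq _ _ wu); lia.
  have Sw := beq_size wu; rewrite size_cat /= in Sw.
  rewrite -[X in Jspan d X](subrK (tauw elt (b ++ i :: i :: c') nu (xpol elt nu 'X_[m]))).
  apply: spanD; first by apply: low (fil_braid_eq _ _ wu); lia.
  by apply: low (fil_square _ _ _ _ _); lia.
elim=> [|c [[w m] nu] v /= wd _ IHv]; first exact: span0.
by apply: span_lin => //; apply: Jw.
Qed.

Lemma fil_Jspan d (a : H) : klr_fil d a -> Jspan d a.
Proof. by move=> /fil_wspan/wspan_Jspan. Qed.

Lemma klr_S_generating : generating (klr_S Q J).
Proof.
apply: generatingE => a; have [d /fil_Jspan] := fil_exhaustive a.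
exact: spanS.
Qed.
End Generation.

(** * The polynomial representation *)

Section KEndo.
Variables (k : comPzRingType) (V : lmodType k).

(** An alias of endo, which is canonically a Z-algebra, that carries the
    k-algebra structure. *)
Definition kendo := endo V.
HB.instance Definition _ := GRing.Zmodule.on kendo.
Implicit Types f g : kendo.

Lemma kendo_scale_subproof (c : k) f : linear (fun a => c *: f a).
Proof. by move=> d a b; rewrite linearP scalerDr !scalerA mulrC. Qed.
Definition kendo_scale c f : kendo := Endo (kendo_scale_subproof c f).

Lemma kendo_scaleA c d f : kendo_scale c (kendo_scale d f) = kendo_scale (c * d) f.
Proof. by apply: endoP => a /=; rewrite scalerA. Qed.
Lemma kendo_scale1 : left_id 1 kendo_scale.
Proof. by move=> f; apply: endoP => a /=; rewrite scale1r. Qed.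
Lemma kendo_scaleDr : right_distributive kendo_scale +%R.
Proof. by move=> c f g; apply: endoP => a; apply: scalerDr. Qed.
Lemma kendo_scaleDl f : {morph kendo_scale^~ f : c d / c + d}.
Proof. by move=> c d; apply: endoP => a; apply: scalerDl. Qed.
HB.instance Definition _ := GRing.Zmodule_isLmodule.Build k kendo
  kendo_scaleA kendo_scale1 kendo_scaleDr kendo_scaleDl.

Definition kendo_mul f g : kendo := endoM f g.
Lemma kendo_mulA : associative kendo_mul. Proof. exact: endoMA. Qed.
Lemma kendo_mulDl : left_distributive kendo_mul +%R. Proof. exact: endoMDl. Qed.
Lemma kendo_mulDr : right_distributive kendo_mul +%R. Proof. exact: endoMDr. Qed.
Lemma kendo_mulZl (c : k) f g : kendo_mul (c *: f) g = c *: kendo_mul f g.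
Proof. exact: endoP. Qed.
Lemma kendo_mulZr (c : k) f g : kendo_mul f (c *: g) = c *: kendo_mul f g.
Proof. by apply: endoP => a; apply: linearZ. Qed.
HB.instance Definition _ := Lmodule_isNUAlgebra.Build k kendo
  kendo_mulA kendo_mulDl kendo_mulDr kendo_mulZl kendo_mulZr.

Lemma kendoP f g : (forall a, f a = g a) -> f = g. Proof. exact: endoP. Qed.
Lemma kendoM f g a : (f ** g) a = f (g a). Proof. by []. Qed.
Lemma kendoD f g a : (f + g) a = f a + g a. Proof. by []. Qed.
Lemma kendoN f a : (- f) a = - f a. Proof. by []. Qed.
Lemma kendoB f g a : (f - g) a = f a - g a. Proof. by []. Qed.
Lemma kendo0 a : (0 : kendo) a = 0. Proof. by []. Qed.
Lemma kendoZ c f a : (c *: f) a = c *: f a. Proof. by []. Qed.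
End KEndo.

Section FunctionModule.
Variables (k : pzRingType) (L : choiceType) (R : lmodType k).
(** The product of copies of R rather than their direct sum: blocks between
    two summands act on it just as well, without any bookkeeping of supports. *)
Definition family := L -> R.
HB.instance Definition _ := gen_eqMixin family.
HB.instance Definition _ := gen_choiceMixin family.
Implicit Types u v w : family.
Definition family_add u v : family := fun a => u a + v a.
Definition family_opp u : family := fun a => - u a.
Definition family_zero : family := fun a => 0.
Definition family_scale c u : family := fun a => c *: u a.
Lemma family_addA : associative family_add.
Proof. by move=> u v w; apply/funext => a; apply: addrA. Qed.
Lemma family_addC : commutative family_add.
Proof. by move=> u v; apply/funext => a; apply: addrC. Qed.
Lemma family_add0 : left_id family_zero family_add.
Proof. by move=> u; apply/funext => a; apply: add0r. Qed.
Lemma family_addN : left_inverse family_zero family_opp family_add.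
Proof. by move=> u; apply/funext => a; apply: addNr. Qed.
HB.instance Definition _ :=
  GRing.isZmodule.Build family family_addA family_addC family_add0 family_addN.
Lemma family_scaleA c d u : family_scale c (family_scale d u) = family_scale (c * d) u.
Proof. by apply/funext => a; apply: scalerA. Qed.
Lemma family_scale1 : left_id 1 family_scale.
Proof. by move=> u; apply/funext => a; apply: scale1r. Qed.
Lemma family_scaleDr : right_distributive family_scale +%R.
Proof. by move=> c u v; apply/funext => a; apply: scalerDr. Qed.
Lemma family_scaleDl u : {morph family_scale^~ u : c d / c + d}.
Proof. by move=> c d; apply/funext => a; apply: scalerDl. Qed.
HB.instance Definition _ := GRing.Zmodule_isLmodule.Build k family
  family_scaleA family_scale1 family_scaleDr family_scaleDl.

Lemma familyD u v a : (u + v) a = u a + v a. Proof. by []. Qed.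
Lemma familyZ c u a : (c *: u) a = c *: u a. Proof. by []. Qed.

Definition delta (a : L) (x : R) : family := fun b => if b == a then x else 0.
Lemma delta_lin a c x y : delta a (c *: x + y) = c *: delta a x + delta a y.
Proof.
by apply/funext => b; rewrite familyD familyZ /delta; case: eqP; rewrite // scaler0 addr0.
Qed.
End FunctionModule.

Section Blocks.
Variables (k : comPzRingType) (L : choiceType) (R : lmodType k).
Implicit Types (phi psi : kendo R) (a b : L).

(** The matrix unit that maps the summand b to the summand a by phi. *)
Lemma block_subproof a b phi : linear (fun v : family L R => delta a (phi (v b))).
Proof. by move=> c u v; rewrite familyD familyZ linearP delta_lin. Qed.
Definition block a b phi : kendo (family L R) := Endo (block_subproof a b phi).

Lemma blockE a b phi v c : block a b phi v c = if c == a then phi (v b) else 0.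
Proof. by []. Qed.

Lemma block_linear a b : linear (block a b).
Proof.
move=> c phi psi; apply: kendoP => v; apply/funext => d.
by rewrite kendoD kendoZ familyD familyZ !blockE; case: eqP => _; rewrite // scaler0 addr0.
Qed.
HB.instance Definition _ a b :=
  GRing.isLinear.Build k (kendo R) (kendo (family L R)) *:%R (block a b) (block_linear a b).

Lemma blockB a b phi psi : block a b (phi - psi) = block a b phi - block a b psi.
Proof. exact: linearB. Qed.
Lemma blockN a b phi : block a b (- phi) = - block a b phi.
Proof. exact: linearN. Qed.
Lemma block0 a b : block a b 0 = 0.
Proof. exact: linear0. Qed.

Lemma block_mul a b a' b' phi psi :
  block a b phi ** block a' b' psi = if b == a' then block a b' (phi ** psi) else 0.
Proof.
apply: kendoP => v; rewrite kendoM; apply/funext => c; rewrite blockE.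
have [<-|ne] := eqVneq b a'.
  by rewrite !blockE eqxx.
by rewrite blockE (negPf ne) linear0 if_same.
Qed.

Lemma block_mul_eq a b c phi psi : block a b phi ** block b c psi = block a c (phi ** psi).
Proof. by rewrite block_mul eqxx. Qed.
End Blocks.

Section Representation.
Variables (k : comNzRingType) (I : choiceType) (n : nat).
Variables (Q P : I -> I -> {mpoly k[2]}).
Local Notation L := {ffun 'I_n -> I}.
Local Notation word := (seq 'I_n.-1).
Local Notation R := {mpoly k[n]}.

Hypothesis Q0 : forall i, Q i i = 0.
Hypothesis QP : forall i j, i != j -> forall x y : R,
  subst2 (Q i j) x y = subst2 (P i j) x y * subst2 (P j i) y x.

Lemma mulp_subproof (p : R) : linear (fun f => p * f).
Proof. by move=> c f g; rewrite mulrDr scalerAr. Qed.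
Definition mulp (p : R) : kendo R := Endo (mulp_subproof p).
Lemma mulpE p f : mulp p f = p * f. Proof. by []. Qed.
Lemma mulp_linear : linear mulp.
Proof. by move=> c p q; apply: kendoP => f; rewrite kendoD kendoZ !mulpE mulrDl scalerAl. Qed.
HB.instance Definition _ := GRing.isLinear.Build k R (kendo R) *:%R mulp mulp_linear.

(** The action of tau_i on a summand whose labels at i and i + 1 are a, b. *)
Definition cross i (a b : I) (f : R) : R :=
  if a == b then ddiff i f
  else subst2 (P a b) 'X_(sr i) 'X_(sl i) * msym (sref i) f.

(** Both cases have the form f |-> (num s_i(f) - sub f) / den, which allows a
    uniform proof of the commutation with the x_p and at a distance. *)
Definition cross_den i (a b : I) : R := if a == b then 'X_(sl i) - 'X_(sr i) else 1.
Definition cross_num i (a b : I) : R :=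
  if a == b then 1 else subst2 (P a b) 'X_(sr i) 'X_(sl i).
Definition cross_sub (a b : I) : R := (a == b)%:R.

Lemma crossE i a b f :
  cross_den i a b * cross i a b f =
  cross_num i a b * msym (sref i) f - cross_sub a b * f.
Proof.
rewrite /cross_den /cross /cross_num /cross_sub; case: eqP => _ /=.
  by rewrite ddiffE !mul1r.
by rewrite mul1r mul0r subr0.
Qed.

Lemma lreg_cross_den i a b : GRing.lreg (cross_den i a b).
Proof.
by rewrite /cross_den; case: eqP => _; [apply: lreg_subX; apply: sl_neq_sr | apply: lreg1].
Qed.

Lemma cross_linear i a b : linear (cross i a b).
Proof.
move=> c f g; apply: (@lreg_cross_den i a b).
rewrite mulrDr -scalerAr !crossE linearP /= mulrDr -!scalerAr mulrDr -scalerAr.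
by rewrite scalerBr opprD addrACA.
Qed.
Definition theta i (nu : L) : kendo R := Endo (cross_linear i (nu (sl i)) (nu (sr i))).
Lemma thetaE i nu f : theta i nu f = cross i (nu (sl i)) (nu (sr i)) f. Proof. by []. Qed.

Definition rep (g : klr_gen I n) : kendo (family L R) :=
  match g with
  | GOne nu => block nu nu (mulp 1)
  | GX p nu => block nu nu (mulp 'X_p)
  | GTau i nu => block (sact i nu) nu (theta i nu)
  end.

Lemma rep_quiver : quiver_rel rep.
Proof.
split=> [nu nu'|i nu|p nu|p q nu] /=; rewrite ?block_mul ?eqxx.
- case: eqP => [->|//]; congr block; apply: kendoP => f.
  by rewrite kendoM !mulpE !mul1r.
- by rewrite block_mul_eq; congr block; apply: kendoP => f; rewrite !kendoM !mulpE !mul1r.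
- by rewrite block_mul_eq; congr block; apply: kendoP => f; rewrite !kendoM !mulpE mul1r mul1r.
- by congr block; apply: kendoP => f; rewrite !kendoM !mulpE mulrCA.
Qed.

Lemma rep_xpol nu p : xpol rep nu p = block nu nu (mulp p).
Proof.
elim/mpoly_gen_ind: p => [c p q IH IH'||i p IH].
- by rewrite (xpol_linear _ nu) IH IH' -block_linear -mulp_linear.
- by rewrite xpol1.
- rewrite (xpolXM rep_quiver) IH /= block_mul_eq; congr block.
  by apply: kendoP => f; rewrite kendoM !mulpE mulrA.
Qed.

Lemma cross_far i j a b c d f : far i j ->
  cross i a b (cross j c d f) = cross j c d (cross i a b f).
Proof.
move=> ij.
have H (i' j' : 'I_n.-1) : far i' j' ->
   (msym (sref j') ('X_(sl i') : R) = 'X_(sl i')) * (msym (sref j') ('X_(sr i') : R) = 'X_(sr i')).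
  move=> ij'; rewrite !msymXU /sref !tpermD //; move: ij'; rewrite /far -?val_eqE /=; lia.
have ji : far j i by move: ij; rewrite /far orbC.
have Hden (i' j' : 'I_n.-1) a' b' : far i' j' ->
    msym (sref j') (cross_den i' a' b') = cross_den i' a' b'.
  by move=> /H E; rewrite /cross_den; case: ifP; rewrite ?msym1 // msymB !E.
have Hnum (i' j' : 'I_n.-1) a' b' : far i' j' ->
    msym (sref j') (cross_num i' a' b') = cross_num i' a' b'.
  by move=> /H E; rewrite /cross_num; case: ifP; rewrite ?msym1 // msym_subst2 !E.
have Hsub j' a' b' : msym (sref j') (cross_sub a' b') = cross_sub a' b'.
  by rewrite /cross_sub; case: eqP; rewrite ?msym1 ?msym0.
apply: (@twisted_commute R (msym (sref i)) (msym (sref j)) (cross i a b) (cross j c d)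
  (cross_den i a b) (cross_num i a b) (cross_sub a b)
  (cross_den j c d) (cross_num j c d) (cross_sub c d)).
- by move=> g; rewrite /= -!msymMm s_far.
- exact: crossE.
- exact: crossE.
- exact: Hden.
- exact: Hnum.
- exact: Hsub.
- exact: Hden.
- exact: Hnum.
- exact: Hsub.
- exact: lreg_cross_den.
- exact: lreg_cross_den.
Qed.

(** The factor x_(i+2) - x_i clears the denominator of the difference quotient
    in the braid relation. *)
Lemma cross_braid (i j : 'I_n.-1) a b c f : j = i.+1 :> nat ->
  ('X_(sr j) - 'X_(sl i)) *
  (cross j a b (cross i a c (cross j b c f)) - cross i b c (cross j a c (cross i a b f))) =
  if a == c then
    (subst2 (Q a b) 'X_(sr j) 'X_(sr i) - subst2 (Q a b) 'X_(sl i) 'X_(sr i)) * f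
  else 0.
Proof.
move=> ij; have ll : sl j = sr i by apply: val_inj.
have n13 : sl i != sr j by rewrite -val_eqE /=; lia.
have n12 := sl_neq_sr i.
have n23 : sr i != sr j by rewrite -ll; apply: sl_neq_sr.
have s1x1 : msym (sref i) ('X_(sl i) : R) = 'X_(sr i) by rewrite msymXU sref_sl.
have s1x2 : msym (sref i) ('X_(sr i) : R) = 'X_(sl i) by rewrite msymXU sref_sr.
have s1x3 : msym (sref i) ('X_(sr j) : R) = 'X_(sr j) by rewrite msymXU /sref tpermD.
have s2x1 : msym (sref j) ('X_(sl i) : R) = 'X_(sl i).
  by rewrite msymXU /sref tpermD // ?ll eq_sym.
have s2x2 : msym (sref j) ('X_(sr i) : R) = 'X_(sr j) by rewrite msymXU -ll sref_sl.
have s2x3 : msym (sref j) ('X_(sr j) : R) = 'X_(sr i) by rewrite msymXU -ll sref_sr.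
have sbr (g : R) : msym (sref i) (msym (sref j) (msym (sref i) g)) =
    msym (sref j) (msym (sref i) (msym (sref j) g)).
  by rewrite -!msymMm mulgA s_braid // mulgA.
have d1E (g : R) := ddiffE i g.
have d2E (g : R) : ('X_(sr i) - 'X_(sr j)) * ddiff j g = msym (sref j) g - g.
  by rewrite -ll ddiffE.
have sub2 (A : {mpoly k[2]}) (s : 'S_n) : {morph (msym s : R -> R) : x y / subst2 A x y}.
  exact: msym_subst2.
have r12 := @lreg_subX k _ _ _ n12.
have r13 := @lreg_subX k _ _ _ n13.
have r23 := @lreg_subX k _ _ _ n23.
pose s1 : {rmorphism R -> R} := msym (sref i); pose s2 : {rmorphism R -> R} := msym (sref j).
rewrite /cross ll.
have zero (x y z : R) : y = z -> x * (y - z) = 0 by move=> ->; rewrite subrr mulr0.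
have [<-|ab] := eqVneq a b; have [Eac|ac] := eqVneq a c.
- have Qz x y : subst2 (Q a a) x y = 0 :> R by rewrite Q0; apply: linear0.
  rewrite !Qz [RHS]mulrBl mul0r [RHS]subr0; apply: zero.
  exact: (@ddiff_braid R s1 s2 _ _ _ s1x1 s1x2 s1x3 s2x1 s2x2 s2x3
    (@msym_srefK _ _ i) (@msym_srefK _ _ j) sbr _ _ d1E d2E r12 r13 r23 f).
- apply: zero; exact: (@twisted_braid_aab R s1 s2 _ _ _ s1x1 s1x2 s1x3 s2x1 s2x2 s2x3
    sbr _ _ d1E d2E r23 (subst2 (P a c)) (sub2 _ _) (sub2 _ _) f).
- rewrite -Eac (eq_sym b) (negPf ab) !(QP ab).
  exact: (@twisted_braid_aba R s1 s2 _ _ _ s1x1 s1x2 s1x3 s2x1 s2x2 s2x3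
     (@msym_srefK _ _ i) (@msym_srefK _ _ j) sbr _ _ d1E d2E (subst2 (P a b)) (subst2 (P b a))
     (sub2 _ _) (sub2 _ _) (sub2 _ _) (sub2 _ _) f).
- have [Ebc|bc] := eqVneq b c.
    apply: zero; rewrite -Ebc.
    exact: (@twisted_braid_abb R s1 s2 _ _ _ s1x1 s1x2 s1x3 s2x1 s2x2 s2x3
      sbr _ _ d1E d2E r12 (subst2 (P a b)) (sub2 _ _) (sub2 _ _) f).
  apply: zero.
  exact: (@twisted_braid_abc R s1 s2 _ _ _ s1x1 s1x2 s1x3 s2x1 s2x2 s2x3 sbr
     (subst2 (P a b)) (subst2 (P a c)) (subst2 (P b c))
     (sub2 _ _) (sub2 _ _) (sub2 _ _) (sub2 _ _) (sub2 _ _) (sub2 _ _) f).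
Qed.

Lemma rep_klr : klr_rel Q rep.
Proof.
have [R1 R2 R3 R4] := rep_quiver.
have Ksr i (nu : L) : sact i nu (sl i) = nu (sr i) by rewrite ffunE sref_sl.
have Ksl i (nu : L) : sact i nu (sr i) = nu (sl i) by rewrite ffunE sref_sr.
have braid_states (i j : 'I_n.-1) (nu : L) : j = i.+1 :> nat ->
  ([/\ sact j nu (sl i) = nu (sl i), sact j nu (sr i) = nu (sr j),
      sact i nu (sl j) = nu (sl i) & sact i nu (sr j) = nu (sr j)] /\ [/\ sact i (sact j nu) (sl j) = nu (sl i), sact i (sact j nu) (sr j) = nu (sr i),
      sact j (sact i nu) (sl i) = nu (sr i) & sact j (sact i nu) (sr i) = nu (sr j)])%type.
  move=> ij; have ll : sl j = sr i by apply: val_inj.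
  have E1 : sref j (sl i) = sl i by rewrite /sref tpermD // -val_eqE /=; lia.
  have E2 : sref i (sr j) = sr j by rewrite /sref tpermD // -val_eqE /=; lia.
  have E3 : sref j (sr i) = sr j by rewrite -ll sref_sl.
  have E4 : sref i (sl j) = sl i by rewrite ll sref_sr.
  have E5 : sref j (sr j) = sr i by rewrite -ll sref_sr.
  by rewrite !ffunE !(E1, E2, E3, E4, E5, sref_sl).
split=> //.
- move=> i nu; rewrite /= block_mul_eq sactK rep_xpol; congr block.
  apply: kendoP => f; rewrite kendoM mulpE !thetaE Ksr Ksl -/(subst2 _ _ _) /cross (eq_sym (nu (sr i))).
  have [E|ne] := eqVneq (nu (sl i)) (nu (sr i)).
    rewrite E Q0 /subst2 comp_mpoly0 mul0r; apply: (lreg_subX (sl_neq_sr i)).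
    rewrite ddiffE mulr0; apply/eqP; rewrite subr_eq0; apply/eqP.
    apply: (lreg_subX (sl_neq_sr i)); have := congr1 (msym (sref i)) (ddiffE i f).
    rewrite msymM !msymB !msymXU sref_sl sref_sr msym_srefK ddiffE => E'.
    by rewrite -opprB mulNr E' opprB.
  rewrite msymM msym_srefK msym_subst2 !msymXU sref_sl sref_sr QP //.
  by rewrite mulrA [X in X * _]mulrC.
- move=> i j nu ij; rewrite /= !block_mul_eq sact_far //; congr block.
  apply: kendoP => f; rewrite !kendoM !thetaE.
  have H (i' j' : 'I_n.-1) : far i' j' -> sact j' nu (sl i') = nu (sl i') /\ sact j' nu (sr i') = nu (sr i').
    by move=> ij'; rewrite !ffunE /sref !tpermD //; move: ij'; rewrite /far -?val_eqE /=; lia.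
  have ji : far j i by move: ij; rewrite /far orbC.
  by rewrite !(H _ _ ij).1 !(H _ _ ij).2 !(H _ _ ji).1 !(H _ _ ji).2 cross_far.
- move=> i j nu p ij E Ep; rewrite /= !block_mul_eq rep_xpol (sact_braid _ ij) -blockB.
  have [[E1 E2 E3 E4] [E5 E6 E7 E8]] := braid_states _ _ nu ij.
  have -> : sact j (sact i (sact j nu)) = nu.
    have ll : sl j = sr i by apply: val_inj.
    apply/ffunP => q; rewrite -[sact j _]/(wact [:: j; i; j] nu) wactE.
    rewrite !word_perm_cons word_perm_nil mulg1 !permM.
    have F1 : sref j (sl i) = sl i by rewrite /sref tpermD // -val_eqE /=; lia.
    have F2 : sref i (sr j) = sr j by rewrite /sref tpermD // -val_eqE /=; lia.
    have F3 : sref j (sr i) = sr j by rewrite -ll sref_sl.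
    have F4 : sref j (sr j) = sr i by rewrite -ll sref_sr.
    have [->|ql] := eqVneq q (sl i); first by rewrite F1 sref_sl F3.
    have [->|qr] := eqVneq q (sr j); first by rewrite F4 sref_sr F1 E.
    have [->|qm] := eqVneq q (sr i); first by rewrite F3 F2 F4.
    have Fq : sref j q = q by rewrite /sref tpermD // ?ll eq_sym.
    by rewrite Fq [sref i q]tpermD 1?eq_sym // Fq.
  congr block; apply: kendoP => f; rewrite kendoB !kendoM !thetaE mulpE.
  rewrite !(E1, E2, E3, E4, E5, E6, E7, E8).
  have ll : sl j = sr i by apply: val_inj.
  rewrite !ll; have n13 : sr j != sl i by rewrite -val_eqE /=; lia.
  apply: (lreg_subX n13); rewrite cross_braid // E eqxx [RHS]mulrA Ep E.
  by rewrite -/(subst2 _ _ _) -/(subst2 _ _ _).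
- move=> i j nu ij /eqP E; rewrite /= !block_mul_eq (sact_braid _ ij) -blockB.
  have [[E1 E2 E3 E4] [E5 E6 E7 E8]] := braid_states _ _ nu ij.
  rewrite -[RHS](block0 _ (sact j (sact i (sact j nu))) nu).
  congr block; apply: kendoP => f; rewrite kendoB !kendoM !thetaE kendo0.
  rewrite !(E1, E2, E3, E4, E5, E6, E7, E8).
  have ll : sl j = sr i by apply: val_inj.
  rewrite !ll; have n13 : sr j != sl i by rewrite -val_eqE /=; lia.
  by apply: (lreg_subX n13); rewrite cross_braid // (negPf E) mulr0.
- move=> i p nu; rewrite /= !block_mul_eq -blockB.
  set phi := theta i nu ** _ - _.
  have phiE f : cross_den i (nu (sl i)) (nu (sr i)) * phi f =
     cross_sub (nu (sl i)) (nu (sr i)) * (('X_(sref i p) - 'X_p) * f).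
    rewrite kendoB !kendoM !thetaE !mulpE mulrBr mulrCA !crossE msymM msymXU; ring.
  have [Enu|ne] := eqVneq (nu (sl i)) (nu (sr i)); last first.
    rewrite !andbF -[RHS](block0 _ (sact i nu) nu); congr block.
    apply: kendoP => f; have := phiE f; rewrite /cross_den /cross_sub (negPf ne).
    by rewrite mul1r mul0r.
  have snu : sact i nu = nu.
    by apply/ffunP => q; rewrite ffunE /sref; case: tpermP => [->|->|].
  rewrite !andbT snu /=; rewrite /cross_den /cross_sub Enu eqxx in phiE.
  have regi := lreg_subX (sl_neq_sr i).
  have [Epl|pl] := eqVneq p (sl i).
    rewrite -blockN; congr block; apply: kendoP => f; apply: regi.
    by rewrite phiE Epl sref_sl mul1r kendoN mulpE; ring.
  have [Epr|pr] := eqVneq p (sr i).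
    congr block; apply: kendoP => f; apply: regi.
    by rewrite phiE Epr sref_sr mul1r mulpE; ring.
  rewrite -[RHS](block0 _ nu nu); congr block.
  apply: kendoP => f; apply: regi.
  by rewrite phiE /sref tpermD 1?eq_sym // subrr mul0r !mulr0.
Qed.
End Representation.

(** * Independence of S for regular parameters *)

Section Artin.
Variables (k : comNzRingType) (n : nat).
Local Notation R := {mpoly k[n]}.

Definition wperm (v : 'S_n) (f : R) : R := msym v^-1 f.

Lemma wpermM (u v : 'S_n) f : wperm (u * v) f = wperm u (wperm v f).
Proof. by rewrite /wperm invMg msymMm. Qed.

(** Distinct permutations are independent over the polynomials, by Artin's
    argument: the differences of variables are regular, which replaces the
    absence of zero divisors. *)
Lemma perm_independent (c : 'S_n -> R) :
  (forall f, \sum_v c v * wperm v f = 0) -> forall v, c v = 0.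
Proof.
have [d] := ubnP #|[pred v | c v != 0]|; elim: d c => // d IH c ltd c0.
have [H|] := boolP [forall v, c v == 0]; first by move=> v; apply/eqP/(forallP H).
rewrite negb_forall => /existsP[v1 nv1].
have other v : v != v1 -> c v = 0.
  move=> vv1; have [p] : exists p, v^-1%g p != v1^-1%g p.
    apply/existsP; apply: contraNT vv1; rewrite negb_exists => /forallP H.
    by apply/eqP/invg_inj/permP => p; move: (H p); rewrite negbK => /eqP.
  move=> /lreg_subX r; apply: (r k); rewrite mulr0.
  pose c' (u : 'S_n) := ('X_(u^-1%g p) - 'X_(v1^-1%g p)) * c u.
  apply: (IH c').
    rewrite -ltnS; apply: leq_trans ltd; apply: proper_card; apply/properP; split.
      by apply/fintype.subsetP => u; rewrite !inE /c'; apply: contraNneq => ->; rewrite mulr0.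
    by exists v1; rewrite !inE ?nv1 // /c' subrr mul0r eqxx.
  move=> f; transitivity (\sum_u c u * wperm u ('X_p * f) - 'X_(v1^-1%g p) * \sum_u c u * wperm u f).
    rewrite mulr_sumr -sumrB; apply: eq_bigr => u _.
    by rewrite /c' /wperm msymM msymXU; ring.
  by rewrite !c0 mulr0 subr0.
have := c0 1; rewrite (bigD1 v1) //= [wperm _ _]msym1 mulr1 big1 ?addr0.
  by move=> E; rewrite E eqxx in nv1.
by move=> v /other ->; rewrite mul0r.
Qed.

(** Taking both orders of each pair makes the product symmetric, not alternating. *)
Definition disc : R := \prod_(pq : 'I_n * 'I_n | pq.1 != pq.2) ('X_pq.1 - 'X_pq.2).

Lemma msym_disc s : msym s disc = disc.
Proof.
rewrite /disc rmorph_prod /=.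
rewrite [RHS](reindex_inj (h := fun pq => (s pq.1, s pq.2))) /=; last first.
  by move=> [p q] [p' q'] [/perm_inj -> /perm_inj ->].
apply: eq_big => [pq|pq _]; first by rewrite (inj_eq perm_inj).
by rewrite msymB !msymXU.
Qed.

Lemma lreg_prod_sub (T : pred ('I_n * 'I_n)) :
  (forall pq, T pq -> pq.1 != pq.2) -> GRing.lreg (\prod_(pq | T pq) ('X_pq.1 - 'X_pq.2) : R).
Proof.
move=> HT; elim/big_ind: _ => [|a b ra rb|pq Tpq].
- exact: lreg1.
- exact: lregM.
- exact: lreg_subX (HT _ Tpq).
Qed.

Lemma lreg_disc : GRing.lreg disc. Proof. exact: lreg_prod_sub. Qed.

Lemma disc_factor (i : 'I_n.-1) :
  exists2 D : R, disc = D * ('X_(sl i) - 'X_(sr i)) & GRing.lreg D.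
Proof.
rewrite /disc (bigD1 (sl i, sr i)) ?sl_neq_sr //= mulrC.
by eexists; first reflexivity; apply: lreg_prod_sub => pq /andP[].
Qed.

Lemma lreg_msym (s : 'S_n) (a : R) : GRing.lreg a -> GRing.lreg (msym s a).
Proof.
move=> ra f g E; apply: (@inj_msym _ _ s^-1%g); apply: ra.
have := congr1 (msym s^-1%g) E.
by rewrite !msymM -msymMm mulgV msym1m.
Qed.
End Artin.

Section Independence.
Variables (k : comNzRingType) (I : choiceType) (n : nat).
Variables (Q P : I -> I -> {mpoly k[2]}).
Local Notation L := {ffun 'I_n -> I}.
Local Notation word := (seq 'I_n.-1).
Local Notation R := {mpoly k[n]}.

Hypothesis Q0 : forall i, Q i i = 0.
Hypothesis QP : forall i j, i != j -> forall x y : R,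
  subst2 (Q i j) x y = subst2 (P i j) x y * subst2 (P j i) y x.
Hypothesis Preg : forall i j, i != j -> forall p q : 'I_n, p != q ->
  GRing.lreg (subst2 (P i j) 'X_p 'X_q : R).

Local Notation rep := (rep (n := n) P).

Fixpoint Theta (w : word) (nu : L) (f : R) : R :=
  if w is i :: w' then theta P i (wact w' nu) (Theta w' nu f) else f.

Lemma Theta_linear w nu : linear (Theta w nu).
Proof. by elim: w => //= i w IH c f g; rewrite IH cross_linear. Qed.
HB.instance Definition _ w nu :=
  GRing.isLinear.Build k R R *:%R (Theta w nu) (Theta_linear w nu).

Lemma disc_theta i nu : exists c c' : R, GRing.lreg c /\
  forall f, @disc k n * theta P i nu f = c * msym (sref i) f - c' * f.
Proof.
have [D ED regD] := @disc_factor k n i.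
rewrite /theta /= /cross; have [_|ne] := eqVneq (nu (sl i)) (nu (sr i)).
  exists D, D; split=> // f.
  by rewrite ED -mulrA ddiffE mulrBr.
exists (@disc k n * subst2 (P (nu (sl i)) (nu (sr i))) 'X_(sr i) 'X_(sl i)), 0; split.
  by apply: lregM; [exact: lreg_disc | apply: Preg; rewrite // eq_sym sl_neq_sr].
by move=> f; rewrite mul0r subr0 mulrA.
Qed.

Definition short_perm d (v : 'S_n) := exists2 w : word, (size w < d)%N & word_perm w = v.

(** Multiplied by the discriminant, each crossing is c s_i - c' with c regular.
    In the expansion of the product along a word, the term that takes s_i at
    every letter gives the permutation of the word; the others come from proper
    subwords, and do not contribute to that permutation if the word is reduced. *)
Lemma Theta_expand w nu : exists c : 'S_n -> R,
  [/\ forall f, @disc k n ^+ size w * Theta w nu f = \sum_v c v * wperm v f,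
      forall v, c v != 0 -> v = word_perm w \/ short_perm (size w) v
    & reduced w -> GRing.lreg (c (word_perm w))].
Proof.
elim: w => [|i w [c [Ec Hc Rc]]].
  exists (fun v => (v == 1%g)%:R); split.
  - move=> f; rewrite expr0 mul1r (bigD1 1%g) //= eqxx big1 ?addr0 ?mul1r.
      by rewrite /wperm invg1 msym1m.
    by move=> v /negPf ->; rewrite mul0r.
  - by move=> v; rewrite word_perm_nil; case: (v =P 1%g) => [->|]; [left | rewrite eqxx].
  - by rewrite word_perm_nil eqxx => _; apply: lreg1.
have [a [a' [rega Ea]]] := disc_theta i (wact w nu).
exists (fun v => a * msym (sref i) (c (sref i * v)%g) - a' * c v); split.
- move=> f; transitivity (@disc k n ^+ size w * (@disc k n * theta P i (wact w nu) (Theta w nu f))).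
    by rewrite /= exprS; ring.
  rewrite Ea; transitivity (a * msym (sref i) (@disc k n ^+ size w * Theta w nu f)
     - a' * (@disc k n ^+ size w * Theta w nu f)).
    by rewrite msymM rmorphXn /= msym_disc; ring.
  rewrite Ec linear_sum /= !mulr_sumr (reindex_inj (mulgI (sref i))) /= -sumrB.
  apply: eq_bigr => v _; rewrite msymM wpermM /wperm srefV msym_srefK; ring.
- move=> v; have [E|cv] := eqVneq (c v) 0.
    have [E'|/Hc] := eqVneq (c (sref i * v)%g) 0.
      by rewrite E E' msym0 !mulr0 subrr eqxx.
    move=> [Ev _|[u su Eu] _]; [left|right].
      by rewrite word_perm_cons -Ev srefKg.
    by exists (i :: u); rewrite ?word_perm_cons ?Eu ?srefKg.
  move=> _; right; case: (Hc _ cv) => [->|[u su Eu]]; first by exists w.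
  by exists u => //=; apply: ltnW.
- move=> red; have redw : reduced w.
    move=> u Eu; have := red (i :: u).
    by rewrite !word_perm_cons Eu => /(_ erefl).
  have E0 : c (word_perm (i :: w)) = 0.
    apply/eqP; apply/negPn/negP => /Hc [E|[u su Eu]].
      by have := red w (esym E); rewrite /= ltnn.
    by have := red u Eu; rewrite /= leqNgt ltnW.
  rewrite E0 mulr0 subr0 word_perm_cons srefKg.
  by apply: lregM => //; apply: lreg_msym; apply: Rc.
Qed.

(** A word of maximal length among those with a nonzero coefficient is the only
    one that contributes to its own permutation. *)
Lemma Theta_independent (jw : 'S_n -> word) (G : 'S_n -> R) nu :
  (forall v, reduced (jw v)) -> (forall v, word_perm (jw v) = v) ->
  (forall f, \sum_v Theta (jw v) nu (G v * f) = 0) -> forall v, G v = 0.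
Proof.
move=> jred jperm EG v0; apply/eqP; apply/negPn/negP => nv0.
have [v nv vmax] := @arg_maxnP _ v0 (fun v => G v != 0) (fun v => size (jw v)) nv0.
have [c Hc] := choice (fun u => Theta_expand (jw u) nu).
have c_exp u := let: And3 E _ _ := Hc u in E.
have c_supp u := let: And3 _ E _ := Hc u in E.
have c_reg u := let: And3 _ _ E := Hc u in E.
(* A power of the discriminant that works for all words at once. *)
pose N := \max_u size (jw u).
have Nle u : (size (jw u) <= N)%N by apply: leq_bigmax.
have key u : \sum_v @disc k n ^+ (N - size (jw v)) * c v u * wperm u (G v) = 0.
  move: u; apply: perm_independent => f.
  transitivity (@disc k n ^+ N * \sum_v Theta (jw v) nu (G v * f)); last by rewrite EG mulr0.
  rewrite mulr_sumr; under [RHS]eq_bigr => u _.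
    rewrite -(subnK (Nle u)) exprD -mulrA c_exp mulr_sumr.
  over.
  rewrite exchange_big /=; apply: eq_bigr => w _; rewrite mulr_suml.
  by apply: eq_bigr => u _; rewrite /wperm msymM !mulrA.
have := key v; rewrite (bigD1 v) //= big1 ?addr0; last first.
  move=> u uv; have [->|nu0] := eqVneq (G u) 0; first by rewrite [wperm _ _]msym0 mulr0.
  have [->|cuv] := eqVneq (c u v) 0; first by rewrite mulr0 mul0r.
  case: (c_supp _ _ cuv) => [E|[w sw Ew]].
    by rewrite E jperm eqxx in uv.
  have := jred v w; rewrite jperm Ew => /(_ erefl).
  by rewrite leqNgt => /negP[]; apply: leq_trans sw (vmax _ nu0).
have rv := c_reg v (jred v); rewrite jperm in rv.
move=> E; have Ev0 : wperm v (G v) = 0.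
  have reg := lregM (@lregX _ _ (N - size (jw v))%N (@lreg_disc k n)) rv.
  by apply: reg; rewrite E mulr0.
by case/eqP: nv; apply: (@inj_msym _ _ v^-1%g); rewrite msym0.
Qed.

Lemma rep_word_mon w m nu :
  word_mon rep (w, m, nu) = block (wact w nu) nu (endoM (Endo (Theta_linear w nu)) (mulp 'X_[m])).
Proof.
rewrite /word_mon /=; elim: w => [|i w IH] /=.
  by rewrite -xpolXm rep_xpol; congr block; apply: kendoP.
by rewrite IH block_mul_eq; congr block; apply: kendoP.
Qed.

Variables (J : pred word) (HJ : reduced_family J).

Lemma klr_S_independent_regular : independent (klr_S Q J).
Proof.
move=> c c0 [[[w0 Jw0] m0] nu0].
have ex v : exists w : word, J w /\ word_perm w = v.
  by have [w Jw Ew] := family_word HJ v; exists w.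
have [jw Hjw] := choice ex.
have jwJ v : J (jw v) by case: (Hjw v).
have jwE v : word_perm (jw v) = v by case: (Hjw v).
have jw_val (t : {w | J w} * 'X_{1..n} * L) : val t.1.1 = jw (word_perm (val t.1.1)).
  by apply: (family_inj HJ); rewrite ?jwE //; apply: valP.
pose kappa := wact w0 nu0.
pose sel v (t : {w | J w} * 'X_{1..n} * L) := (word_perm (val t.1.1) == v) && (t.2 == nu0).
pose G v : R := if wact (jw v) nu0 == kappa
  then \sum_(t <- finsupp c | sel v t) c t *: 'X_[t.1.2] else 0.
have G0 v1 : G v1 = 0.
  apply: (@Theta_independent jw G nu0) => // [u|f]; first by apply: HJ.1.
  have [phi phiE] := lift_linear_map (rep_klr Q0 QP).
  have : phi (fscomb (klr_S Q J) c) (delta nu0 f) kappa = 0.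
    by rewrite [fscomb _ _]c0 linear0.
  have ev (s : seq ({w | J w} * 'X_{1..n} * L)) (F : _ -> kendo (family L R)) :
      (\sum_(t <- s) F t) (delta nu0 f) kappa = \sum_(t <- s) F t (delta nu0 f) kappa.
    by elim/big_rec2: _ => // t a b _ <-.
  rewrite linear_fscomb /fscomb ev => E0; rewrite -[RHS]E0.
  transitivity (\sum_v \sum_(t <- finsupp c | sel v t)
     if wact (jw v) nu0 == kappa then Theta (jw v) nu0 (c t *: 'X_[t.1.2] * f) else 0).
    apply: eq_bigr => v _; rewrite /G; case: ifP => _; last by rewrite big1 // mul0r linear0.
    by rewrite mulr_suml linear_sum.
  under eq_bigr => v _ do rewrite big_mkcond.
  rewrite exchange_big /=; apply: eq_bigr => t _.
  rewrite (bigD1 (word_perm (val t.1.1))) //= big1 ?addr0; last first.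
    by move=> v vt; rewrite /sel eq_sym (negPf vt).
  rewrite phiE klr_SE (lift_word_mon (rep_klr Q0 QP)) rep_word_mon.
  rewrite -[RHS]/(c t *: block (wact (val t.1.1) t.2) t.2
    (endoM (Endo (Theta_linear (val t.1.1) t.2)) (mulp 'X_[t.1.2])) (delta nu0 f) kappa).
  rewrite blockE /sel eqxx /= -jw_val /delta.
  case: (t.2 =P nu0) => [->|_]; rewrite /= (eq_sym kappa); case: ifP => _; rewrite ?scaler0 //.
    by rewrite -[RHS]linearZ /= -scalerAl.
  by rewrite mulr0 linear0 scaler0.
have := G0 (word_perm w0).
have -> : G (word_perm w0) = \sum_(t <- finsupp c | sel (word_perm w0) t) c t *: 'X_[t.1.2].
  by rewrite /G (_ : wact _ nu0 = kappa) ?eqxx //; apply: eq_wact.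
move=> /(congr1 (mcoeff m0)); rewrite mcoeff0 linear_sum /=.
pose t0 : {w | J w} * 'X_{1..n} * L := (exist _ w0 Jw0, m0, nu0).
case: (finsuppP c t0) => // t0c.
have sel0 : sel (word_perm w0) t0 by rewrite /sel !eqxx.
rewrite big_mkcond (big_fsetD1 t0) //= sel0 mcoeffZ mcoeffX eqxx mulr1.
rewrite big1_seq ?addr0 // => t /=; rewrite !inE => /andP[tt0 _].
case: ifP => // /andP[/eqP Ew /eqP Enu].
rewrite mcoeffZ mcoeffX; case: eqP => [Em|]; last by rewrite mulr0.
case/eqP: tt0; case: t Ew Enu Em => [[[w Jw] m] nu] /= Ew -> ->.
by congr (_, _, _); apply: val_inj => /=; apply: (family_inj HJ).
Qed.
End Independence.

(** * Independence of S in general, by deformation *)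

Section Reduction.
Variables (k : comNzRingType) (H : nuAlgType {poly k}).

Definition teqv : rel H := fun a b => `[< exists c, a - b = 'X *: c >].

Lemma teqv_refl : reflexive teqv.
Proof. by move=> a; apply/asboolP; exists 0; rewrite subrr scaler0. Qed.
Lemma teqv_sym : ssrbool.symmetric teqv.
Proof.
suff S a b : teqv a b -> teqv b a by move=> a b; apply/idP/idP; apply: S.
by move=> /asboolP[c E]; apply/asboolP; exists (- c); rewrite scalerN -E opprB.
Qed.
Lemma teqv_trans : transitive teqv.
Proof.
move=> b a c /asboolP[d Ed] /asboolP[e Ee]; apply/asboolP; exists (d + e).
by rewrite scalerDr -Ed -Ee addrA subrK.
Qed.
Canonical teqv_equiv := EquivRel teqv teqv_refl teqv_sym teqv_trans.

(** The k-algebra H / tH of an algebra H over k[t]. *)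
Definition red := {eq_quot teqv_equiv}.
HB.instance Definition _ := Choice.on red.

Definition cl (a : H) : red := \pi_red a.

Lemma cl_eqP a b : cl a = cl b <-> exists c, a - b = 'X *: c.
Proof.
split; first by move=> /eqmodP/asboolP.
by move=> E; apply/eqmodP/asboolP.
Qed.

Lemma cl_surj (x : red) : exists a, x = cl a.
Proof. by exists (repr x); rewrite /cl reprK. Qed.

Lemma repr_cl a : exists c, repr (cl a) - a = 'X *: c.
Proof. by apply/cl_eqP; rewrite /cl reprK. Qed.

Definition red_zero : red := cl 0.
Definition red_add (x y : red) : red := cl (repr x + repr y).
Definition red_opp (x : red) : red := cl (- repr x).
Definition red_scale (c : k) (x : red) : red := cl (c%:P *: repr x).
Definition red_mul (x y : red) : red := cl (repr x ** repr y).

Lemma cl_add a b : red_add (cl a) (cl b) = cl (a + b).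
Proof.
have [c Ec] := repr_cl a; have [d Ed] := repr_cl b; apply/cl_eqP.
by exists (c + d); rewrite scalerDr -Ec -Ed opprD addrACA.
Qed.
Lemma cl_opp a : red_opp (cl a) = cl (- a).
Proof.
have [c Ec] := repr_cl a; apply/cl_eqP; exists (- c).
by rewrite scalerN -Ec opprB opprK addrC.
Qed.
Lemma cl_scale c a : red_scale c (cl a) = cl (c%:P *: a).
Proof.
have [d Ed] := repr_cl a; apply/cl_eqP; exists (c%:P *: d).
by rewrite -scalerBr Ed !scalerA mulrC.
Qed.
Lemma cl_mul a b : red_mul (cl a) (cl b) = cl (a ** b).
Proof.
have [c Ec] := repr_cl a; have [d Ed] := repr_cl b; apply/cl_eqP.
exists (c ** repr (cl b) + a ** d).
rewrite scalerDr -nmulZl -nmulZr -Ec -Ed nmulBl linearB /=.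
by rewrite addrA subrK.
Qed.

Lemma red_addA : associative red_add.
Proof.
by move=> x y z; case: (cl_surj x) (cl_surj y) (cl_surj z) => a -> [b ->] [c ->];
  rewrite !cl_add addrA.
Qed.
Lemma red_addC : commutative red_add.
Proof.
by move=> x y; case: (cl_surj x) (cl_surj y) => a -> [b ->]; rewrite !cl_add addrC.
Qed.
Lemma red_add0 : left_id red_zero red_add.
Proof. by move=> x; case: (cl_surj x) => a ->; rewrite cl_add add0r. Qed.
Lemma red_addN : left_inverse red_zero red_opp red_add.
Proof. by move=> x; case: (cl_surj x) => a ->; rewrite cl_opp cl_add addNr. Qed.
HB.instance Definition _ :=
  GRing.isZmodule.Build red red_addA red_addC red_add0 red_addN.

Lemma red_scaleA c d x : red_scale c (red_scale d x) = red_scale (c * d) x.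
Proof. by case: (cl_surj x) => a ->; rewrite !cl_scale scalerA polyCM. Qed.
Lemma red_scale1 : left_id 1 red_scale.
Proof. by move=> x; case: (cl_surj x) => a ->; rewrite cl_scale scale1r. Qed.
Lemma red_scaleDr : right_distributive red_scale +%R.
Proof.
by move=> c x y; case: (cl_surj x) (cl_surj y) => a -> [b ->];
  rewrite ![_ + _]cl_add !cl_scale [RHS]cl_add scalerDr.
Qed.
Lemma red_scaleDl x : {morph red_scale^~ x : c d / c + d}.
Proof.
by move=> c d; case: (cl_surj x) => a ->; rewrite !cl_scale [RHS]cl_add polyCD scalerDl.
Qed.
HB.instance Definition _ := GRing.Zmodule_isLmodule.Build k red
  red_scaleA red_scale1 red_scaleDr red_scaleDl.

Lemma red_mulA : associative red_mul.
Proof.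
by move=> x y z; case: (cl_surj x) (cl_surj y) (cl_surj z) => a -> [b ->] [c ->];
  rewrite !cl_mul nmulA.
Qed.
Lemma red_mulDl : left_distributive red_mul +%R.
Proof.
by move=> x y z; case: (cl_surj x) (cl_surj y) (cl_surj z) => a -> [b ->] [c ->];
  rewrite [cl a + _]cl_add !cl_mul [RHS]cl_add nmulDl.
Qed.
Lemma red_mulDr : right_distributive red_mul +%R.
Proof.
by move=> x y z; case: (cl_surj x) (cl_surj y) (cl_surj z) => a -> [b ->] [c ->];
  rewrite [cl b + _]cl_add !cl_mul [RHS]cl_add nmulDr.
Qed.
Lemma red_mulZl (c : k) x y : red_mul (c *: x) y = c *: red_mul x y.
Proof.
by case: (cl_surj x) (cl_surj y) => a -> [b ->];
  rewrite [c *: cl a]cl_scale !cl_mul [RHS]cl_scale nmulZl.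
Qed.
Lemma red_mulZr (c : k) x y : red_mul x (c *: y) = c *: red_mul x y.
Proof.
by case: (cl_surj x) (cl_surj y) => a -> [b ->];
  rewrite [c *: cl b]cl_scale !cl_mul [RHS]cl_scale nmulZr.
Qed.
HB.instance Definition _ := Lmodule_isNUAlgebra.Build k red
  red_mulA red_mulDl red_mulDr red_mulZl red_mulZr.

Lemma clD a b : cl (a + b) = cl a + cl b. Proof. by rewrite [RHS]cl_add. Qed.
Lemma clN a : cl (- a) = - cl a. Proof. by rewrite [RHS]cl_opp. Qed.
Lemma clB a b : cl (a - b) = cl a - cl b. Proof. by rewrite clD clN. Qed.
Lemma cl0 : cl 0 = 0. Proof. by []. Qed.
Lemma clZ c a : cl (c%:P *: a) = c *: cl a. Proof. by rewrite [RHS]cl_scale. Qed.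
Lemma clM a b : cl (a ** b) = cl a ** cl b. Proof. by rewrite [RHS]cl_mul. Qed.
Lemma cl_tZ a : cl ('X *: a) = 0.
Proof. by rewrite -cl0; apply/cl_eqP; exists a; rewrite subr0. Qed.
Lemma cl_eq0 a : cl a = 0 -> exists c, a = 'X *: c.
Proof. by rewrite -cl0 => /cl_eqP; rewrite subr0. Qed.
End Reduction.

Section RegularShift.
Variables (k : comNzRingType) (n : nat).
Local Notation K := {poly k}.
Local Notation up := (map_mpoly (@polyC k)).

Lemma up_linear c (p q : {mpoly k[n]}) : up (c *: p + q) = c%:P *: up p + up q.
Proof. by rewrite raddfD /= map_mpolyZ. Qed.

Lemma up0 : up 0 = 0 :> {mpoly K[n]}. Proof. exact: raddf0. Qed.

Definition tdeg_le d (p : {mpoly K[n]}) := forall m, (size (p@_m) <= d)%N.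

Lemma mcoeffXM i (p : {mpoly K[n]}) m : ('X_i * p)@_m = 0 \/ exists m', ('X_i * p)@_m = p@_m'.
Proof.
rewrite mulrC; case: (boolP (m \in msupp (p * 'X_i))) => [|/memN_msupp_eq0 ->]; last by left.
by rewrite (perm_mem (msuppMX _ _)) => /mapP[m' _ ->]; right; exists m'; rewrite mcoeffMX.
Qed.

Lemma tdeg_le_up d (q : {mpoly k[n]}) p : tdeg_le d p -> tdeg_le d (up q * p).
Proof.
move=> pd; elim/mpoly_gen_ind: q => [c q q' IH IH'||i q IH] m.
- have -> : up (c *: q + q') = c%:P%:MP * up q + up q'.
    by rewrite up_linear -mul_mpolyC.
  rewrite mulrDl mcoeffD -mulrA mcoeffCM (leq_trans (size_polyD _ _)) //.
  rewrite geq_max IH' andbT mul_polyC.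
  exact: leq_trans (size_scale_leq _ _) (IH m).
- by rewrite rmorph1 mul1r.
- rewrite rmorphM /= map_mpolyX -mulrA.
  by case: (mcoeffXM i (up q * p) m) => [->|[m' ->]]; rewrite ?size_poly0.
Qed.

(** Multiplication by q + t raises the degree in t of a nonzero polynomial. *)
Lemma lreg_shift (q : {mpoly k[n]}) : GRing.lreg (up q + 'X%:MP).
Proof.
apply: mulrI0_lreg => p E.
have step d : tdeg_le d.+1 p -> tdeg_le d p.
  move=> pd m; have [->|nz] := eqVneq p@_m 0; first by rewrite size_poly0.
  have := congr1 (mcoeff m) E; rewrite mcoeff0 mulrDl mcoeffD mcoeffCM.
  move/eqP; rewrite addrC addr_eq0 => /eqP E'.
  have := tdeg_le_up q pd m; rewrite -size_polyN -E' mulrC size_mulX //.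
have [d pd] : exists d, tdeg_le d p.
  exists (\max_(m <- msupp p) size p@_m) => m.
  case: (boolP (m \in msupp p)) => [mp|/memN_msupp_eq0 ->]; last by rewrite size_poly0.
  exact: (@leq_bigmax_seq _ (msupp p) xpredT (fun m => size p@_m)).
have p0 : tdeg_le 0 p by elim: d pd => // d IH /step.
by apply/mpolyP => m; rewrite mcoeff0; apply/eqP; rewrite -size_poly_leq0.
Qed.
End RegularShift.

Lemma subst2_swap (k : comNzRingType) m (A : {mpoly k[2]}) (x y : {mpoly k[m]}) :
  subst2 (subst2 A 'X_1 'X_0) x y = subst2 A y x.
Proof.
elim/mpoly2_ind: A => [c A A' IH IH'||A IH|A IH].
- by rewrite !subst2_is_linear IH IH'.
- by rewrite !subst2_1.
- by rewrite !subst2M !subst2_X0 subst2_X1 IH.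
- by rewrite !subst2M !subst2_X1 subst2_X0 IH.
Qed.

(** An orientation of every pair of distinct indices, which serves instead of a
    total order: choose depends only on the extent of the predicate. *)
Section Tournament.
Variable I : choiceType.
Definition beats (i j : I) := choose (pred2 i j) i == i.

Lemma beats_antisym i j : i != j -> beats j i = ~~ beats i j.
Proof.
move=> ij; rewrite /beats.
have -> : choose (pred2 j i) j = choose (pred2 i j) i.
  rewrite (@eq_choose _ (pred2 j i) (pred2 i j)); last by move=> x /=; rewrite orbC.
  by apply: choose_id; rewrite /= eqxx ?orbT.
have := @chooseP _ (pred2 i j) i; rewrite /= eqxx => /(_ isT) /orP[] /eqP ->.
  by rewrite eqxx (negPf ij).
by rewrite eqxx eq_sym (negPf ij).
Qed.
End Tournament.

Section Deformation.
Variables (k : comNzRingType) (I : choiceType) (n : nat).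
Variable Q : I -> I -> {mpoly k[2]}.
Hypothesis Q0 : forall i, Q i i = 0.
Hypothesis Qsym : forall i j, Q i j = Q j i \mPo [tuple 'X_1; 'X_0].
Local Notation L := {ffun 'I_n -> I}.
Local Notation word := (seq 'I_n.-1).
Local Notation K := {poly k}.
Local Notation up := (map_mpoly (@polyC k)).

(** The deformed parameters, and their factorization. Adding t keeps the
    symmetry, and does not change the difference quotients in the braid
    relations. *)
Definition shiftQ i j : {mpoly K[2]} := if i == j then 0 else up (Q i j) + 'X%:MP.
Definition shiftP i j : {mpoly K[2]} := if beats i j then shiftQ i j else 1.

Lemma shiftQ0 i : shiftQ i i = 0. Proof. by rewrite /shiftQ eqxx. Qed.

Lemma up_subst2 m (A : {mpoly k[2]}) (x y : {mpoly k[m]}) :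
  up (subst2 A x y) = subst2 (up A) (up x) (up y).
Proof.
elim/mpoly2_ind: A => [c A A' IH IH'||A IH|A IH].
- by rewrite subst2_is_linear !up_linear subst2_is_linear IH IH'.
- by rewrite subst2_1 !rmorph1 subst2_1.
- by rewrite subst2M subst2_X0 !rmorphM /= map_mpolyX subst2M subst2_X0 IH.
- by rewrite subst2M subst2_X1 !rmorphM /= map_mpolyX subst2M subst2_X1 IH.
Qed.

Lemma subst2_shiftQ m i j (x y : {mpoly k[m]}) : i != j ->
  subst2 (shiftQ i j) (up x) (up y) = up (subst2 (Q i j) x y) + 'X%:MP.
Proof.
move=> ij; rewrite /shiftQ (negPf ij) up_subst2 /subst2 raddfD /=.
by rewrite comp_mpolyC.
Qed.

Lemma subst2_shiftQX m i j (p q : 'I_m) : i != j ->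
  subst2 (shiftQ i j) 'X_p 'X_q = up (subst2 (Q i j) 'X_p 'X_q) + 'X%:MP.
Proof. by move=> ij; have := subst2_shiftQ 'X_p 'X_q ij; rewrite !map_mpolyX. Qed.

Lemma shiftQ_sym m i j (x y : {mpoly K[m]}) : i != j ->
  subst2 (shiftQ i j) x y = subst2 (shiftQ j i) y x.
Proof.
move=> ij; rewrite -[RHS]subst2_swap; congr subst2.
by rewrite subst2_shiftQX 1?eq_sym // /shiftQ (negPf ij) {1}Qsym.
Qed.

Lemma shiftQP i j : i != j -> forall x y : {mpoly K[n]},
  subst2 (shiftQ i j) x y = subst2 (shiftP i j) x y * subst2 (shiftP j i) y x.
Proof.
move=> ij x y; rewrite /shiftP (beats_antisym ij); case: (beats i j) => /=.
  by rewrite subst2_1 mulr1.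
by rewrite subst2_1 [RHS]mul1r; apply: shiftQ_sym.
Qed.

Lemma shiftP_regular i j : i != j -> forall p q : 'I_n, p != q ->
  GRing.lreg (subst2 (shiftP i j) 'X_p 'X_q : {mpoly K[n]}).
Proof.
move=> ij p q pq; rewrite /shiftP; case: (beats i j); last by rewrite subst2_1; apply: lreg1.
by rewrite subst2_shiftQX //; apply: lreg_shift.
Qed.

Local Notation H' := (klr n shiftQ).
Local Notation elt' := (klr_elt shiftQ : klr_gen I n -> H').

Definition red_elt (g : klr_gen I n) : red H' := cl (elt' g).

Let Hrel := @klr_relP K I n shiftQ.
Let Hq := quiver_of_klr Hrel.

Lemma red_quiver : quiver_rel red_elt.
Proof.
split=> [nu nu'|i nu|p nu|p q nu]; rewrite /red_elt.
- transitivity (cl (if nu == nu' then elt' (GOne nu) else 0)); last by case: eqP.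
  by rewrite -(qr_ee Hq) clM.
- by rewrite {1}(qr_te Hq) !clM.
- by rewrite {1}(qr_xe Hq) !clM.
- by rewrite -[LHS]clM (qr_xx Hq) clM.
Qed.

Lemma red_xpol nu p : xpol red_elt nu p = cl (xpol elt' nu (up p)).
Proof.
elim/mpoly_gen_ind: p => [c p q IH IH'||i p IH].
- by rewrite up_linear (xpol_linear red_elt nu) (xpol_linear elt' nu) IH IH' clD clZ.
- by rewrite rmorph1 !xpol1.
- by rewrite rmorphM /= map_mpolyX (xpolXM red_quiver) (xpolXM Hq) IH clM.
Qed.

Lemma red_klr : klr_rel Q red_elt.
Proof.
have [R1 R2 R3 R4] := red_quiver.
split=> //.
- move=> i nu; rewrite /red_elt -clM (klr_tt Hrel) red_xpol -!/(subst2 _ _ _).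
  have [E|ne] := eqVneq (nu (sl i)) (nu (sr i)).
    by rewrite E Q0 shiftQ0 /subst2 !comp_mpoly0 up0.
  rewrite subst2_shiftQX // -[X in _ + X]mulr1 mul_mpolyC addrC.
  by rewrite (xpol_linear elt' nu) clD cl_tZ add0r.
- by move=> i j nu ij; rewrite /red_elt -!clM (klr_far Hrel).
- move=> i j nu p ij E Ep.
  rewrite red_xpol -(klr_braid Hrel (P := up p) ij E) ?clB ?clM // -!/(subst2 _ _ _).
  have := congr1 (fun q => up q) Ep; rewrite -!/(subst2 _ _ _).
  rewrite rmorphM !rmorphB /= !map_mpolyX => ->.
  have [Eb|ne] := eqVneq (nu (sl i)) (nu (sr i)).
    by rewrite Eb Q0 shiftQ0 /subst2 !comp_mpoly0 up0.
  have shiftK (a b c : {mpoly K[n]}) : a - b = (a + c) - (b + c) by ring.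
  by rewrite !subst2_shiftQX //; apply: shiftK.
- move=> i j nu ij ne; rewrite /red_elt -[0]cl0.
  by rewrite -(klr_braid0 Hrel ij ne) clB !clM.
- move=> i p nu; rewrite /red_elt.
  have -> : cl (elt' (GTau i nu)) ** cl (elt' (GX p nu)) -
    cl (elt' (GX (sref i p) (sact i nu))) ** cl (elt' (GTau i nu)) =
    cl (elt' (GTau i nu) ** elt' (GX p nu) - elt' (GX (sref i p) (sact i nu)) ** elt' (GTau i nu)).
    by rewrite clB !clM.
  by rewrite (klr_tx Hrel) -clN; case: ifP => // _; case: ifP.
Qed.

Variables (J : pred word) (HJ : reduced_family J).

Lemma shift_basis : is_basis (klr_S shiftQ J : _ -> H').
Proof.
split; first exact: klr_S_generating.
exact: (klr_S_independent_regular shiftQ0 shiftQP shiftP_regular HJ).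
Qed.

Lemma red_tauw w nu b : tauw red_elt w nu (cl b) = cl (tauw elt' w nu b).
Proof. by elim: w => //= i w ->; rewrite clM. Qed.

(** A relation over k lifts to a combination of the basis of the deformed
    algebra that is divisible by t; but constants divisible by t are zero. *)
Lemma klr_S_independent : independent (klr_S Q J : _ -> klr n Q).
Proof.
move=> c; rewrite -/(fscomb _ _) => c0 t.
have [phi phiE] := lift_linear_map red_klr.
have E : cl (\sum_(s <- finsupp c) (c s)%:P *: klr_S shiftQ J s) = 0.
  have := congr1 phi c0; rewrite linear0 linear_fscomb => <-.
  rewrite /fscomb; elim/big_rec2: _ => // s a b _ <-; rewrite clD clZ /= phiE.
  rewrite !klr_SE (lift_word_mon red_klr) /word_mon /=.
  by rewrite -!xpolXm red_xpol map_mpolyX red_tauw.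
have [b Eb] := cl_eq0 E.
have [psi psiE] := basis_coord shift_basis t.
have Eb' : psi (\sum_(s <- finsupp c) (c s)%:P *: klr_S shiftQ J s) = 'X *: psi b.
  by rewrite Eb linearZ.
case: (finsuppP c t) => // tc.
have Ec : psi (\sum_(s <- finsupp c) (c s)%:P *: klr_S shiftQ J s) = (c t)%:P.
  rewrite linear_sum /= (big_fsetD1 t) //= linearZ psiE eqxx /= big1_seq ?addr0 //.
    exact: mulr1.
  move=> s; rewrite !inE => /andP[_ /andP[st _]].
  by rewrite linearZ psiE (negPf st); exact: mulr0.
have : ('X * (psi b : K))`_0 = (c t)%:P`_0 by congr (_`_0); rewrite -Ec Eb'.
by rewrite coefXM coefC.
Qed.
End Deformation.

(** * Independence of S forces the symmetry of Q *)

Section Symmetry.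
Variables (k : comNzRingType) (I : choiceType) (n : nat).
Variable Q : I -> I -> {mpoly k[2]}.
Local Notation L := {ffun 'I_n -> I}.
Local Notation word := (seq 'I_n.-1).
Local Notation H := (klr n Q).
Local Notation elt := (klr_elt Q : klr_gen I n -> H).

Let Hrel := @klr_relP k I n Q.
Let Hq := quiver_of_klr Hrel.

Lemma tau_xpol i (nu : L) P : nu (sl i) != nu (sr i) ->
  elt (GTau i nu) ** xpol elt nu P =
  xpol elt (sact i nu) (msym (sref i) P) ** elt (GTau i nu).
Proof.
move=> ne; elim/mpoly_gen_ind: P => [c P P' IH IH'||p P IH].
- by rewrite !linearP /= IH IH' nmulDl nmulZl.
- by rewrite msym1 !xpol1 (mul_t_e Hq) (mul_e_t Hq).
- rewrite msymM msymXU !(xpolXM Hq) -[RHS]nmulA -IH !nmulA; congr (_ ** _).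
  by have /eqP := klr_tx Hrel i p nu; rewrite (negPf ne) !andbF subr_eq0 => /eqP.
Qed.

Variables (J : pred word) (HJ : reduced_family J).

Lemma family_letter (i : 'I_n.-1) : exists j : 'I_n.-1, J [:: j].
Proof.
have [w Jw Ew] := family_word HJ (sref i).
have := family_reduced HJ Jw; rewrite Ew -[sref i]mulg1 inv_up ?inv1; last by rewrite !perm1 /=.
by case: w Jw Ew => [|j [|]] // Jj _ _; exists j.
Qed.

Lemma comp_subst2 m (A : {mpoly k[2]}) (x y : {mpoly k[n]}) (T : n.-tuple {mpoly k[m]}) :
  subst2 A x y \mPo T = subst2 A (x \mPo T) (y \mPo T).
Proof.
elim/mpoly2_ind: A => [c A A' IH IH'||A IH|A IH].
- by rewrite !subst2_is_linear linearP /= IH IH'.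
- by rewrite !subst2_1 comp_mpoly1.
- by rewrite !subst2M !subst2_X0 rmorphM /= IH.
- by rewrite !subst2M !subst2_X1 rmorphM /= IH.
Qed.

(** Both ways of computing tau_i tau_i tau_i 1_nu produce tau_i times a
    polynomial, and the elements tau_i x^m 1_nu are part of S. *)
Lemma basis_symmetric (i0 : 'I_n.-1) : is_basis (klr_S Q J : _ -> H) ->
  (forall i, Q i i = 0) ->
  forall a b, Q a b = Q b a \mPo [tuple 'X_1; 'X_0].
Proof.
move=> HS Q0 a b; have [->|ab] := eqVneq a b; first by rewrite Q0 comp_mpoly0.
have [i Ji] := family_letter i0.
pose nu : L := [ffun p => if p == sl i then a else b].
have nul : nu (sl i) = a by rewrite ffunE eqxx.
have nur : nu (sr i) = b by rewrite ffunE eq_sym (negPf (sl_neq_sr i)).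
have ne : nu (sl i) != nu (sr i) by rewrite nul nur.
pose D : {mpoly k[n]} := subst2 (Q a b) 'X_(sl i) 'X_(sr i) - subst2 (Q b a) 'X_(sr i) 'X_(sl i).
have tD : elt (GTau i nu) ** xpol elt nu D = 0.
  rewrite /D !linearB /= [X in _ - X]tau_xpol //.
  rewrite msym_subst2 !msymXU sref_sl sref_sr; apply/eqP; rewrite subr_eq0; apply/eqP.
  have := klr_tt Hrel i nu; rewrite nul nur -/(subst2 _ _ _) => <-.
  have := klr_tt Hrel i (sact i nu); rewrite sactK -/(subst2 _ _ _).
  have -> : sact i nu (sl i) = b by rewrite ffunE sref_sl.
  have -> : sact i nu (sr i) = a by rewrite ffunE sref_sr.
  by move=> <-; rewrite nmulA.
have D0 : D = 0.
  apply/mpolyP => m; rewrite mcoeff0.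
  have [phi phiE] := basis_coord HS (exist _ [:: i] Ji, m, nu).
  have := congr1 phi tD; rewrite linear0 /xpol linear_sum /= linear_sum /= => <-.
  have E m' : phi (elt (GTau i nu) ** (D@_m' *: xmon elt nu m')) = D@_m' * (m' == m)%:R.
    rewrite nmulZr linearZ; congr (_ * _).
    rewrite -[elt _ ** _]/(word_mon elt ([:: i], m', nu)).
    have := phiE (exist _ [:: i] Ji, m', nu); rewrite klr_SE => ->.
    by rewrite !xpair_eqE !eqxx andbT.
  under eq_bigr => m' _ do rewrite E.
  case: (boolP (m \in msupp D)) => [mD|mD].
    rewrite (bigD1_seq m) ?msupp_uniq //= eqxx mulr1 big1 ?addr0 // => m' /negPf ->.
    by rewrite mulr0.
  rewrite (memN_msupp_eq0 mD) big1_seq // => m' /andP[_ m'D].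
  by case: eqP => [E'|]; rewrite ?mulr0 // -E' m'D in mD *.
(* Sending x_i, x_(i+1) to the two variables and the others to 0 recovers Q. *)
pose T : n.-tuple {mpoly k[2]} :=
  [tuple if p == sl i then 'X_0 else if p == sr i then 'X_1 else 0 | p < n].
have Tl : ('X_(sl i) : {mpoly k[n]}) \mPo T = 'X_0.
  by rewrite comp_mpolyXU -tnth_nth tnth_mktuple eqxx.
have Tr : ('X_(sr i) : {mpoly k[n]}) \mPo T = 'X_1.
  by rewrite comp_mpolyXU -tnth_nth tnth_mktuple eq_sym (negPf (sl_neq_sr i)) eqxx.
have := congr1 (fun P => P \mPo T) D0; rewrite /D comp_mpolyB comp_mpoly0 !comp_subst2 Tl Tr.
move/eqP; rewrite subr_eq0 => /eqP E.
rewrite -[RHS]E /subst2 -[LHS]comp_mpoly_id; congr (_ \mPo _).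
by apply: val_inj; rewrite /= enum_ordSl enum_ordSl enum_ord0.
Qed.
End Symmetry.

(** * The graded relations *)

Section GradedRelations.
Variables (k : comNzRingType) (I : choiceType) (n : nat).
Local Notation L := {ffun 'I_n -> I}.
Local Notation word := (seq 'I_n.-1).

Section Family.
Variables (B : nuAlgType k) (f : klr_gen I n -> B).
Local Notation e nu := (f (GOne nu)).
Local Notation x p nu := (f (GX p nu)).
Local Notation t i nu := (f (GTau i nu)).

(** The leading terms of the relations of H_n(Q). *)
Record graded_rel : Prop := GradedRel {
  grd_quiver : quiver_rel f;
  grd_tt : forall i (nu : L), t i (sact i nu) ** t i nu = 0;
  grd_far : forall i j (nu : L), far i j ->
    t i (sact j nu) ** t j nu = t j (sact i nu) ** t i nu;
  grd_braid : forall (i j : 'I_n.-1) (nu : L), j = i.+1 :> nat ->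
    t j (sact i (sact j nu)) ** t i (sact j nu) ** t j nu =
    t i (sact j (sact i nu)) ** t j (sact i nu) ** t i nu;
  grd_tx : forall i p (nu : L), t i nu ** x p nu = x (sref i p) (sact i nu) ** t i nu
}.

Hypothesis fg : graded_rel.
Let fq := grd_quiver fg.

Lemma grd_braid_eq w w' nu b : braid_eq w w' -> tauw f w nu b = tauw f w' nu b.
Proof.
elim=> {w w'} [w|w w' _ ->|w' w w'' _ -> _ ->|a c i j ij|a c i j ij] //; rewrite !tauw_cat.
  by rewrite /= !nmulA (grd_far fg _ ij) [sact i (sact j _)]sact_far.
rewrite /= (sact_braid _ ij) !nmulA; congr tauw; congr (_ ** _).
by rewrite (grd_braid fg _ ij).
Qed.

Lemma grd_square a i c nu b : tauw f (a ++ i :: i :: c) nu b = 0.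
Proof. by rewrite tauw_cat /= nmulA (grd_tt fg) nmul0l linear0. Qed.

Lemma grd_x_word w nu m p :
  x p (wact w nu) ** word_mon f (w, m, nu) = word_mon f (w, (U_(word_perm w p) + m)%MM, nu).
Proof.
rewrite /word_mon /=; elim: w p => [|i w IH] p /=.
  by rewrite word_perm_nil perm1 (xmonU fq).
have := grd_tx fg i (sref i p) (wact w nu); rewrite srefK nmulA => <-.
by rewrite -nmulA IH word_perm_cons permM.
Qed.
End Family.

Variables (J : pred word) (HJ : reduced_family J).
Local Notation T := ({w | J w} * 'X_{1..n} * L)%type.

Definition basis_mon (B : nuAlgType k) (f : klr_gen I n -> B) (s : T) : B :=
  word_mon f (val s.1.1, s.1.2, s.2).

(** The product of a generator and a basis element is zero or a basis element,
    and which one it is depends only on the word combinatorics. The two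
    algebras compared by the PBW property thus have the same table. *)
Lemma graded_table (g : klr_gen I n) (s : T) :
  (forall (B : nuAlgType k) (f : klr_gen I n -> B), graded_rel f -> f g ** basis_mon f s = 0) \/
  exists s', forall (B : nuAlgType k) (f : klr_gen I n -> B),
    graded_rel f -> f g ** basis_mon f s = basis_mon f s'.
Proof.
case: s => [[u m] nu]; case: g => [mu|p mu|i mu].
- have [->|/negPf ne] := eqVneq mu (wact (val u) nu); [right | left] => [|B f fg].
    exists (u, m, nu) => B f fg; rewrite /basis_mon /word_mon /= -xpolXm.
    by rewrite (mul_e_tauw (grd_quiver fg)) eqxx.
  by rewrite /basis_mon /word_mon /= -xpolXm (mul_e_tauw (grd_quiver fg)) ne.
- have [->|/eqP ne] := eqVneq mu (wact (val u) nu); [right | left] => [|B f fg].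
    exists (u, (U_(word_perm (val u) p) + m)%MM, nu) => B f fg.
    exact: grd_x_word.
  by rewrite /basis_mon /word_mon /= -xpolXm (mul_x_neq (grd_quiver fg)).
- have [->|/eqP ne] := eqVneq mu (wact (val u) nu); last first.
    left=> B f fg.
    by rewrite /basis_mon /word_mon /= -xpolXm (mul_t_neq (grd_quiver fg)).
  case: (word_cases HJ (i :: val u)) => [[w Jw Ew]|[a [j [b Ew]]]]; [right | left].
    exists (exist _ w Jw, m, nu) => B f fg.
    by rewrite /basis_mon /word_mon /= -(grd_braid_eq fg _ _ Ew).
  by move=> B f fg; rewrite /basis_mon; have := grd_braid_eq fg nu (xmon f nu m) Ew;
    rewrite (grd_square fg).
Qed.

Lemma nil_in_family : J [::].
Proof.
have [u Ju Eu] := family_word HJ 1%g.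
by have := family_reduced HJ Ju; rewrite Eu inv1 => /size0nil <-.
Qed.
End GradedRelations.

(** * The associated graded algebra of H_n(Q) *)

Section AssociatedGraded.
Variables (k : comNzRingType) (I : choiceType) (n : nat).
Variable Q : I -> I -> {mpoly k[2]}.
Local Notation L := {ffun 'I_n -> I}.
Local Notation word := (seq 'I_n.-1).
Local Notation H := (klr n Q).
Local Notation elt := (klr_elt Q : klr_gen I n -> H).
Local Notation F := (@klr_filtration k I n Q).

Let Hrel := @klr_relP k I n Q.
Let Hq := quiver_of_klr Hrel.

Lemma gr_class_eq d d' a a' (Fa : F d a) (Fa' : F d' a') :
  d = d' -> a = a' -> gr_class Fa = gr_class Fa'.
Proof. by move=> Ed Ea; congr pmod_gen; apply: felt_eq. Qed.

Lemma gr_classM d d' a a' (Fa : F d a) (Fa' : F d' a') :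
  gr_class Fa ** gr_class Fa' = gr_class (filM Fa Fa').
Proof. exact: gr_mul_gen2. Qed.

Lemma gr_class_lin d c a b (Fa : F d a) (Fb : F d b) (Fab : F d (c *: a + b)) :
  gr_class Fab = c *: gr_class Fa + gr_class Fb.
Proof. exact: ((gr_gen_rel F).1 _ _ _ _ Fa Fb Fab). Qed.

Lemma gr_class0 d (F0 : F d 0) : gr_class F0 = 0.
Proof.
have Z : F d (-1 *: 0 + 0) by rewrite scaler0 addr0.
transitivity (gr_class Z); last by rewrite (gr_class_lin F0 F0) scaleN1r addNr.
by apply: gr_class_eq; rewrite // scaler0 addr0.
Qed.

Lemma gr_class_low d e a (Fa : F d a) : klr_fil e a -> (e < d)%N -> gr_class Fa = 0.
Proof.
case: d Fa => // d Fa Fe ed.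
exact: ((gr_gen_rel F).2 _ _ (fil_le (ed : (e <= d)%N) Fe : F d a) Fa).
Qed.

Lemma gr_class_sub d e a b (Fa : F d a) (Fb : F d b) :
  klr_fil e (a - b) -> (e < d)%N -> gr_class Fa = gr_class Fb.
Proof.
move=> Fe ed; have Fab : F d (-1 *: b + a) by apply: klr_fil_lin.
have := gr_class_lin Fb Fa Fab; rewrite (gr_class_low (e := e)) //.
  by rewrite scaleN1r addrC => /esym/eqP; rewrite subr_eq0 => /eqP.
by rewrite scaleN1r addrC.
Qed.

Definition gr_elt (g : klr_gen I n) : gr F :=
  match g with
  | GOne nu => gr_class (F := F) (klr_fil1 Q nu)
  | GX p nu => gr_class (F := F) (klr_filx Q p nu)
  | GTau i nu => gr_class (F := F) (klr_filt Q i nu)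
  end.

Lemma gr_elt_graded : graded_rel gr_elt.
Proof.
split; first split=> [nu nu'|i nu|p nu|p q nu].
- rewrite /= gr_classM; have [->|ne] := eqVneq nu nu'.
    by apply: gr_class_eq => //; rewrite (mul_ee Hq).
  have F0 : F 0 0 := klr_fil0 _ _ _.
  transitivity (gr_class F0).
    by apply: gr_class_eq => //; rewrite (qr_ee Hq) (negPf ne).
  exact: gr_class0.
- by rewrite /= !gr_classM; apply: gr_class_eq => //; rewrite -(qr_te Hq).
- by rewrite /= !gr_classM; apply: gr_class_eq => //; rewrite -(qr_xe Hq).
- by rewrite /= !gr_classM; apply: gr_class_eq => //; rewrite (qr_xx Hq).
- move=> i nu; rewrite /= gr_classM; apply: (gr_class_low (e := 0)) => //.
  by rewrite (klr_tt Hrel); apply: fil_xpol.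
- by move=> i j nu ij; rewrite /= !gr_classM; apply: gr_class_eq; rewrite // (klr_far Hrel).
- move=> i j nu ij; rewrite /= !gr_classM; apply/esym/(gr_class_sub (e := 0)) => //.
  have := fil_braid nu ij (klr_fil1 Q nu : klr_fil 0 (elt (GOne nu))).
  by rewrite /= !(mul_t_e Hq) !nmulA.
- move=> i p nu; rewrite /= !gr_classM; apply: (gr_class_sub (e := 0)) => //.
  rewrite (klr_tx Hrel); case: ifP => _.
    by rewrite -scaleN1r -[_ *: _]addr0; apply: klr_fil_lin; [apply: klr_fil1 | apply: klr_fil0].
  by case: ifP => _; [apply: klr_fil1 | apply: klr_fil0].
Qed.

Lemma gr_xmon nu m (Fm : F 0 (xmon elt nu m)) : xmon gr_elt nu m = gr_class Fm.
Proof.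
elim/mnm_ind: m Fm => [|p m IH] Fm.
  by rewrite xmon0; apply: gr_class_eq => //; rewrite xmon0.
have F0 : F 0 (xmon elt nu m) by rewrite -xpolXm; apply: fil_xpol.
rewrite (xmonU (grd_quiver gr_elt_graded)) (IH F0) gr_classM.
by apply: gr_class_eq => //; rewrite (xmonU Hq).
Qed.

Lemma gr_word_mon s (Fs : F (size s.1.1) (word_mon elt s)) :
  word_mon gr_elt s = gr_class Fs.
Proof.
case: s Fs => [[w m] nu]; rewrite /word_mon /=; elim: w => [|i w IH] Fs /=.
  exact: gr_xmon.
have Fw : F (size w) (tauw elt w nu (xmon elt nu m)) := @fil_word_mon k I n Q (w, m, nu).
by rewrite (IH Fw) gr_classM; apply: gr_class_eq.
Qed.

Variables (J : pred word) (HJ : reduced_family J).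
Local Notation T := ({w | J w} * 'X_{1..n} * L)%type.
Local Notation bH := (klr_S Q J).
Local Notation bG := (basis_mon (J := J) gr_elt).
Local Notation len s := (size (val s.1.1)).

Lemma fil_klr_S (s : T) : F (len s) (bH s).
Proof. by rewrite klr_SE; apply: (@fil_word_mon k I n Q (val s.1.1, s.1.2, s.2)). Qed.

Lemma gr_class_klr_S d (s : T) (Fs : F d (bH s)) : (len s <= d)%N ->
  gr_class Fs = if len s == d then bG s else 0.
Proof.
move=> sd; have Fw : F (len s) (word_mon elt (val s.1.1, s.1.2, s.2)).
  by rewrite -klr_SE; apply: fil_klr_S.
case: eqP => [E|/eqP ne].
  rewrite /basis_mon (@gr_word_mon (val s.1.1, s.1.2, s.2) Fw).
  by apply: gr_class_eq; rewrite ?klr_SE.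
by apply: gr_class_low (fil_klr_S s) _; rewrite ltn_neqAle ne.
Qed.

Lemma gr_span (a : gr F) : span bG (fun=> True) a.
Proof.
elim/pmod_ind: a => [[d a Fa]||c a b Sa Sb].
- have := fil_Jspan HJ (Fa : klr_fil d a); move: Fa => + Sa.
  elim: Sa => [|c s v sd Sv IH] Fa; first by rewrite [pmod_gen _ _]gr_class0; apply: span0.
  have Fv : F d v.
    elim: {Fa IH} Sv => [|c' s' v' s'd _ IH]; first exact: klr_fil0.
    by apply: klr_fil_lin => //; apply: fil_le s'd (fil_klr_S _).
  have Fs : F d (bH s) := fil_le sd (fil_klr_S s).
  rewrite [pmod_gen _ _](gr_class_lin Fs Fv Fa); apply: span_lin; last exact: IH.
  by rewrite gr_class_klr_S //; case: eqP => _; [apply: span_gen | apply: span0].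
- exact: span0.
- exact: span_lin.
Qed.

(** The coordinate of an element of S of length d vanishes on words of length
    less than d, so it induces a linear form on the graded algebra. *)
Lemma gr_independent : is_basis bH -> independent bG.
Proof.
move=> HS; apply: independent_dual => t.
have [phi phiE] := basis_coord HS t.
have vanish d v : (d < len t)%N -> klr_fil d v -> phi v = 0.
  move=> dt /(fil_Jspan HJ); elim=> [|c s w sd _ IH]; first exact: linear0.
  rewrite linearP IH addr0 phiE; case: eqP => [E|_]; last exact: mulr0.
  by move: sd; rewrite E leqNgt dt.
pose f (y : felt F) : k^o := if fdeg y == len t then phi (fval y) else 0.
have Rf : gr_rel f.
  split=> [d c a b Fa Fb Fab|d a Fa Fa']; rewrite /f /=.
    by case: eqP => _; rewrite ?linearP // scaler0 addr0.
  by case: eqP => // E; apply: vanish Fa; rewrite -E.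
pose psi : {linear gr F -> k^o} := HB.pack_for {linear gr F -> k^o} (pmod_lift f)
  (GRing.isLinear.Build k (gr F) k^o *:%R _ (pmod_lift_linear Rf)).
exists psi => u; have Fu := fil_klr_S u.
have -> : bG u = gr_class Fu by rewrite gr_class_klr_S // eqxx.
change (pmod_lift f (gr_class Fu) = (u == t)%:R).
rewrite (pmod_lift_gen Rf) /f /= phiE; case: eqP => // ne.
by case: (u =P t) => // E; rewrite E in ne.
Qed.

(** A relation between the elements of S gives one between the symbols of its
    terms of maximal length. *)
Lemma klr_S_independent_gr : independent bG -> independent bH.
Proof.
move=> iG c c0.
have top D : (forall s, c s != 0 -> (len s <= D)%N) -> forall s, len s = D -> c s = 0.
  move=> cD s sD.
  have cls (l : seq T) : (forall u, u \in l -> (len u <= D)%N) ->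
      forall Fl : F D (\sum_(u <- l) c u *: bH u),
      gr_class Fl = \sum_(u <- l) c u *: (if len u == D then bG u else 0).
    elim: l => [|u l IH] lD.
      by rewrite !big_nil => Fl; apply: gr_class0.
    rewrite !big_cons => Fl.
    have uD : (len u <= D)%N by apply: lD; rewrite inE eqxx.
    have Fu : F D (bH u) := fil_le uD (fil_klr_S u).
    have {}lD v : v \in l -> (len v <= D)%N by move=> vl; apply: lD; rewrite inE vl orbT.
    have Fv : F D (\sum_(v <- l) c v *: bH v).
      rewrite big_seq; elim/big_ind: _ => [||v vl]; first exact: klr_fil0.
        exact: fil_add.
      rewrite -[_ *: _]addr0; apply: klr_fil_lin; last exact: klr_fil0.
      exact: fil_le (lD _ vl) (fil_klr_S v).
    by rewrite (gr_class_lin Fu Fv Fl) (IH lD Fv) gr_class_klr_S.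
  pose c' : {fsfun T -> k with 0} := [fsfun u in finsupp c => if len u == D then c u else 0].
  have c'E u : c' u = if len u == D then c u else 0.
    by rewrite fsfunE; case: finsuppP => // _; rewrite if_same.
  have := iG c'; rewrite -/(fscomb bG c') => /(_ _ s); rewrite c'E sD eqxx; apply.
  have sub : (finsupp c' `<=` finsupp c)%fset.
    by apply/fsubsetP => u; rewrite !mem_finsupp c'E; case: (len u == D); rewrite ?eqxx.
  rewrite (fscombE bG sub).
  have Fc : F D (\sum_(u <- finsupp c) c u *: bH u) by rewrite c0; apply: klr_fil0.
  transitivity (gr_class Fc); last first.
    have F0 : F D 0 := klr_fil0 _ _ _.
    by rewrite -(gr_class0 F0); apply: gr_class_eq.
  rewrite cls; last by move=> u; rewrite mem_finsupp => /cD.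
  apply: eq_bigr => u _; rewrite c'E; case: eqP => // _.
  by rewrite scale0r scaler0.
have low D : (forall s, c s != 0 -> (len s < D)%N) -> forall s, c s = 0.
  elim: D => [|D IH] cD s; first by apply/eqP; apply/negPn/negP => /cD.
  apply: IH => u nu; have := cD u nu; rewrite ltnS leq_eqVlt => /orP[/eqP E|//].
  by rewrite (top D cD u E) eqxx in nu.
apply: (low (\max_(s <- finsupp c) len s).+1) => s; rewrite -mem_finsupp ltnS => sc.
by rewrite (big_fsetD1 s) //= leq_maxl.
Qed.
End AssociatedGraded.

(** * The nil Hecke algebra *)

Section NilHeckeBasis.
Variable n : nat.
Local Notation word := (seq 'I_n.-1).
Local Notation NH := (nilHecke n).

Definition nhw (w : word) : NH := foldr (fun i h => nhT i ** h) (nh1 n) w.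

Lemma nh1l (h : NH) : nh1 n ** h = h. Proof. exact: (nh_1l (nilHecke_rel n)). Qed.
Lemma nh1r (h : NH) : h ** nh1 n = h. Proof. exact: (nh_1r (nilHecke_rel n)). Qed.

Lemma nhT_sq i : nhT i ** nhT i = 0 :> NH. Proof. exact: (nh_sq (nilHecke_rel n)). Qed.
Lemma nhT_far i j : far i j -> nhT i ** nhT j = nhT j ** nhT i :> NH.
Proof. exact: (nh_far (nilHecke_rel n)). Qed.
Lemma nhT_braid (i j : 'I_n.-1) : j = i.+1 :> nat ->
  nhT i ** nhT j ** nhT i = nhT j ** nhT i ** nhT j :> NH.
Proof. exact: (nh_braid (nilHecke_rel n)). Qed.

Lemma nhw_cat w w' : nhw (w ++ w') = nhw w ** nhw w'.
Proof. by elim: w => [|i w IH] /=; rewrite ?nh1l // IH nmulA. Qed.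

Lemma nhw_braid_eq w w' : braid_eq w w' -> nhw w = nhw w'.
Proof.
elim=> {w w'} [w|w w' _ ->|w' w w'' _ -> _ ->|a c i j ij|a c i j ij] //; rewrite !nhw_cat.
  by rewrite /= !nmulA -(nmulA (nhw a)) (nhT_far ij) !nmulA.
rewrite /=; congr (_ ** _); rewrite !nmulA; congr (_ ** _).
exact: nhT_braid.
Qed.

Lemma nhw_square a i c : nhw (a ++ i :: i :: c) = 0.
Proof. by rewrite nhw_cat /= (nmulA (nhT i)) nhT_sq nmul0l linear0. Qed.

Lemma nhw_span (h : NH) : span nhw (fun=> True) h.
Proof.
elim/palg_ind: h => [[i|]||c a b Ha Hb|a b Ha Hb].
- by rewrite -/(nhT i) -[nhT i]nh1r; apply: (@span_gen _ _ _ nhw _ [:: i]).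
- exact: (@span_gen _ _ _ nhw _ [::]).
- exact: span0.
- exact: span_lin.
- elim: Ha => [|c w v _ _ IH]; first by rewrite nmul0l; apply: span0.
  rewrite nmulDl nmulZl; apply: span_lin => //.
  elim: Hb {IH} => [|d w' v' _ _ IH']; first by rewrite linear0; apply: span0.
  by rewrite linearP /= -nhw_cat; apply: span_lin => //; apply: span_gen.
Qed.

(** For a single label and Q = 0, the tau_i satisfy the relations of the nil
    Hecke algebra, so the independence of S over the integers separates the
    elements T_w. *)
Let Q0 : unit -> unit -> {mpoly int[2]} := fun _ _ => 0.
Let nu0 : {ffun 'I_n -> unit} := [ffun=> tt].

Lemma unit_labels (nu : {ffun 'I_n -> unit}) : nu = nu0.
Proof. by apply/ffunP => p; case: (nu p) (nu0 p) => [[]]. Qed.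

Definition nh_to_klr (o : option 'I_n.-1) : klr n Q0 :=
  if o is Some i then klr_elt Q0 (GTau i nu0) else klr_elt Q0 (GOne nu0).

Lemma nh_to_klr_rel : nh_rel nh_to_klr.
Proof.
have R := @klr_relP int unit n Q0; have Rq := quiver_of_klr R.
have unitl (a : klr n Q0) : klr_elt Q0 (GOne nu0) ** a = a.
  elim/palg_ind: a => [[nu|p nu|i nu]||c a b IHa IHb|a b IHa _].
  - by rewrite (unit_labels nu); apply: (mul_ee Rq).
  - by rewrite (unit_labels nu); apply: (mul_e_x Rq).
  - by rewrite -[X in GOne X](unit_labels (sact i nu)); apply: (mul_e_t Rq).
  - exact: linear0.
  - by rewrite linearP /= IHa IHb.
  - by rewrite nmulA IHa.
have unitr (a : klr n Q0) : a ** klr_elt Q0 (GOne nu0) = a.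
  elim/palg_ind: a => [[nu|p nu|i nu]||c a b IHa IHb|a b _ IHb].
  - by rewrite (unit_labels nu); apply: (mul_ee Rq).
  - by rewrite (unit_labels nu); apply: (mul_x_e Rq).
  - by rewrite (unit_labels nu); apply: (mul_t_e Rq).
  - exact: nmul0l.
  - by rewrite nmulDl nmulZl IHa IHb.
  - by rewrite -nmulA IHb.
have S i : sact i nu0 = nu0 by apply: unit_labels.
have xpol0 : xpol (klr_elt Q0) nu0 0 = 0 :> klr n Q0 by apply: linear0.
split=> //= [i|i j ij|i j ij].
- have := klr_tt R i nu0; rewrite S => ->.
  by rewrite /Q0 comp_mpoly0.
- by have := klr_far R nu0 ij; rewrite !S.
- have := @klr_braid _ _ _ _ _ _ R i j nu0 0 ij; rewrite !S xpol0 => E.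
  apply/eqP; rewrite eq_sym -subr_eq0; apply/eqP; apply: E.
    by rewrite !ffunE.
  by rewrite mulr0 /Q0 !comp_mpoly0 subr0.
Qed.

Variables (J : pred word) (HJ : reduced_family J).

Lemma nhw_dual (w0 : word) : J w0 ->
  exists c : NH -> int, (forall h h', c (h + h') = c h + c h') /\
    forall w, J w -> c (nhw w) = (w == w0)%:R.
Proof.
move=> Jw0.
have HS : is_basis (klr_S Q0 J : _ -> klr n Q0).
  split; first exact: klr_S_generating.
  by apply: klr_S_independent => // i j; rewrite /Q0 comp_mpoly0.
have [phi phiE] := basis_coord HS (exist _ w0 Jw0, 0%MM, nu0).
exists (fun h => phi (palg_lift nh_to_klr h)); split=> [h h'|w Jw].
  by rewrite (palg_evD nh_to_klr_rel) linearD.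
have -> : palg_lift nh_to_klr (nhw w) = klr_S Q0 J (exist _ w Jw, 0%MM, nu0).
  rewrite klr_SE /word_mon /= xmon0; elim: w {Jw} => [|i w IH] /=.
    exact: (palg_lift_gen nh_to_klr_rel).
  rewrite (palg_liftM nh_to_klr_rel) IH (palg_lift_gen nh_to_klr_rel) /=.
  by rewrite (unit_labels (wact w nu0)).
by rewrite phiE !xpair_eqE !eqxx !andbT.
Qed.
End NilHeckeBasis.

(** * The wreath product *)

Section WreathBasis.
Variables (k : comNzRingType) (I : choiceType) (n : nat).
Local Notation L := {ffun 'I_n -> I}.
Local Notation word := (seq 'I_n.-1).
Local Notation A := (polysum k I).
Local Notation W := (wreath A n).
Local Notation NH := (nilHecke n).
Implicit Types (a b : {ffun 'I_n -> A}) (h : NH) (nu : L) (m : 'X_{1..n}).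

Definition w_elt (g : klr_gen I n) : W :=
  match g with
  | GOne nu => w_one k nu
  | GX p nu => w_x k p nu
  | GTau i nu => w_T k i nu
  end.

(** The element x^m 1_nu of the tensor power. *)
Definition tens m nu : {ffun 'I_n -> A} := [ffun q => ps_single (nu q) 'X^(m q)].

Lemma ps_singleE (i : I) (p : {poly k}) j : ps_single i p j = if j == i then p else 0.
Proof. by rewrite fsfunE inE. Qed.

Lemma pure_mul a h b h' : pure a h ** pure b h' = wr_lmul a (wr_act h (pure b h')).
Proof. exact: wr_mul_pure. Qed.

Lemma pure_mul1 a b h : pure a (nh1 n) ** pure b h = pure (fmul a b) h :> W.
Proof. by rewrite pure_mul wr_act_1 wr_lmul_pure. Qed.

Lemma pure_mulT a i b h : pure a (nhT i) ** pure b h = pure (fmul a (sact i b)) (nhT i ** h) :> W.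
Proof. by rewrite pure_mul wr_act_T wr_T_pure wr_lmul_pure. Qed.

Lemma pure_lin a p (c : k) u v h :
  pure (fupd a p (c *: u + v)) h = c *: pure (fupd a p u) h + pure (fupd a p v) h :> W.
Proof. exact: (pure_rel A n).1. Qed.

Lemma fupd_id a p : fupd a p (a p) = a.
Proof. by apply/ffunP => q; rewrite ffunE; case: eqP => [->|]. Qed.

Lemma pure0l a p h : a p = 0 -> pure a h = 0 :> W.
Proof.
move=> ap; have := pure_lin a p (-1) 0 0 h; rewrite scaler0 addr0 scaleN1r addNr.
by rewrite -{1}ap fupd_id.
Qed.

Lemma sact_tens i m nu : sact i (tens m nu) = tens [multinom m (sref i q) | q < n] (sact i nu).
Proof. by apply/ffunP => q; rewrite !ffunE mnmE. Qed.

Lemma fmul_tens m m' nu : fmul (tens m nu) (tens m' nu) = tens (m + m')%MM nu.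
Proof.
apply/ffunP => q; rewrite !ffunE; apply/fsfunP => j.
rewrite ps_mulE !ps_singleE; case: eqP => _; last by rewrite mulr0.
by rewrite mnmDE exprD.
Qed.

Lemma pure_tens_neq m m' nu nu' h : nu != nu' -> pure (fmul (tens m nu) (tens m' nu')) h = 0 :> W.
Proof.
move=> ne; have [p np] : exists p, nu p != nu' p.
  apply/existsP; apply: contraNT ne; rewrite negb_exists => /forallP H.
  by apply/eqP/ffunP => p; move: (H p); rewrite negbK => /eqP.
apply: (@pure0l _ p); rewrite !ffunE; apply/fsfunP => j.
rewrite ps_mulE !ps_singleE psE; case: eqP => [->|_]; last by rewrite mul0r.
by rewrite (negPf np) mulr0.
Qed.

Lemma w_oneE nu : w_one k nu = pure (tens 0%MM nu) (nh1 n).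
Proof. by congr pure; apply/ffunP => q; rewrite !ffunE mnm0E expr0. Qed.

Lemma w_xE p nu : w_x k p nu = pure (tens U_(p)%MM nu) (nh1 n).
Proof.
congr pure; apply/ffunP => q; rewrite !ffunE mnm1E (eq_sym q).
by case: eqP; rewrite ?expr1 ?expr0.
Qed.

Lemma w_TE i nu : w_T k i nu = pure (tens 0%MM (sact i nu)) (nhT i).
Proof.
rewrite /w_T w_oneE wr_act_T wr_T_pure nh1r sact_tens; congr (pure (tens _ _) _).
by apply/mnmP => q; rewrite !mnmE.
Qed.

Definition w_eltE := (w_oneE, w_xE, w_TE).

Lemma w_elt_graded : graded_rel w_elt.
Proof.
split; first split=> [nu nu'|i nu|p nu|p q nu].
- rewrite /= !w_eltE pure_mul1; have [->|ne] := eqVneq nu nu'.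
    by rewrite fmul_tens addm0.
  exact: pure_tens_neq.
- rewrite /= !w_eltE pure_mul1 pure_mulT fmul_tens nh1r sact_tens; congr pure.
  rewrite fmul_tens; congr tens.
  by apply/mnmP => q; rewrite !mnmE.
- by rewrite /= !w_eltE !pure_mul1 !fmul_tens addm0 add0m.
- by rewrite /= !w_eltE !pure_mul1 !fmul_tens addmC.
- move=> i nu; rewrite /= !w_eltE pure_mulT nhT_sq.
  exact: pure0r.
- move=> i j nu ij; rewrite /= !w_eltE !pure_mulT !sact_tens (sact_far _ ij) !fmul_tens.
  rewrite (nhT_far ij); congr (pure (tens _ _) _).
  by apply/mnmP => q; rewrite !mnmE.
- move=> i j nu ij; rewrite /= !w_eltE -!nmulA !pure_mulT !sact_tens !fmul_tens !sact_tens.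
  rewrite !fmul_tens (sact_braid _ ij) !nmulA (nhT_braid ij).
  by congr (pure (tens _ _) _); apply/mnmP => q; rewrite !mnmE.
- move=> i p nu; rewrite /= !w_eltE pure_mul1 pure_mulT sact_tens !fmul_tens nh1r.
  congr (pure (tens _ _) _); apply/mnmP => q; rewrite !mnmE addn0 add0n.
  by rewrite -(inj_eq (@perm_inj _ (sref i))) srefK.
Qed.

Let Wq := grd_quiver w_elt_graded.

Lemma w_xmon nu m : xmon w_elt nu m = pure (tens m nu) (nh1 n).
Proof.
elim/mnm_ind: m => [|p m IH]; first by rewrite xmon0 /= w_oneE.
by rewrite (xmonU Wq) IH /= w_xE pure_mul1 fmul_tens.
Qed.

Lemma w_word_mon w m nu :
  word_mon w_elt (w, m, nu) = pure (wact w (tens m nu)) (nhw w).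
Proof.
rewrite /word_mon /=; elim: w => [|i w IH] /=; first exact: w_xmon.
rewrite IH w_TE pure_mulT; congr pure; apply/ffunP => q.
rewrite !ffunE !wactE mnm0E expr0; apply/fsfunP => j.
rewrite ps_mulE !ffunE !ps_singleE; case: eqP => _; last by rewrite mulr0.
by rewrite mul1r.
Qed.

Variables (J : pred word) (HJ : reduced_family J).
Local Notation T := ({w | J w} * 'X_{1..n} * L)%type.
Local Notation bW := (basis_mon (J := J) w_elt).

Lemma polysum_ind (P : A -> Prop) : P 0 ->
  (forall c i d u, P u -> P (c *: ps_single i ('X^d : {poly k}) + u)) -> forall u, P u.
Proof.
move=> P0 PS.
have evalD (X : Type) (s : seq X) (F : X -> A) j : (\sum_(x <- s) F x) j = \sum_(x <- s) F x j.
  by elim/big_rec2: _ => [|x a b _ <-]; rewrite [LHS]psE.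
have single (i : I) p : ps_single i p = \sum_(d < size p) p`_d *: ps_single i ('X^d : {poly k}).
  apply/fsfunP => j; rewrite evalD ps_singleE.
  rewrite -[in LHS](coefK p) poly_def.
  case: eqP => E; last first.
    by rewrite big1 // => d _; rewrite [LHS]psE ps_singleE (introF eqP E) scaler0.
  by apply: eq_bigr => d _; rewrite [RHS]psE ps_singleE (introT eqP E).
have P1 i p u : P u -> P (ps_single i p + u).
  move=> Pu; rewrite single; elim: (index_enum _) => [|d s IH].
    by rewrite big_nil add0r.
  by rewrite big_cons -addrA; apply: PS.
move=> u; have -> : u = \sum_(i <- finsupp u) ps_single i (u i).
  apply/fsfunP => j; rewrite evalD; case: finsuppP => ju.
    rewrite big1_seq // => i /andP[_ iu]; rewrite ps_singleE.
    by case: eqP => // E; rewrite E iu in ju.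
  rewrite (big_fsetD1 j) //= ps_singleE eqxx big1_seq ?addr0 // => i.
  by rewrite !inE ps_singleE eq_sym => /andP[_ /andP[/negPf ->]].
elim: (enum_fset _) => [|i s IH]; first by rewrite big_nil.
by rewrite big_cons; apply: P1.
Qed.

Lemma pureD a h h' : pure a (h + h') = pure a h + pure a h' :> W.
Proof. exact: (pure_rel A n).2. Qed.

Lemma pureZ a (c : int) h : pure a (c *: h) = c%:~R *: pure a h :> W.
Proof.
have pos (d : nat) : pure a (d%:Z *: h) = d%:R *: pure a h :> W.
  elim: d => [|d IH]; first by rewrite !scale0r pure0r.
  by rewrite intS scalerDl scale1r pureD IH mulrS scalerDl scale1r.
case: c => d; first exact: pos.
rewrite NegzE scaleNr mulrNz scaleNr -pos; apply/eqP.
by rewrite -addr_eq0 -pureD addNr pure0r.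
Qed.

Lemma pure_tens_span w m nu : J w -> span bW (fun=> True) (pure (tens m nu) (nhw w)).
Proof.
move=> Jw; pose v := word_perm w.
pose m' := [multinom m (v^-1%g q) | q < n].
pose nu' : L := [ffun q => nu (v^-1%g q)].
have -> : pure (tens m nu) (nhw w) = bW (exist _ w Jw, m', nu').
  rewrite /basis_mon w_word_mon /=; congr pure; apply/ffunP => q.
  by rewrite wactE !ffunE mnmE permK.
exact: span_gen.
Qed.

(** Multilinearity reduces to monomials one tensor factor after the other; the
    positions in l are those still to be expanded. *)
Lemma pure_word_span w a : J w -> span bW (fun=> True) (pure a (nhw w)).
Proof.
move=> Jw.
suff H (l : seq 'I_n) b : (forall p, p \notin l -> exists i, exists d : nat, b p = ps_single i 'X^d) ->
    span bW (fun=> True) (pure b (nhw w)).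
  by apply: (H (enum 'I_n)) => p; rewrite mem_enum.
elim: l b => [|p l IH] b Hb.
  have [nu Hnu] := choice (fun p => Hb p isT).
  have [m Hm] := choice Hnu.
  have -> : b = tens [multinom m p | p < n] [ffun p => nu p].
    by apply/ffunP => p; rewrite !ffunE mnmE.
  exact: pure_tens_span.
rewrite -(fupd_id b p); elim/polysum_ind: (b p) => [|c i d u Su].
  by rewrite (@pure0l _ p) ?ffunE ?eqxx //; apply: span0.
rewrite pure_lin; apply: span_lin => //; apply: IH => q ql.
rewrite ffunE; case: eqP => [_|/eqP qp]; first by exists i, d.
by apply: Hb; rewrite inE negb_or qp.
Qed.

Lemma wreath_span (v : W) : span bW (fun=> True) v.
Proof.
elim/pmod_ind: v => [[a h]||c v v' Sv Sv']; [|exact: span0|exact: span_lin].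
rewrite -/(pure a h); elim: (nhw_span h) => [|c w h' _ _ IH].
  by rewrite pure0r; apply: span0.
rewrite pureD pureZ; apply: span_lin => //.
case: (word_cases HJ w) => [[u Ju wu]|[b [i [b' wb]]]].
  by rewrite (nhw_braid_eq wu); apply: pure_word_span.
by rewrite (nhw_braid_eq wb) nhw_square pure0r; apply: span0.
Qed.

(** The dual forms are products of one coefficient form on each tensor factor
    with a form on the nil Hecke algebra. *)
Lemma wreath_independent : independent bW.
Proof.
apply: independent_dual => -[[[w0 Jw0] m0] nu0].
have [c [cD cE]] := nhw_dual HJ Jw0; pose v := word_perm w0.
pose f (x : {ffun 'I_n -> A} * NH) : k^o :=
  (\prod_p (x.1 p (nu0 (v p)))`_(m0 (v p))) * (c x.2)%:~R.
have Rf : wr_rel f.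
  split=> [a p d u u' h|a h h']; rewrite /f /=; last by rewrite cD rmorphD mulrDr.
  have E z : \prod_q (fupd a p z q (nu0 (v q)))`_(m0 (v q)) =
      (z (nu0 (v p)))`_(m0 (v p)) * \prod_(q | q != p) (a q (nu0 (v q)))`_(m0 (v q)).
    rewrite (bigD1 p) //= !ffunE eqxx; congr (_ * _).
    by apply: eq_bigr => q /negPf qp; rewrite ffunE qp.
  rewrite !E [(d *: u + u') _]psE [(d *: u) _]psE coefD coefZ.
  by rewrite !mulrDl -!mulrA.
pose psi : {linear W -> k^o} := HB.pack_for {linear W -> k^o} (pmod_lift f)
  (GRing.isLinear.Build k W k^o *:%R _ (pmod_lift_linear Rf)).
exists psi => -[[[w Jw] m] nu]; change (pmod_lift f (bW (exist _ w Jw, m, nu)) =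
  ((exist _ w Jw, m, nu) == (exist _ w0 Jw0, m0, nu0) :> T)%:R).
rewrite /basis_mon w_word_mon (pmod_lift_gen Rf) /f /= cE // !xpair_eqE.
have -> : (exist _ w Jw == exist _ w0 Jw0 :> {w | J w}) = (w == w0 :> word).
  by apply/eqP/eqP => [[]|E] //; apply: val_inj.
case: (w =P w0 :> word) => [->|_] /=; last by rewrite mulr0z mulr0.
rewrite mulr1z mulr1.
have fE p : (wact w0 (tens m nu) p (nu0 (v p)))`_(m0 (v p)) =
    ((m (v p) == m0 (v p)) && (nu (v p) == nu0 (v p)))%:R.
  rewrite wactE ffunE ps_singleE andbC eq_sym; case: eqP => _; last by rewrite coef0.
  by rewrite coefXn eq_sym.
under eq_bigr => p _ do rewrite fE.
have [/andP[/eqP -> /eqP ->]|ne] := boolP ((m == m0) && (nu == nu0)).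
  by rewrite big1 // => p _; rewrite !eqxx.
have [p Hp] : exists p, ~~ ((m p == m0 p) && (nu p == nu0 p)).
  apply/existsP; apply: contraNT ne; rewrite negb_exists => /forallP H.
  by apply/andP; split; apply/eqP; [apply/mnmP|apply/ffunP] => p;
    move: (H p); rewrite negbK => /andP[/eqP E1 /eqP E2].
by rewrite (bigD1 (v^-1%g p)) //= permKV (negPf Hp) mul0r.
Qed.

Lemma wreath_basis : is_basis bW.
Proof. by split; [apply: generatingE wreath_span | exact: wreath_independent]. Qed.
End WreathBasis.

(** * The PBW property *)

Section PBW.
Variables (k : comNzRingType) (I : choiceType) (n : nat).
Variable Q : I -> I -> {mpoly k[2]}.
Local Notation L := {ffun 'I_n -> I}.
Local Notation word := (seq 'I_n.-1).
Local Notation W := (wreath (polysum k I) n).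
Local Notation G := (gr (@klr_filtration k I n Q)).
Local Notation welt := (@w_elt k I n).
Local Notation gelt := (@gr_elt k I n Q).

Let Wg := @w_elt_graded k I n.
Let Gg := @gr_elt_graded k I n Q.

Variables (J : pred word) (HJ : reduced_family J).
Local Notation bW := (basis_mon (J := J) welt).
Local Notation bG := (basis_mon (J := J) gelt).

Lemma pbw_morphism_elt (phi : {linear W -> G}) :
  pbw_morphism phi -> forall g, phi (welt g) = gelt g.
Proof. by case=> _ H1 Hx Ht [nu|p nu|i nu]; [exact: H1 | exact: Hx | exact: Ht]. Qed.

Lemma pbw_morphism_basis (phi : {linear W -> G}) :
  pbw_morphism phi -> forall t, phi (bW t) = bG t.
Proof.
move=> Hphi; have phiE := pbw_morphism_elt Hphi; have [phiM _ _ _] := Hphi.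
move=> [[u m] nu]; rewrite /basis_mon /word_mon /=; elim: (val u) => [|i w IH] /=.
  elim/mnm_ind: m => [|p m IH]; first by rewrite !xmon0 phiE.
  by rewrite (xmonU (grd_quiver Wg)) (xmonU (grd_quiver Gg)) phiM phiE IH.
by rewrite phiM IH; congr (_ ** _); apply: (phiE (GTau _ _)).
Qed.

Lemma pbw_basis : pbw_property n Q -> is_basis (klr_S Q J).
Proof.
case=> phi [Hphi [psi phiK _]]; split; first exact: klr_S_generating.
apply: klr_S_independent_gr => c; rewrite -/(fscomb _ _) => c0.
apply: (wreath_independent HJ (k := k) (I := I)).
rewrite -/(fscomb _ _) -[LHS]phiK -[RHS]phiK linear0 linear_fscomb -c0; congr psi.
by apply: eq_bigr => t _; rewrite /= (pbw_morphism_basis Hphi).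
Qed.

(** Both families are bases indexed by the same set, on which left
    multiplication by the generators is given by the same table; hence the
    linear bijection between them is multiplicative. *)
Lemma basis_pbw : is_basis (klr_S Q J) -> pbw_property n Q.
Proof.
move=> HS; have HW := @wreath_basis k I n J HJ.
have HG : is_basis bG.
  by split; [apply: generatingE; apply: gr_span | apply: gr_independent].
have [phi phiE] := basis_extend HW bG.
have [psi psiE] := basis_extend HG bW.
have phi_gen g b : phi (welt g ** b) = gelt g ** phi b.
  apply: span_intertwine (wreath_span HJ b) => t.
  case: (graded_table k HJ g t) => [H0|[t' Ht']].
    by rewrite (H0 _ _ Wg) linear0 phiE (H0 _ _ Gg).
  by rewrite (Ht' _ _ Wg) !phiE (Ht' _ _ Gg).
have phi_one nu : phi (welt (GOne nu)) = gelt (GOne nu).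
  have := phiE (exist _ [::] (nil_in_family HJ), 0%MM, nu).
  by rewrite /basis_mon /word_mon /= !xmon0.
have phi_elt g : phi (welt g) = gelt g.
  case: g => [nu|p nu|i nu]; first exact: phi_one.
    by rewrite -(mul_x_e (grd_quiver Wg)) phi_gen phi_one (mul_x_e (grd_quiver Gg)).
  by rewrite -(mul_t_e (grd_quiver Wg)) phi_gen phi_one (mul_t_e (grd_quiver Gg)).
pose good a := forall b, phi (a ** b) = phi a ** phi b.
have good_elt g : good (welt g) by move=> b; rewrite phi_gen phi_elt.
have goodM a b : good a -> good b -> good (a ** b).
  by move=> ga gb c; rewrite -nmulA ga gb ga nmulA.
have good_basis t : good (bW t).
  case: t => [[u m] nu]; rewrite /basis_mon /word_mon /=; elim: (val u) => [|i w IH] /=.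
    elim/mnm_ind: m => [|p m IH]; first by rewrite xmon0.
    by rewrite (xmonU (grd_quiver Wg)); apply: goodM.
  by apply: goodM IH; apply: (good_elt (GTau _ _)).
exists phi; split; last first.
  exists psi => a; first exact: span_cancel phiE psiE (wreath_span HJ a).
  exact: span_cancel psiE phiE (gr_span HJ a).
split=> [a|nu|p nu|i nu]; [|exact: (phi_elt (GOne nu))|exact: (phi_elt (GX p nu))|exact: (phi_elt (GTau i nu))].
exact: span_multiplicative good_basis (wreath_span HJ a).
Qed.
End PBW.

Theorem theorem3p7 (k : comNzRingType) (I : choiceType)
    (Q : I -> I -> {mpoly k[2]}) (Q0 : forall i, Q i i = 0)
    (n : nat) (n_ge2 : (2 <= n)%N)
    (J : pred (seq 'I_n.-1)) (HJ : reduced_family J) :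
  (pbw_property n Q <-> is_basis (klr_S Q J)) /\
  (is_basis (klr_S Q J) <->
   forall i j, Q i j = Q j i \mPo [tuple 'X_1; 'X_0]).
Proof.
have n1 : (0 < n.-1)%N by case: n n_ge2 {J HJ} => [|[]].
split; split.
- exact: pbw_basis.
- exact: basis_pbw.
- by move=> HS; apply: (basis_symmetric HJ (Ordinal n1)).
- move=> Qsym; split; first exact: klr_S_generating.
  exact: klr_S_independent.
Qed.
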